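(* Let $\Phi$ be an Orlicz function. Suppose that at least one of the following holds for some constant $C_\Phi>0$ depending only on $\Phi$: (i) for every $n\in\mathbb N$ and every sequence $\{f_k\}_{k=1}^n$ of independent random variables from $L_\Phi[0,1]$ satisfying $\sum_{k=1}^n\mathbb P(\mathrm{supp}(f_k))\le1$, one has $$\mathbb{E}\Big(\Phi\big(\sum_{k=1}^n f_k\big)\Big)\le C_\Phi\,\mathbb E\Big(\Phi\big(\bigoplus_{k=1}^n f_k\big)\Big);$$ (ii) for every noncommutative probability space $(\mathcal M,\tau)$, every $n\in\mathbb N$ and every sequence $\{x_k\}_{k=1}^n$ of freely independent random variables from $L_\Phi(\mathcal M,\tau)$ satisfying $\sum_{k=1}^n\tau(\mathrm{supp}(x_k))\le1$, one has $$\tau\Big(\Phi\big(\big|\sum_{k=1}^n x_k\big|\big)\Big)\le C_\Phi\,\tau\Big(\Phi\big(\bigoplus_{k=1}^n x_k\big)\Big).$$ Then $\Phi$ satisfies the $\Delta_2$-condition.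
   Context: An Orlicz function is an even convex function $\Phi:\mathbb R\to[0,\infty)$ with $\Phi(0)=0$; it satisfies the $\Delta_2$-condition if there is $C$ with $\Phi(2t)\le C\Phi(t)$ for all $t>0$. Classical notions: random variables are a.e. finite real-valued measurable functions on $(0,1)$ with Lebesgue measure $\mathbb P$, $\mathbb E(g)=\int_0^1g$. $L_\Phi[0,1]$ is the set of measurable $g$ with $\|g\|_{L_\Phi}=\inf\{\lambda>0:\int_0^1\Phi(g(t)/\lambda)\,dt\le1\}<\infty$. $\bigoplus_k f_k$ is a sum of disjointly supported functions $g_k$ with $g_k$ equimeasurable with $f_k$; when $\sum_k\mathbb P(\mathrm{supp} f_k)\le1$ it is viewed as a function on $(0,1)$, so $\mathbb E(\Phi(\bigoplus_k f_k))=\sum_k\mathbb E(\Phi(f_k))$. Noncommutative notions: a noncommutative probability space $(\mathcal M,\tau)$ is a finite von Neumann algebra with a faithful normal trace $\tau$, $\tau(1)=1$. $S(\mathcal M,\tau)$ is the $*$-algebra of $\tau$-measurable operators; random variables are its self-adjoint elements. $\mu(t,x)=\inf\{s>0:\tau(e_{(s,\infty)}(|x|))\le t\}$; $L_\Phi(\mathcal M,\tau)=\{x\in S(\mathcal M,\tau):\mu(x)\in L_\Phi[0,1]\}$. $\mathrm{supp}(x)$ is the projection onto the closure of the range of $|x|$. Von Neumann subalgebras $\mathcal M_i$ are freely independent if $\tau(y_1\cdots y_m)=0$ for every $m$ whenever $y_j\in\mathcal M_{i_j}$, $i_1\ne i_2\ne\cdots\ne i_m$, $\tau(y_j)=0$;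 random variables are freely independent if the von Neumann subalgebras they generate are. $\bigoplus_k x_k$ is the operator $\sum_k x_k\otimes e_k$ affiliated with $\mathcal M\otimes\ell_\infty$ with trace $\tau\otimes\#$ ($\#$ counting measure), so the expression $\tau(\Phi(\bigoplus_k x_k))$ equals $\sum_k\tau(\Phi(|x_k|))$. *)

(* Defs.v *)
From HB Require Import structures.
From mathcomp Require Import all_boot all_order all_algebra.
From mathcomp Require Import sesquilinear.
From mathcomp Require Import all_classical all_reals all_analysis.
From mathcomp Require Import complex.

Set Implicit Arguments.
Unset Strict Implicit.
Unset Printing Implicit Defensive.

Import Order.TTheory GRing.Theory Num.Theory Num.Def.
Import numFieldNormedType.Exports.

Local Open Scope classical_set_scope.
Local Open Scope complex_scope.
Local Open Scope ring_scope.

Section Classical.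
Context {R : realType}.
Implicit Types (Phi g h : R -> R) (A : set R).

Definition orlicz_function Phi : Prop :=
  [/\ forall t, 0 <= Phi t,
      forall t, Phi (- t) = Phi t,
      convex_function (E := R^o) setT Phi &
      Phi 0 = 0].

Definition Delta2 Phi : Prop :=
  exists C : R, forall t, 0 < t -> Phi (2 * t) <= C * Phi t.

Definition I01 : set R := `]0, 1[.

Definition Pr A : \bar R := lebesgue_measure (A `&` I01).

Definition EPhi Phi g : \bar R :=
  (\int[lebesgue_measure]_(t in I01) (Phi (g t))%:E)%E.

Definition norm_LPhi Phi g : \bar R :=
  ereal_inf [set l%:E | l in
    [set l : R | 0 < l /\ (EPhi Phi (fun t => (g t / l)%R) <= 1)%E]].

Definition in_LPhi Phi g : Prop :=
  measurable_fun I01 g /\ (norm_LPhi Phi g < +oo)%E.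

Definition fsupp g : set R := [set t | g t != 0].

Definition independent n (f : 'I_n -> R -> R) : Prop :=
  forall B : 'I_n -> set R, (forall k, measurable (B k)) ->
    Pr (\bigcap_k (f k @^-1` B k)) = (\prod_(k < n) Pr (f k @^-1` B k))%E.

Definition equimeasurable g h : Prop :=
  forall B : set R, measurable B -> Pr (g @^-1` B) = Pr (h @^-1` B).

(* [g] is a version on (0, 1) of the disjoint sum of the [f k]; such a [g]
   exists iff the measures of the supports sum up to at most 1. *)
Definition disjoint_sum n (f : 'I_n -> R -> R) g : Prop :=
  exists h : 'I_n -> R -> R,
    [/\ forall k, measurable_fun I01 (h k),
        forall k, equimeasurable (h k) (f k),
        forall j k, j != k -> fsupp (h j) `&` fsupp (h k) `&` I01 = set0 &
        forall t, I01 t -> g t = \sum_(k < n) h k t].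

Definition classical_estimate Phi (C : R) : Prop :=
  forall (n : nat) (f : 'I_n -> R -> R), (0 < n)%N ->
    (forall k, in_LPhi Phi (f k)) ->
    independent f ->
    (\sum_(k < n) Pr (fsupp (f k)) <= 1)%E ->
    forall g, disjoint_sum f g ->
      (EPhi Phi (fun t => (\sum_(k < n) f k t)%R) <= C%:E * EPhi Phi g)%E.

End Classical.

Record hilbertSpace (R : realType) := HilbertSpace {
  hilbert_sort :> completeNormedModType R[i];
  hdot : {dot hilbert_sort for conjC};
  hdotE : forall u : hilbert_sort, `|u| ^+ 2 = hdot u u
}.

Section Operators.
Context {R : realType} {H : hilbertSpace R}.
Implicit Types (T S p u : H -> H) (M N : set (H -> H)) (E : set R -> H -> H).

Local Notation "''[' x , y ]" := (@hdot R H x y) : ring_scope.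

Definition bounded_op T : Prop :=
  (forall (a : R[i]) x y, T (a *: x + y) = a *: T x + T y) /\ continuous T.

Definition adjoint_of T S : Prop := forall x y, '[T x, y] = '[x, S y].

Definition projection p : Prop :=
  [/\ bounded_op p, p \o p = p & adjoint_of p p].

(* The order of [R[i]] makes [0 <= z] say that [z] is real and nonnegative. *)
Definition positive_op T : Prop := forall x, 0 <= '[T x, x].

Definition le_op S T : Prop := positive_op (fun x => T x - S x).

Definition commutant M : set (H -> H) :=
  [set S | bounded_op S /\ forall T, M T -> S \o T = T \o S].

Definition von_neumann_algebra M : Prop :=
  [/\ forall T, M T -> bounded_op T,
      forall T, M T -> exists2 S, M S & adjoint_of T S &
      commutant (commutant M) = M].

Definition finite_algebra M : Prop :=
  forall u v, M u -> M v -> adjoint_of u v -> v \o u = id -> u \o v = id.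

Definition directed (D : set (H -> H)) : Prop :=
  D !=set0 /\
  forall S T, D S -> D T -> exists U, [/\ D U, le_op S U & le_op T U].

Definition op_lub M (D : set (H -> H)) T : Prop :=
  [/\ M T, forall S, D S -> le_op S T &
      forall U, M U -> (forall S, D S -> le_op S U) -> le_op T U].

Definition normal_functional M (tau : (H -> H) -> R[i]) : Prop :=
  forall (D : set (H -> H)) T,
    (forall S, D S -> M S /\ positive_op S) -> directed D -> op_lub M D T ->
    (forall S, D S -> tau S <= tau T) /\
    (forall c : R[i], (forall S, D S -> tau S <= c) -> tau T <= c).

(* [tau] is only meaningful on [M]. *)
Record faithful_normal_tracial_state M (tau : (H -> H) -> R[i]) : Prop := {
  tau_linear : forall (a : R[i]) S T, M S -> M T ->
    tau (fun x => a *: S x + T x) = a * tau S + tau T;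
  tau_ge0 : forall T, M T -> positive_op T -> 0 <= tau T;
  tau_faithful : forall T, M T -> positive_op T -> tau T = 0 -> T = fun=> 0;
  tau_trace : forall S T, M S -> M T -> tau (S \o T) = tau (T \o S);
  tau_normal : normal_functional M tau;
  tau1 : tau id = 1
}.

Implicit Types x y a : set (H * H).

Definition dom x : set H := [set xi | exists eta, x (xi, eta)].
Definition ran x : set H := [set eta | exists xi, x (xi, eta)].

Definition closed_operator x : Prop :=
  [/\ x (0, 0),
      forall (c : R[i]) xi eta xi' eta', x (xi, eta) -> x (xi', eta') ->
        x (c *: xi + xi', c *: eta + eta'),
      forall xi eta eta', x (xi, eta) -> x (xi, eta') -> eta = eta',
      dense (dom x) & closed x].

Definition op_adj x : set (H * H) :=
  [set z | forall xi eta, x (xi, eta) -> '[eta, z.1] = '[xi, z.2]].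

Definition self_adjoint x : Prop := dense (dom x) /\ op_adj x = x.

Definition op_comp x y : set (H * H) :=
  [set z | exists w, y (z.1, w) /\ x (w, z.2)].

(* The sum in the algebra of measurable operators: closure of the algebraic
   sum, which is defined on the intersection of the domains. *)
Definition strong_add x y : set (H * H) :=
  closure [set z | exists eta eta',
    [/\ x (z.1, eta), y (z.1, eta') & z.2 = eta + eta']].

Definition op_zero : set (H * H) := [set z | z.2 = 0].

Definition strong_sum n (x : 'I_n -> set (H * H)) : set (H * H) :=
  \big[strong_add/op_zero]_(k < n) x k.

(* [a = |x|], the positive square root of [x^* x] *)
Definition modulus_of x a : Prop :=
  [/\ self_adjoint a, forall xi eta, a (xi, eta) -> 0 <= '[eta, xi] &
      op_comp a a = op_comp (op_adj x) x].

Definition spectral_distr E (xi : H) (A : set R) : \bar R :=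
  (complex.Re '[E A xi, xi])%:E.

(* [E] is the projection-valued measure with [a = \int l dE(l)], the latter
   having domain { xi | \int l^2 d<E(l) xi, xi> < +oo }. Only the values of [E]
   on Borel sets matter. *)
Definition spectral_measure_of a E : Prop :=
  [/\ forall A, measurable A -> projection (E A),
      E setT = id,
      forall xi, semi_sigma_additive (spectral_distr E xi),
      forall xi, dom a xi <->
        (\int[spectral_distr E xi]_l (l ^+ 2)%:E < +oo)%E &
      forall xi eta, a (xi, eta) ->
        '[eta, xi] = (fine (\int[spectral_distr E xi]_l l%:E)%E)%:C].

Definition affiliated M x : Prop :=
  forall u v, commutant M u -> adjoint_of u v -> v \o u = id -> u \o v = id ->
    forall xi eta, x (xi, eta) -> x (u xi, u eta).

Definition generated_algebra M x : set (H -> H) :=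
  [set T | forall N, von_neumann_algebra N -> N `<=` M -> affiliated N x -> N T].

Definition proj_onto (V : set H) : H -> H :=
  get [set p : H -> H | projection p /\ range p = V].

(* The product [y 0 \o ... \o y m] has [m.+1] factors. *)
Definition free_algebras (tau : (H -> H) -> R[i]) n
    (A : 'I_n -> set (H -> H)) : Prop :=
  forall (m : nat) (i : nat -> 'I_n) (y : nat -> H -> H),
    (forall j, (j < m)%N -> i j != i j.+1) ->
    (forall j, (j < m.+1)%N -> A (i j) (y j) /\ tau (y j) = 0) ->
    tau (\big[(fun S T => S \o T)/id]_(j < m.+1) y j) = 0.

End Operators.

Record ncProbSpace (R : realType) := NCProbSpace {
  nc_space : hilbertSpace R;
  nc_alg : set (nc_space -> nc_space);
  nc_tau : (nc_space -> nc_space) -> R[i];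
  nc_von_neumann : von_neumann_algebra nc_alg;
  nc_finite : finite_algebra nc_alg;
  nc_trace : faithful_normal_tracial_state nc_alg nc_tau
}.

(* An element of S(M, tau): a closed densely defined operator affiliated with M
   and defined on the ranges of projections of M of trace arbitrarily close
   to 1. It is bundled with its modulus and the spectral measure of its modulus,
   which exist and are unique (on Borel sets) by the spectral theorem. *)
Record measurableOperator (R : realType) (M : ncProbSpace R) :=
  MeasurableOperator {
  mo_graph :> set (nc_space M * nc_space M);
  mo_closed : closed_operator mo_graph;
  mo_affiliated : affiliated (@nc_alg R M) mo_graph;
  mo_measurable : forall e : R, 0 < e -> exists p : nc_space M -> nc_space M,
    [/\ nc_alg p, projection p, forall xi, dom mo_graph (p xi) &
        complex.Re (nc_tau (fun xi => xi - p xi)) <= e];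
  mo_abs : set (nc_space M * nc_space M);
  mo_absP : modulus_of mo_graph mo_abs;
  mo_spec : set R -> nc_space M -> nc_space M;
  mo_specP : spectral_measure_of mo_abs mo_spec
}.

Section Noncommutative.
Context {R : realType} {M : ncProbSpace R}.
Implicit Types (Phi : R -> R) (x : measurableOperator M).

Definition trace (T : nc_space M -> nc_space M) : R := complex.Re (nc_tau T).

Definition nc_supp x : nc_space M -> nc_space M :=
  proj_onto (closure (ran (mo_abs x))).

Definition singular_value x (t : R) : R :=
  inf [set s | 0 < s /\ trace (mo_spec x `]s, +oo[) <= t].

Definition in_nc_LPhi Phi x : Prop := in_LPhi Phi (singular_value x).

Definition nc_distr x (A : set R) : \bar R := (trace (mo_spec x A))%:E.

(* tau (Phi (|x|)), the trace of a positive operator \int f dE being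
   \int f d(tau \o E). *)
Definition tau_Phi Phi x : \bar R := (\int[nc_distr x]_l (Phi l)%:E)%E.

(* tau (Phi (x_1 \oplus ... \oplus x_n)): in the n-fold direct sum with trace
   tau \otimes #, the spectral measure is the direct sum of the spectral
   measures and the trace of a direct sum is the sum of the traces. *)
Definition tau_Phi_oplus Phi n (x : 'I_n -> measurableOperator M) : \bar R :=
  (\int[(fun A : set R => \sum_(k < n) nc_distr (x k) A)%E]_l (Phi l)%:E)%E.

Definition nc_random_variable x : Prop := self_adjoint x.

Definition freely_independent n (x : 'I_n -> measurableOperator M) : Prop :=
  free_algebras (@nc_tau R M)
    (fun k => generated_algebra (@nc_alg R M) (x k)).

End Noncommutative.

(* [s] ranges over the (unique) measurable operators whose graph is the sum. *)
Definition free_estimate (R : realType) (Phi : R -> R) (C : R) : Prop :=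
  forall (M : ncProbSpace R) (n : nat) (x : 'I_n -> measurableOperator M),
    (0 < n)%N ->
    (forall k, nc_random_variable (x k)) ->
    (forall k, in_nc_LPhi Phi (x k)) ->
    freely_independent x ->
    \sum_(k < n) trace (nc_supp (x k)) <= 1 ->
    forall s : measurableOperator M,
      mo_graph s = strong_sum (fun k => mo_graph (x k)) ->
      (tau_Phi Phi s <= C%:E * tau_Phi_oplus Phi x)%E.

(* Main.v *)
(* The hypotheses are tested on two-valued variables.

   In the classical case, f_1 and f_2 are t times the indicators of two independent
   events of probability 1/2. Their disjoint sum is the constant t, while their sum
   is 2 t with probability 1/4, whence Phi(2 t) <= 4 C Phi(t).

   In the free case, x_1 and x_2 are t times two free projections p and q of trace
   1/2. Their disjoint sum contributes Phi(t), and t (p + q) exceeds 3 t / 2 with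
   positive probability, whence Phi(3 t / 2) <= 8 C Phi(t); two iterations suffice
   since (3/2)^2 >= 2. The projections are realised in the crossed product of
   L^oo(-pi, pi) by the reflection sg : x |-> - x, as p = (1 + e^{ix/2} sg) / 2 and
   q = (1 + e^{-ix/2} sg) / 2. Then p + q = 1 + cos(x/2) sg, so that the spectral
   values of p + q above the point x are 1 + cos(x/2) and 1 - cos(x/2). Freeness
   amounts to the vanishing of the moments of e^{ix}, because alternating products of
   2 p - 1 and 2 q - 1 are powers of e^{ix} up to one factor e^{+-ix/2} sg. *)

From HB Require Import structures.
Require Import Defs.
From mathcomp Require Import all_boot all_order all_algebra.
From mathcomp Require Import sesquilinear ring lra.
From mathcomp Require Import all_classical all_reals all_analysis.
From mathcomp Require Import complex measurable_realfun.

Set Implicit Arguments.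
Unset Strict Implicit.
Unset Printing Implicit Defensive.

Import Order.TTheory GRing.Theory Num.Theory Num.Def.
Import numFieldNormedType.Exports.

Local Open Scope classical_set_scope.
Local Open Scope complex_scope.
Local Open Scope ring_scope.

(** * The Hilbert space of square-integrable complex functions *)

(** The free hypothesis speaks of concrete von Neumann algebras, so one has to be built with all
    that its record demands: equality with the double commutant, finiteness, a faithful normal
    trace. The crossed product is the von Neumann algebra of the infinite dihedral group Z/2 * Z/2,
    whose two generating symmetries are free by nature. Acting on L^2(-pi, pi) itself, it is the
    commutant of the multiplications by even functions, that is, the 2 x 2 matrices over L^oo(0,
    pi). Each element has two bounded coefficients, which turns every computation into one about
    functions. The spectral theorem is bypassed: all operators involved have the form f p + g (1 -
    p) with f, g even and nonnegative, and their spectral measures are written down from f and g.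
    The factor is 3/2 and not 2 because p + q has the spectral value 2 only on a null set. The
    constant 8 is the inverse of 1/2 times 1/4: the branch 1 + cos(x/2) carries half of the trace,
    and cos(x/2) >= 1/2 has probability at least 1/4. *)

Section ComplexSquare.
Context {R : realType}.
Implicit Types (z w : R[i]).

Definition sqn z : R := complex.Re z ^+ 2 + complex.Im z ^+ 2.

Lemma sqn_ge0 z : 0 <= sqn z.
Proof. by rewrite addr_ge0 ?sqr_ge0. Qed.

Lemma sqnE z : (sqn z)%:C = z * conjC z.
Proof.
case: z => a b; rewrite /sqn/=; apply/eqP; rewrite eq_complex/=.
by apply/andP; split; apply/eqP; rewrite /=; ring.
Qed.

Lemma ReD z w : complex.Re (z + w) = complex.Re z + complex.Re w.
Proof. by case: z w => ? ? []. Qed.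
Lemma ImD z w : complex.Im (z + w) = complex.Im z + complex.Im w.
Proof. by case: z w => ? ? []. Qed.
Lemma ReN z : complex.Re (- z) = - complex.Re z.
Proof. by case: z. Qed.
Lemma ImN z : complex.Im (- z) = - complex.Im z.
Proof. by case: z. Qed.
Lemma ReM z w : complex.Re (z * w) =
  complex.Re z * complex.Re w - complex.Im z * complex.Im w.
Proof. by case: z w => ? ? []. Qed.
Lemma ImM z w : complex.Im (z * w) =
  complex.Re z * complex.Im w + complex.Im z * complex.Re w.
Proof. by case: z w => ? ? []. Qed.
Lemma Re_conj z : complex.Re (conjC z) = complex.Re z.
Proof. by case: z. Qed.
Lemma Im_conj z : complex.Im (conjC z) = - complex.Im z.
Proof. by case: z. Qed.

Definition ReImE := (ReD, ImD, ReN, ImN, ReM, ImM, Re_conj, Im_conj).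

Lemma complex_ext z w : complex.Re z = complex.Re w ->
  complex.Im z = complex.Im w -> z = w.
Proof. by case: z w => ? ? [? ?] /= -> ->. Qed.

Lemma sqnM z w : sqn (z * w) = sqn z * sqn w.
Proof. by rewrite /sqn !ReImE; ring. Qed.

Lemma sqn_conj z : sqn (conjC z) = sqn z.
Proof. by rewrite /sqn !ReImE sqrrN. Qed.

Lemma sqnD_le z w : sqn (z + w) <= 2 * (sqn z + sqn w).
Proof.
rewrite /sqn !ReImE; move: (complex.Re z) (complex.Im z) (complex.Re w) (complex.Im w) => a b c e.
have := sqr_ge0 (a - c); have := sqr_ge0 (b - e); nra.
Qed.

Lemma sqn_eq0 z : (sqn z == 0) = (z == 0).
Proof. by rewrite /sqn paddr_eq0 ?sqr_ge0// !sqrf_eq0 eq_complex. Qed.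

Lemma sqn0 : sqn (0 : R[i]) = 0.
Proof. by apply/eqP; rewrite sqn_eq0. Qed.

Lemma sqn_real (r : R) : sqn r%:C = r ^+ 2.
Proof. by rewrite /sqn /= expr0n /= addr0. Qed.

Lemma normcE2 z : `|z| = (Num.sqrt (sqn z))%:C.
Proof. by rewrite normc_def. Qed.

End ComplexSquare.

(** * Complex-valued integrable and square-integrable functions *)

Section L2fun.
Context {d : measure_display} {T : measurableType d} {R : realType}.
Variable mu : {finite_measure set T -> \bar R}.
Implicit Types (f g h : T -> R[i]).

Definition cmeasurable f := measurable_fun setT (fun x => complex.Re (f x)) /\
  measurable_fun setT (fun x => complex.Im (f x)).

(** The bound holds everywhere and not just almost everywhere, so that sums, products and
    compositions with a map need no null sets; every class of L^oo has such a representative. *)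
Definition cbounded f := cmeasurable f /\ exists K : R, forall x, sqn (f x) <= K.

Definition aeeq f g := {ae mu, forall x, f x = g x}.

Definition L1fun f := mu.-integrable setT (EFin \o (fun x => complex.Re (f x))) /\
  mu.-integrable setT (EFin \o (fun x => complex.Im (f x))).

Definition L2fun f := cmeasurable f /\
  mu.-integrable setT (EFin \o (fun x => sqn (f x))).

Definition Cint f : R[i] :=
  (\int[mu]_x complex.Re (f x)) +i* (\int[mu]_x complex.Im (f x)).

Lemma cmeasurable_cst z : cmeasurable (fun _ => z).
Proof. by split; exact: measurable_cst. Qed.

Lemma cmeasurableD f g : cmeasurable f -> cmeasurable g ->
  cmeasurable (fun x => f x + g x).
Proof.
move=> [f1 f2] [g1 g2]; split.
- by under eq_fun do rewrite ReD; exact: measurable_funD.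
- by under eq_fun do rewrite ImD; exact: measurable_funD.
Qed.

Lemma cmeasurableM f g : cmeasurable f -> cmeasurable g ->
  cmeasurable (fun x => f x * g x).
Proof.
move=> [f1 f2] [g1 g2]; split.
- by under eq_fun do rewrite ReM; apply: measurable_funB; exact: measurable_funM.
- by under eq_fun do rewrite ImM; apply: measurable_funD; exact: measurable_funM.
Qed.

Lemma cmeasurable_conj f : cmeasurable f -> cmeasurable (fun x => conjC (f x)).
Proof.
move=> [f1 f2]; split.
- by under eq_fun do rewrite Re_conj.
- by under eq_fun do rewrite Im_conj; exact: measurable_funN.
Qed.

Lemma measurable_sqn f : cmeasurable f -> measurable_fun setT (fun x => sqn (f x)).
Proof.
move=> [f1 f2].
by apply: measurable_funD; exact: measurable_funX.
Qed.

Lemma cmeasurable_real (f : T -> R) : measurable_fun setT f ->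
  cmeasurable (fun x => (f x)%:C).
Proof. by move=> mf; split => //=; exact: measurable_cst. Qed.

Lemma L2fun_meas f : L2fun f -> cmeasurable f. Proof. by case. Qed.

Lemma L2fun_dom (c : R) h f g : cmeasurable h -> L2fun f -> L2fun g ->
  (forall x, sqn (h x) <= c * (sqn (f x) + sqn (g x))) -> L2fun h.
Proof.
move=> mh [_ f2] [_ g2] H; split => //.
have I := integrableZl measurableT c (integrableD measurableT f2 g2).
apply: le_integrable I => //.
- by apply/measurable_EFinP; exact: measurable_sqn.
- move=> x _ /=; rewrite lee_fin !ger0_norm ?sqn_ge0//.
  exact: le_trans (sqn_ge0 _) (H x).
Qed.

Lemma L2fun0 : L2fun (fun _ => 0).
Proof.
split; first exact: cmeasurable_cst.
rewrite [X in mu.-integrable _ X](_ : _ = cst 0%:E); first exact: integrable0.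
by apply/funext => x; rewrite /= sqn0.
Qed.

Lemma L2funD f g : L2fun f -> L2fun g -> L2fun (fun x => f x + g x).
Proof.
move=> f2 g2; apply: (L2fun_dom (c := 2) _ f2 g2).
- by apply: cmeasurableD; exact: L2fun_meas.
- by move=> x; exact: sqnD_le.
Qed.

Lemma L2funMb f g : cbounded f -> L2fun g -> L2fun (fun x => f x * g x).
Proof.
move=> [mf [K fK]] g2; apply: (L2fun_dom (c := K) _ g2 L2fun0).
- by apply: cmeasurableM => //; exact: L2fun_meas.
- by move=> x; rewrite sqnM sqn0 addr0 ler_wpM2r// sqn_ge0.
Qed.

Lemma cbounded_cst z : cbounded (fun _ => z).
Proof. by split; [exact: cmeasurable_cst|exists (sqn z)]. Qed.

Lemma cboundedD f g : cbounded f -> cbounded g -> cbounded (fun x => f x + g x).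
Proof.
move=> [mf [K fK]] [mg [L gL]]; split; first exact: cmeasurableD.
by exists (2 * (K + L)) => x; rewrite (le_trans (sqnD_le _ _))// ler_wpM2l// lerD.
Qed.

Lemma cboundedM f g : cbounded f -> cbounded g -> cbounded (fun x => f x * g x).
Proof.
move=> [mf [K fK]] [mg [L gL]]; split; first exact: cmeasurableM.
by exists (K * L) => x; rewrite sqnM ler_pM// sqn_ge0.
Qed.

Lemma cbounded_conj f : cbounded f -> cbounded (fun x => conjC (f x)).
Proof.
by move=> [mf [K fK]]; split; [exact: cmeasurable_conj|exists K => x; rewrite sqn_conj].
Qed.

Lemma cbounded_real (f : T -> R) : measurable_fun setT f ->
  (exists K, forall x, `|f x| <= K) -> cbounded (fun x => (f x)%:C).
Proof.
move=> mf [K fK]; split; first exact: cmeasurable_real.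
exists (K ^+ 2) => x; rewrite sqn_real -real_normK ?num_real//.
by rewrite ler_sqr ?nnegrE//; apply: le_trans (fK x).
Qed.

Lemma L2funZ z f : L2fun f -> L2fun (fun x => z * f x).
Proof. by move=> f2; apply: L2funMb => //; exact: cbounded_cst. Qed.

Lemma L2funN f : L2fun f -> L2fun (fun x => - f x).
Proof. by move=> /(L2funZ (-1)); under eq_fun do rewrite mulN1r. Qed.

Lemma L2fun_bounded f : cbounded f -> L2fun f.
Proof.
move=> [mf [K fK]]; split => //.
apply: (le_integrable measurableT _ _ (finite_measure_integrable_cst mu K measurableT)).
- by apply/measurable_EFinP; exact: measurable_sqn.
- move=> x _ /=; rewrite lee_fin !ger0_norm ?sqn_ge0//.
  exact: le_trans (sqn_ge0 _) (fK x).
Qed.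

Lemma L1fun_L2M f g : L2fun f -> L2fun g -> L1fun (fun x => f x * conjC (g x)).
Proof.
move=> f2 g2.
have [m1 m2] : cmeasurable (fun x => f x * conjC (g x)).
  apply: cmeasurableM; first exact: L2fun_meas.
  by apply: cmeasurable_conj; exact: L2fun_meas.
have I := integrableD measurableT f2.2 g2.2.
split; apply: (le_integrable measurableT _ _ I).
- exact/measurable_EFinP.
- move=> x _ /=; rewrite lee_fin [leRHS]ger0_norm; last by rewrite addr_ge0// sqn_ge0.
  rewrite !ReImE /sqn.
  move: (complex.Re (f x)) (complex.Im (f x)) (complex.Re (g x)) (complex.Im (g x)) => a b c e.
  have := sqr_ge0 (a - c); have := sqr_ge0 (b - e).
  have := sqr_ge0 (a + c); have := sqr_ge0 (b + e).
  by rewrite ler_norml => *; apply/andP; split; nra.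
- exact/measurable_EFinP.
- move=> x _ /=; rewrite lee_fin [leRHS]ger0_norm; last by rewrite addr_ge0// sqn_ge0.
  rewrite !ReImE /sqn.
  move: (complex.Re (f x)) (complex.Im (f x)) (complex.Re (g x)) (complex.Im (g x)) => a b c e.
  have := sqr_ge0 (a - e); have := sqr_ge0 (b - c).
  have := sqr_ge0 (a + e); have := sqr_ge0 (b + c).
  by rewrite ler_norml => *; apply/andP; split; nra.
Qed.

Lemma L1fun_cbounded f : cbounded f -> L1fun f.
Proof.
move=> bf.
rewrite [f](_ : _ = fun x => f x * conjC 1); last first.
  by apply/funext => x; rewrite conjC1 mulr1.
by apply: L1fun_L2M; apply: L2fun_bounded => //; exact: cbounded_cst.
Qed.

Lemma L1fun_meas f : L1fun f -> cmeasurable f.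
Proof. by move=> [/measurable_int/measurable_EFinP ? /measurable_int/measurable_EFinP ?]. Qed.

Lemma CintD f g : L1fun f -> L1fun g -> Cint (fun x => f x + g x) = Cint f + Cint g.
Proof.
move=> [f1 f2] [g1 g2]; rewrite /Cint.
under eq_Rintegral do rewrite ReD.
under [in X in _ +i* X]eq_Rintegral do rewrite ImD.
by rewrite !RintegralD.
Qed.

Lemma CintZ z f : L1fun f -> Cint (fun x => z * f x) = z * Cint f.
Proof.
move=> [f1 f2]; rewrite /Cint.
under eq_Rintegral do rewrite ReM.
under [in X in _ +i* X]eq_Rintegral do rewrite ImM.
have I1 c := integrableZl measurableT c f1.
have I2 c := integrableZl measurableT c f2.
rewrite RintegralB//; [|exact: I1|exact: I2].
rewrite RintegralD//; [|exact: I2|exact: I1].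
by rewrite !RintegralZl//; case: z.
Qed.

Lemma Cint_conj f : L1fun f -> Cint (fun x => conjC (f x)) = conjC (Cint f).
Proof.
move=> f1; apply: complex_ext => /=.
  by apply: eq_Rintegral => x _; case: (f x).
rewrite -mulN1r -RintegralZl//; last exact: f1.2.
by apply: eq_Rintegral => x _; rewrite Im_conj mulN1r.
Qed.

Lemma Cint_ae f g : cmeasurable f -> cmeasurable g -> aeeq f g -> Cint f = Cint g.
Proof.
move=> [f1 f2] [g1 g2] fg; apply: complex_ext; rewrite /= /Rintegral; congr fine;
  apply: ae_eq_integral => //; try exact/measurable_EFinP;
  by apply: filterS fg => x /= -> _.
Qed.

End L2fun.

(** Only semidefiniteness is assumed, because the inequality also serves for the form ['[T x, y]] of
    a positive operator, which may degenerate. The case [B y y = 0] therefore has an argument of its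
    own. *)
Lemma cauchy_schwarz_form (R : realType) (V : lmodType R[i])
    (B : V -> V -> R[i]) :
  (forall a x y z, B (a *: x + y) z = a * B x z + B y z) ->
  (forall x y, B y x = conjC (B x y)) -> (forall x, 0 <= B x x) ->
  forall x y, `|B x y| ^+ 2 <= B x x * B y y.
Proof.
move=> hl hc hp x y.
have hr a u v w : B u (a *: v + w) = conjC a * B u v + B u w.
  by rewrite hc hl rmorphD rmorphM /= -!hc.
have key a b : B (a *: x + b *: y) (a *: x + b *: y) =
    a * conjC a * B x x + a * conjC b * B x y + b * conjC a * B y x +
    b * conjC b * B y y.
  rewrite hl hr -[b *: y]addr0 hl !hr.
  have h0 u : B u 0 = 0.
    by have := hr 1 u 0 0; rewrite scaler0 addr0 rmorph1 mul1r => /eqP; rewrite -subr_eq0 opprD addNKr oppr_eq0 => /eqP.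
  have h0' u : B 0 u = 0 by rewrite hc h0 conjC0.
  by rewrite !h0 !h0'; ring.
rewrite normCK -hc.
have : B y y = 0 \/ 0 < B y y.
  by have := hp y; rewrite le_eqVlt => /orP[/eqP <-|]; [left|right].
case=> [y0|y0].
  have [->|xy0] := eqVneq (B x y) 0; first by rewrite mul0r mulr_ge0.
  (* On the line x + c y the form is affine in c when [B y y = 0]; this c is chosen to make its
     value -1. *)
  exfalso; have := hp ((1 : R[i]) *: x + (- (B x x + 1) / (2 * B y x)) *: y).
  have yx0 : B y x != 0 by rewrite hc conjC_eq0.
  have xxr : conjC (B x x) = B x x by rewrite -hc.
  have cxy : conjC (- (B x x + 1) / (2 * B y x)) = - (B x x + 1) / (2 * B x y).
    rewrite fmorph_div rmorphN rmorphD rmorphM /= xxr conjC1 conjC_nat.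
    by rewrite -(hc y x).
  rewrite key y0 mulr0 addr0 cxy rmorph1 mulr1 !mul1r.
  rewrite (_ : _ + _ = -1); first by rewrite oppr_ge0 ler10.
  by field; rewrite xy0 yx0.
have := hp (B y y *: x + (- B x y) *: y).
have yyr : conjC (B y y) = B y y by rewrite -hc.
rewrite key rmorphN /= yyr -hc.
rewrite (_ : _ + _ = B y y * (B x x * B y y - B x y * B y x)); last by ring.
by rewrite pmulr_rge0// subr_ge0.
Qed.

(** * The pre-Hilbert space of classes of square-integrable functions *)

Section L2space.
Context {d : measure_display} {T : measurableType d} {R : realType}.
Variable mu : {finite_measure set T -> \bar R}.
Implicit Types (f g h : T -> R[i]).

Definition L2class f : set (T -> R[i]) := [set g | L2fun mu g /\ aeeq mu g f].

(** A class is stored as the set of its members, so that almost everywhere equal functions give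
    equal vectors. The representative is only asserted to exist, hence proof irrelevance makes
    [L2set] injective. *)
Record L2 := MkL2 {
  L2set : set (T -> R[i]);
  L2setP : exists2 f, L2fun mu f & L2set = L2class f }.

Implicit Types u v w : L2.

HB.instance Definition _ := gen_eqMixin L2.
HB.instance Definition _ := gen_choiceMixin L2.

Lemma aeeq_refl f : aeeq mu f f.
Proof. exact: aeW. Qed.

Lemma aeeq_sym f g : aeeq mu f g -> aeeq mu g f.
Proof. by apply: filterS => x /= ->. Qed.

Lemma aeeq_trans g f h : aeeq mu f g -> aeeq mu g h -> aeeq mu f h.
Proof. by apply: filterS2 => x /= -> ->. Qed.

Lemma L2class_eq f g : aeeq mu f g -> L2class f = L2class g.
Proof.
move=> fg; apply/seteqP; split=> h [h2 hf]; split => //.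
- exact: aeeq_trans fg.
- exact: aeeq_trans (aeeq_sym fg).
Qed.

Definition rep u : T -> R[i] := xget (fun _ => 0) (L2set u).

Lemma rep_in u : L2set u (rep u).
Proof.
apply: xgetPex; have [f f2 ->] := L2setP u.
by exists f; split => //; exact: aeeq_refl.
Qed.

Lemma L2fun_rep u : L2fun mu (rep u).
Proof. by have := rep_in u; have [f f2 ->] := L2setP u => -[]. Qed.

Lemma L2set_rep u : L2set u = L2class (rep u).
Proof.
have := rep_in u; have [f f2 ->] := L2setP u => -[_ h].
by apply: L2class_eq; exact: aeeq_sym.
Qed.

(** Functions that are not square-integrable get the zero class, so that the operations below need
    no proof argument. *)
Definition cls f : L2 :=
  match pselect (L2fun mu f) with
  | left f2 => MkL2 (ex_intro2 _ _ f f2 erefl)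
  | right _ => MkL2 (ex_intro2 _ _ (fun _ => 0) (L2fun0 mu) erefl)
  end.

Lemma L2_inj u v : L2set u = L2set v -> u = v.
Proof.
case: u v => [A hA] [B hB] /= AB; subst B.
by congr MkL2; exact: Prop_irrelevance.
Qed.

Lemma L2setE f : L2fun mu f -> L2set (cls f) = L2class f.
Proof. by rewrite /cls; case: pselect. Qed.

Lemma rep_cls f : L2fun mu f -> aeeq mu (rep (cls f)) f.
Proof. by move=> f2; have := rep_in (cls f); rewrite L2setE// => -[]. Qed.

Lemma cls_eq f g : L2fun mu f -> L2fun mu g -> aeeq mu f g -> cls f = cls g.
Proof. by move=> f2 g2 fg; apply: L2_inj; rewrite !L2setE//; exact: L2class_eq. Qed.

Lemma repK u : cls (rep u) = u.
Proof. by apply: L2_inj; rewrite L2setE; [rewrite -L2set_rep|exact: L2fun_rep]. Qed.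

Lemma L2_ext u v : aeeq mu (rep u) (rep v) -> u = v.
Proof. by move=> h; rewrite -[u]repK -[v]repK; apply: cls_eq => //; exact: L2fun_rep. Qed.

Definition L2add u v := cls (fun x => rep u x + rep v x).
Definition L2opp u := cls (fun x => - rep u x).
Definition L2zero := cls (fun _ => 0).
Definition L2scale (a : R[i]) u := cls (fun x => a * rep u x).

Lemma rep_add u v : aeeq mu (rep (L2add u v)) (fun x => rep u x + rep v x).
Proof. by apply: rep_cls; apply: L2funD; exact: L2fun_rep. Qed.

Lemma rep_opp u : aeeq mu (rep (L2opp u)) (fun x => - rep u x).
Proof. by apply: rep_cls; apply: L2funN; exact: L2fun_rep. Qed.

Lemma rep_scale a u : aeeq mu (rep (L2scale a u)) (fun x => a * rep u x).
Proof. by apply: rep_cls; apply: L2funZ; exact: L2fun_rep. Qed.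

Lemma rep_zero : aeeq mu (rep L2zero) (fun _ => 0).
Proof. by apply: rep_cls; exact: L2fun0. Qed.

Lemma L2addA : associative L2add.
Proof.
move=> u v w; apply: L2_ext.
have h1 := rep_add u (L2add v w); have h2 := rep_add v w.
have h3 := rep_add (L2add u v) w; have h4 := rep_add u v.
apply: filterS2 (filterI h1 h2) (filterI h3 h4) => x [/= -> ->] [-> ->].
by rewrite addrA.
Qed.

Lemma L2addC : commutative L2add.
Proof.
move=> u v; apply: L2_ext; apply: filterS2 (rep_add u v) (rep_add v u) => x /= -> ->.
by rewrite addrC.
Qed.

Lemma L2add0 : left_id L2zero L2add.
Proof.
move=> u; apply: L2_ext; apply: filterS2 (rep_add L2zero u) rep_zero => x /= -> ->.
by rewrite add0r.
Qed.

Lemma L2addN : left_inverse L2zero L2opp L2add.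
Proof.
move=> u; apply: L2_ext.
apply: filterS3 (rep_add (L2opp u) u) (rep_opp u) rep_zero => x /= -> -> ->.
by rewrite addNr.
Qed.

HB.instance Definition _ := GRing.isZmodule.Build L2 L2addA L2addC L2add0 L2addN.

Lemma L2scaleA a b u : L2scale a (L2scale b u) = L2scale (a * b) u.
Proof.
apply: L2_ext; apply: filterS3 (rep_scale a (L2scale b u)) (rep_scale b u)
  (rep_scale (a * b) u) => x /= -> -> ->; by rewrite mulrA.
Qed.

Lemma L2scale1 : left_id 1 L2scale.
Proof.
by move=> u; apply: L2_ext; apply: filterS (rep_scale 1 u) => x /= ->; rewrite mul1r.
Qed.

Lemma L2scaleDr : right_distributive L2scale +%R.
Proof.
move=> a u v; apply: L2_ext.
have h1 := rep_scale a (L2add u v); have h2 := rep_add u v.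
have h3 := rep_add (L2scale a u) (L2scale a v).
have h4 := rep_scale a u; have h5 := rep_scale a v.
apply: filterS3 (filterI h1 h2) h3 (filterI h4 h5) => x [/= -> ->] -> [-> ->].
by rewrite mulrDr.
Qed.

Lemma L2scaleDl u : {morph L2scale^~ u : a b / a + b}.
Proof.
move=> a b; apply: L2_ext.
have h1 := rep_scale (a + b) u.
have h3 := rep_add (L2scale a u) (L2scale b u).
have h4 := rep_scale a u; have h5 := rep_scale b u.
apply: filterS3 h1 h3 (filterI h4 h5) => x /= -> -> [-> ->].
by rewrite mulrDl.
Qed.

HB.instance Definition _ := GRing.Zmodule_isLmodule.Build R[i] L2
  L2scaleA L2scale1 L2scaleDr L2scaleDl.

Lemma repD u v : aeeq mu (rep (u + v)) (fun x => rep u x + rep v x).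
Proof. exact: rep_add. Qed.

Lemma repN u : aeeq mu (rep (- u)) (fun x => - rep u x).
Proof. exact: rep_opp. Qed.

Lemma repZ a u : aeeq mu (rep (a *: u)) (fun x => a * rep u x).
Proof. exact: rep_scale. Qed.

Lemma rep0 : aeeq mu (rep 0) (fun _ => 0).
Proof. exact: rep_zero. Qed.

Lemma repB u v : aeeq mu (rep (u - v)) (fun x => rep u x - rep v x).
Proof. by apply: filterS2 (repD u (- v)) (repN v) => x /= -> ->. Qed.

Definition L2dot u v : R[i] := Cint mu (fun x => rep u x * conjC (rep v x)).

Lemma L1fun_repM u v : L1fun mu (fun x => rep u x * conjC (rep v x)).
Proof. by apply: L1fun_L2M; exact: L2fun_rep. Qed.

Lemma L2dotE u v f g : aeeq mu (rep u) f -> aeeq mu (rep v) g ->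
  L2fun mu f -> L2fun mu g -> L2dot u v = Cint mu (fun x => f x * conjC (g x)).
Proof.
move=> uf vg f2 g2; apply: Cint_ae.
- exact: L1fun_meas (L1fun_repM u v).
- by apply: (@L1fun_meas _ _ _ mu); exact: L1fun_L2M.
- by apply: filterS2 uf vg => x /= -> ->.
Qed.

Lemma L2dotC u v : L2dot u v = conjC (L2dot v u).
Proof.
rewrite /L2dot -Cint_conj; last exact: L1fun_repM.
by congr Cint; apply/funext => x; rewrite rmorphM /= conjCK mulrC.
Qed.

Lemma L2dot_linearl a u v w : L2dot (a *: u + v) w = a * L2dot u w + L2dot v w.
Proof.
have auw : L1fun mu (fun x => a * (rep u x * conjC (rep w x))).
  rewrite [X in L1fun _ X](_ : _ = fun x => (a * rep u x) * conjC (rep w x)).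
    by apply: L1fun_L2M; [apply: L2funZ|]; exact: L2fun_rep.
  by apply/funext => x; rewrite mulrA.
rewrite [in RHS]/L2dot -CintZ; last exact: L1fun_repM.
rewrite -CintD//; last exact: L1fun_repM.
rewrite (@L2dotE _ _ (fun x => a * rep u x + rep v x) (rep w)).
- by congr Cint; apply/funext => x; rewrite mulrDl mulrA.
- by apply: filterS2 (repD (a *: u) v) (repZ a u) => x /= -> ->.
- exact: aeeq_refl.
- by apply: L2funD; [apply: L2funZ|]; exact: L2fun_rep.
- exact: L2fun_rep.
Qed.

Lemma L2dot_linearr a u v w :
  L2dot w (a *: u + v) = conjC a * L2dot w u + L2dot w v.
Proof.
by rewrite L2dotC L2dot_linearl rmorphD rmorphM /= -!L2dotC.
Qed.

Definition L2sqn u : R := \int[mu]_x sqn (rep u x).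

Lemma L2dot_sqn u : L2dot u u = (L2sqn u)%:C.
Proof.
apply: complex_ext => /=.
  by apply: eq_Rintegral => x _; rewrite -sqnE.
rewrite (_ : (fun x => _) = fun=> 0); last by apply/funext => x; rewrite -sqnE.
by rewrite Rintegral_cst// mul0r.
Qed.

Lemma integrable_sqn_rep u : mu.-integrable setT (EFin \o (fun x => sqn (rep u x))).
Proof. exact: (L2fun_rep u).2. Qed.

Lemma L2sqn_ge0 u : 0 <= L2sqn u.
Proof. by apply: Rintegral_ge0 => x _; exact: sqn_ge0. Qed.

Lemma EFin_L2sqn u : (L2sqn u)%:E = (\int[mu]_x (sqn (rep u x))%:E)%E.
Proof.
rewrite /L2sqn /Rintegral fineK//.
by have := integrable_fin_num measurableT (integrable_sqn_rep u).
Qed.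

Lemma L2sqn_eq0 u : L2sqn u = 0 -> u = 0.
Proof.
move=> u0; apply: L2_ext; apply: aeeq_trans (aeeq_sym rep0).
have m : measurable_fun setT (EFin \o (fun x => sqn (rep u x))).
  by apply/measurable_EFinP; apply: measurable_sqn; exact: L2fun_meas (L2fun_rep u).
have /(ae_eq_integral_abs mu measurableT m) :
    (\int[mu]_x `|(sqn (rep u x))%:E| = 0)%E.
  under eq_integral do rewrite gee0_abs ?lee_fin ?sqn_ge0//.
  by rewrite -EFin_L2sqn u0.
by apply: filterS => x /= /(_ I)[] /eqP; rewrite sqn_eq0 => /eqP.
Qed.

Lemma L2dot_gt0 u : u != 0 -> 0 < L2dot u u.
Proof.
move=> u0; rewrite L2dot_sqn ltcR lt_neqAle L2sqn_ge0 andbT eq_sym.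
by apply: contra u0 => /eqP/L2sqn_eq0/eqP.
Qed.

Lemma L2dot_bilinear : bilinear_for
  (GRing.Scale.Law.clone _ _ ( *%R) _ : GRing.Scale.law R[i] R[i])
  (GRing.Scale.Law.clone _ _ (conjC \; *%R) _) L2dot.
Proof. by split=> [w|w] a u v; [exact: L2dot_linearl|exact: L2dot_linearr]. Qed.

HB.instance Definition _ := bilinear_isBilinear.Build R[i] L2 L2 R[i]
  _ _ L2dot L2dot_bilinear.

Lemma L2dot_herm u v : L2dot u v = (-1) ^+ false * conjC (L2dot v u).
Proof. by rewrite expr0 mul1r -L2dotC. Qed.

HB.instance Definition _ := isHermitianSesquilinear.Build R[i] L2 false conjC
  L2dot L2dot_herm.
HB.instance Definition _ := isDotProduct.Build R[i] L2 L2dot L2dot_gt0.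

Definition L2norm u : R[i] := (Num.sqrt (L2sqn u))%:C.

Lemma L2norm_sqr u : L2norm u ^+ 2 = L2dot u u.
Proof. by rewrite /L2norm L2dot_sqn -rmorphXn /= sqr_sqrtr// L2sqn_ge0. Qed.

Lemma L2norm_ge0 u : 0 <= L2norm u.
Proof. by rewrite lecR sqrtr_ge0. Qed.

Lemma L2dot_le u v : `|L2dot u v| <= L2norm u * L2norm v.
Proof.
rewrite -ler_sqr ?nnegrE ?mulr_ge0 ?L2norm_ge0// exprMn !L2norm_sqr.
apply: cauchy_schwarz_form => [|x y|x]; first exact: L2dot_linearl.
- exact: L2dotC.
- by rewrite L2dot_sqn lecR L2sqn_ge0.
Qed.

Lemma L2normD u v : L2norm (u + v) <= L2norm u + L2norm v.
Proof.
rewrite -ler_sqr ?nnegrE ?addr_ge0 ?L2norm_ge0// sqrrD !L2norm_sqr.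
have -> : L2dot (u + v) (u + v) = L2dot u u + (L2dot u v + L2dot v u) + L2dot v v.
  rewrite -{1 2}[u]scale1r !L2dot_linearl -[u in L2dot _ (u + v)]scale1r.
  by rewrite !L2dot_linearr rmorph1 !scale1r; ring.
rewrite lerD2r lerD2l.
have -> : L2dot u v + L2dot v u = 2 * (complex.Re (L2dot u v))%:C.
  rewrite [L2dot v u]L2dotC; case: (L2dot u v) => a b.
  by apply: complex_ext; rewrite /= ?ReImE/=; ring.
rewrite -[leRHS]mulr_natl ler_pM2l ?ltr0n//.
apply: le_trans (L2dot_le u v).
by rewrite (le_trans _ (normc_ge_Re _))// lecR ler_norm.
Qed.

Lemma L2normZ a u : L2norm (a *: u) = `|a| * L2norm u.
Proof.
apply/eqP; rewrite -(@eqrXn2 _ 2) ?mulr_ge0 ?L2norm_ge0// exprMn !L2norm_sqr.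
rewrite -[a *: u]addr0 L2dot_linearl L2dot_linearr normCK.
have h0 w : L2dot w 0 = 0.
  have := L2dot_linearr 1 0 0 w; rewrite scaler0 addr0 rmorph1 mul1r => /eqP.
  by rewrite eq_sym addrC -subr_eq0 addrK => /eqP.
rewrite [L2dot 0 _]L2dotC !h0 conjC0; apply/eqP; ring.
Qed.

Lemma L2norm_eq0 u : L2norm u = 0 -> u = 0.
Proof.
move=> u0; apply: L2sqn_eq0.
have : L2norm u ^+ 2 = 0 by rewrite u0 expr0n.
by rewrite L2norm_sqr L2dot_sqn => -[].
Qed.

HB.instance Definition _ := Lmodule_isNormed.Build R[i] L2 L2normD L2normZ L2norm_eq0.

End L2space.

Lemma limn_einf_le (R : realType) (u : (\bar R)^nat) (c : \bar R) (N : nat) :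
  (forall m, (N <= m)%N -> (u m <= c)%E) -> (limn_einf u <= c)%E.
Proof.
move=> H; rewrite limn_einf_lim; apply: lime_le; first exact: is_cvg_einfs.
apply: nearW => n; apply: le_trans (H (maxn N n) (leq_maxl _ _)).
by apply: ereal_inf_lbound; exists (maxn N n) => //=; exact: leq_maxr.
Qed.

(** * Riesz-Fischer theorem for a rapidly Cauchy sequence of real functions *)

Section RieszFischer.
Context {d : measure_display} {T : measurableType d} {R : realType}.
Variable mu : {finite_measure set T -> \bar R}.
Variable h : nat -> T -> R.
Hypothesis mh : forall n, measurable_fun setT (h n).
Hypothesis h_cauchy : forall n m, (n <= m)%N ->
  (\int[mu]_x ((h m x - h n x) ^+ 2)%:E <= ((1 / (2 ^ n.+1)%:R) ^+ 2)%:E)%E.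

Lemma cvg_summable_increments (x : T) :
  (\sum_(n <oo) (`|h n.+1 x - h n x|)%:E < +oo)%E -> cvgn (fun n => h n x : R^o).
Proof.
set L := (X in (X < _)%E) => Ly.
have L0 : (0 <= L)%E by apply: nneseries_ge0 => n _ _; rewrite lee_fin.
have Lf : L = (fine L)%:E by rewrite fineK// ge0_fin_numE.
have : cvgn (series (telescope (fun n => h n x : R^o))).
  apply: normed_cvg; apply: nondecreasing_is_cvgn.
    apply/nondecreasing_seqP => n; rewrite /normed_series_of.
    by rewrite seriesSr//= lerDl.
  exists (fine L) => _ [n _ <-]; rewrite -lee_fin -Lf /normed_series_of /series /= -sumEFin.
  by apply: nneseries_lim_ge => i _ _; rewrite lee_fin.
rewrite telescopeK => /cvg_ex[l hl]; apply/cvg_ex; exists (l + h 0%N x).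
rewrite (_ : (fun n => _) = (fun n => (h n x - h 0%N x) + h 0%N x)); last first.
  by apply/funext => n; rewrite subrK.
by apply: cvgD => //; exact: cvg_cst.
Qed.

(** With e = 2^(n+1), the inequality |y| <= e y^2 + 1/e turns the L^2 bound on the n-th increment
    into the L^1 bound (1 + mu(T)) / e. These bounds are summable, so the sum of the increments has
    finite integral. *)
Lemma ae_cvg_increments : {ae mu, forall x, 
  (\sum_(n <oo) (`|h n.+1 x - h n x|)%:E < +oo)%E}.
Proof.
have mg n : measurable_fun setT (fun x => `|h n.+1 x - h n x|%:E).
  by apply/measurable_EFinP; apply: measurableT_comp => //; exact: measurable_funB.
have : (\int[mu]_x (\sum_(n <oo) (`|h n.+1 x - h n x|)%:E) < +oo)%E.
  rewrite integral_nneseries//.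
  pose M := fine (mu setT).
  have ME : mu setT = M%:E by rewrite fineK// fin_num_measure.
  have M0 : 0 <= M by apply: fine_ge0.
  apply: (@le_lt_trans _ _ (1 + M)%:E); last exact: ltry.
  have := @epsilon_trick0 R (1 + M) xpredT (addr_ge0 ler01 M0).
  apply: le_trans; apply: lee_nneseries => [n _ _|n _].
    by apply: integral_ge0 => x _; rewrite lee_fin.
  set e := (2 ^ n.+1)%:R.
  have e0 : (0 : R) < e by rewrite ltr0n expn_gt0.
  apply: (@le_trans _ _ (\int[mu]_x ((e * (h n.+1 x - h n x) ^+ 2) + e^-1)%:E)%E).
    apply: ge0_le_integral => //.
    - apply/measurable_EFinP; apply: measurable_funD => //.
      by apply: measurable_funM => //; apply: measurable_funX; exact: measurable_funB.
    - move=> x _; rewrite lee_fin; set y := h n.+1 x - h n x.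
      have : 0 <= e^-1 * (e * `|y| - 1) ^+ 2 by rewrite mulr_ge0 ?sqr_ge0// invr_ge0 ltW.
      rewrite (_ : _ * _ = e * `|y| ^+ 2 + e^-1 - 2 * `|y|); last first.
        by field; rewrite gt_eqF.
      rewrite real_normK ?num_real//; have := normr_ge0 y; lra.
  under eq_integral do rewrite EFinD EFinM.
  have msq : measurable_fun setT (fun x => ((h n.+1 x - h n x) ^+ 2)%:E).
    by apply/measurable_EFinP; apply: measurable_funX; exact: measurable_funB.
  rewrite ge0_integralD//; first last.
  - by move=> x _; rewrite lee_fin invr_ge0 ltW.
  - by apply: emeasurable_funM.
  - by move=> x _; rewrite mule_ge0// lee_fin ?sqr_ge0// ltW.
  rewrite ge0_integralZl_EFin//; last by move=> x _; rewrite lee_fin sqr_ge0.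
  rewrite integral_cst// [X in (_ + _ * X)%E]ME -EFinM mulrDl EFinD -/e mul1r [M / e]mulrC.
  rewrite leeD2r//.
  apply: (@le_trans _ _ (e%:E * ((1 / e) ^+ 2)%:E)%E).
    by rewrite lee_pmul2l ?lte_fin// h_cauchy.
  by rewrite -EFinM lee_fin mul1r expr2 mulrA divff ?gt_eqF// mul1r.
move=> fin.
have : mu.-integrable setT (fun x => (\sum_(n <oo) (`|h n.+1 x - h n x|)%:E)%E).
  apply/integrableP; split.
    by apply: ge0_emeasurable_sum => // n x _ _; rewrite lee_fin.
  under eq_integral => x _.
    rewrite gee0_abs; last by apply: nneseries_ge0 => n _ _; rewrite lee_fin.
    over.
  exact: fin.
move=> /(integrable_ae measurableT); apply: filterS => x /(_ I).
by rewrite ge0_fin_numE// nneseries_ge0// => n _ _; rewrite lee_fin.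
Qed.

(** The sequence converges almost everywhere because its increments are summable, and Fatou's lemma
    in m carries the bound on h m - h n over to the limit. *)
Lemma riesz_fischer : exists2 k : T -> R, measurable_fun setT k &
  forall n, (\int[mu]_x ((k x - h n x) ^+ 2)%:E <= ((1 / (2 ^ n.+1)%:R) ^+ 2)%:E)%E.
Proof.
pose E := [set x | (\sum_(n <oo) (`|h n.+1 x - h n x|)%:E < +oo)%E].
have mg n : measurable_fun setT (fun x => `|h n.+1 x - h n x|%:E).
  by apply/measurable_EFinP; apply: measurableT_comp => //; exact: measurable_funB.
have mE : measurable E.
  rewrite -[E]setTI; apply: emeasurable_fun_infty_o => //.
  by apply: ge0_emeasurable_sum => // n x _ _; rewrite lee_fin.
(* Cutting off outside the convergence set makes the sequence converge everywhere, so the limit is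
   measurable and changes nothing up to a null set. *)
pose h' n x := \1_E x * h n x.
have mh' n : measurable_fun setT (h' n) by apply: measurable_funM.
pose k x : R := limn (fun n => h' n x : R^o).
have h'k x : (fun n => h' n x : R^o) @ \oo --> k x.
  rewrite /k /h' indicE; have [xE|xE] := boolP (x \in E).
    under eq_fun do rewrite mul1r.
    by apply: cvg_summable_increments; rewrite inE in xE.
  by under eq_fun do rewrite mul0r; exact: is_cvg_cst.
have mk : measurable_fun setT k.
  by apply: (@measurable_fun_cvg _ _ _ _ h') => // x _; exact: h'k.
exists k => // n.
have -> : (\int[mu]_x ((k x - h n x) ^+ 2)%:E = \int[mu]_x ((k x - h' n x) ^+ 2)%:E)%E.
  apply: ge0_ae_eq_integral => //.
  - by apply/measurable_EFinP; apply: measurable_funX; exact: measurable_funB.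
  - by apply/measurable_EFinP; apply: measurable_funX; exact: measurable_funB.
  - by move=> x _; rewrite lee_fin sqr_ge0.
  - by move=> x _; rewrite lee_fin sqr_ge0.
  - apply: filterS ae_cvg_increments => x xE _.
    by rewrite /h' indicE mem_set// mul1r.
pose f m x := ((h' m x - h' n x) ^+ 2)%:E.
have mf m : measurable_fun setT (f m).
  by apply/measurable_EFinP; apply: measurable_funX; exact: measurable_funB.
have f0 m x : setT x -> (0 <= f m x)%E by rewrite lee_fin sqr_ge0.
apply: le_trans (limn_einf_le (N := n) (u := fun m => (\int[mu]_x f m x)%E) _).
  have := fatou mu measurableT mf f0; apply: le_trans.
  rewrite le_eqVlt; apply/orP; left; apply/eqP; apply: eq_integral => x _.
  apply/esym; refine (cvg_limn_einf_sup _).1.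
  apply: cvg_EFin; first exact: nearW.
  rewrite /f /=.
  have := cvgM (cvgB (h'k x) (cvg_cst (h' n x : R^o))) (cvgB (h'k x) (cvg_cst (h' n x : R^o))).
  exact.
move=> m nm; apply: le_trans (h_cauchy nm).
apply: ge0_le_integral => //.
- by move=> x _; rewrite lee_fin sqr_ge0.
- by apply/measurable_EFinP; apply: measurable_funX; exact: measurable_funB.
- move=> x _; rewrite lee_fin /h' -mulrBr exprMn ler_piMl ?sqr_ge0//.
Qed.

End RieszFischer.

(** * Completeness of L^2 *)

Section L2complete.
Context {d : measure_display} {T : measurableType d} {R : realType}.
Variable mu : {finite_measure set T -> \bar R}.

Lemma L2_normE (u : L2 mu) : `|u| = (Num.sqrt (L2sqn u))%:C.
Proof. by []. Qed.

Lemma L2sqn_le (u : L2 mu) (e : R) : 0 <= e -> `|u| <= e%:C -> L2sqn u <= e ^+ 2.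
Proof.
move=> e0; rewrite L2_normE lecR => ue.
rewrite -[leLHS]sqr_sqrtr ?L2sqn_ge0// ler_sqr// nnegrE ?sqrtr_ge0//.
Qed.

Lemma L2norm_le (u : L2 mu) (e : R) : 0 <= e -> L2sqn u <= e ^+ 2 -> `|u| <= e%:C.
Proof.
move=> e0 ue; rewrite L2_normE lecR -[leRHS](ger0_norm e0) -sqrtr_sqr.
exact: ler_wsqrtr.
Qed.

Lemma measurable_rep (u : L2 mu) :
  measurable_fun setT (fun x => complex.Re (rep u x)) /\
  measurable_fun setT (fun x => complex.Im (rep u x)).
Proof. exact: L2fun_meas (L2fun_rep u). Qed.

Lemma integral_sqn_repB (u v : L2 mu) :
  (\int[mu]_x (sqn (rep u x - rep v x))%:E)%E = (L2sqn (u - v))%:E.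
Proof.
rewrite EFin_L2sqn; apply: ge0_ae_eq_integral => //.
- apply/measurable_EFinP/measurable_sqn/L2fun_meas/L2funD; first exact: L2fun_rep.
  by apply: L2funN; exact: L2fun_rep.
- exact/measurable_EFinP/measurable_sqn/L2fun_meas/L2fun_rep.
- by move=> x _; rewrite lee_fin sqn_ge0.
- by move=> x _; rewrite lee_fin sqn_ge0.
- by apply: filterS (repB u v) => x /= ->.
Qed.

Lemma L2_complete (F : set_system (L2 mu)) : ProperFilter F -> cauchy F -> cvg F.
Proof.
move=> FF /cauchyP Fc.
have [e eE] : {e : nat -> R | forall n, e n = 1 / (2 ^ n.+1)%:R} by eexists.
have e0 n : 0 < e n by rewrite eE divr_gt0// ltr0n expn_gt0.
have {}Fc n : exists x, F (ball x (e n / 2)%:C).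
  by apply: Fc; rewrite ltcR divr_gt0.
have [xs Fxs] := choice Fc.
(* Points of [A n] and [A m] with n <= m lie in the same n-th ball of radius e n / 2, whence the
   rate e n for the extracted sequence. Intersecting all earlier balls is what gives this for every
   pair. *)
pose A n := [set y | forall k, (k <= n)%N -> ball (xs k) (e k / 2)%:C y].
have FA n : F (A n).
  elim: n => [|n IHn].
    by apply: filterS (Fxs 0%N) => y ? k; rewrite leqn0 => /eqP ->.
  apply: filterS2 IHn (Fxs n.+1) => y Ay By k; rewrite leq_eqVlt => /orP[/eqP -> //|].
  by rewrite ltnS; exact: Ay.
have [u Au] := choice (fun n => filter_ex (FA n)).
have u_cauchy n m : (n <= m)%N -> `|u m - u n| <= (e n)%:C.
  move=> nm; have := Au m n nm; have := Au n n (leqnn n).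
  rewrite -!ball_normE /= => h1 h2.
  rewrite -(subrKA (xs n)); apply: le_trans (ler_normD _ _) _.
  rewrite distrC [e n]splitr rmorphD /=.
  by apply: lerD; [exact: ltW h2|exact: ltW h1].
(* [riesz_fischer] concerns real functions; it will be applied with g the real part and then the
   imaginary part. *)
have le_sq (g : R[i] -> R) (mg : forall n, measurable_fun setT (fun x => g (rep (u n) x))) :
    (forall z w, (g z - g w) ^+ 2 <= sqn (z - w)) -> forall n m, (n <= m)%N ->
    (\int[mu]_x ((g (rep (u m) x) - g (rep (u n) x)) ^+ 2)%:E <=
     ((1 / (2 ^ n.+1)%:R) ^+ 2)%:E)%E.
  move=> hg n m nm; rewrite -eE; apply: (@le_trans _ _ (L2sqn (u m - u n))%:E); last first.
    by rewrite lee_fin L2sqn_le ?u_cauchy// ltW// e0.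
  rewrite -integral_sqn_repB; apply: ge0_le_integral => //.
  - by move=> x _; rewrite lee_fin sqr_ge0.
  - by apply/measurable_EFinP; apply: measurable_funX; exact: measurable_funB.
  - apply/measurable_EFinP/measurable_sqn/L2fun_meas/L2funD; first exact: L2fun_rep.
    by apply: L2funN; exact: L2fun_rep.
  - by move=> x _; rewrite lee_fin.
have mRe n := (measurable_rep (u n)).1.
have mIm n := (measurable_rep (u n)).2.
have [k1 mk1 k1P] := riesz_fischer mRe (le_sq _ mRe
  ltac:(by move=> z w; rewrite /sqn !ReImE lerDl sqr_ge0)).
have [k2 mk2 k2P] := riesz_fischer mIm (le_sq _ mIm
  ltac:(by move=> z w; rewrite /sqn !ReImE lerDr sqr_ge0)).
pose f x := k1 x +i* k2 x.
have mf : cmeasurable f by split.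
have fle n : (\int[mu]_x (sqn (f x - rep (u n) x))%:E <= ((2 * e n) ^+ 2)%:E)%E.
  rewrite (_ : (\int[mu]_x _)%E = (\int[mu]_x ((k1 x - complex.Re (rep (u n) x)) ^+ 2)%:E +
      \int[mu]_x ((k2 x - complex.Im (rep (u n) x)) ^+ 2)%:E)%E); last first.
    rewrite -ge0_integralD//.
    - by apply: eq_integral => x _; rewrite -EFinD /sqn !ReImE.
    - by move=> x _; rewrite lee_fin sqr_ge0.
    - by apply/measurable_EFinP; apply: measurable_funX; exact: measurable_funB.
    - by move=> x _; rewrite lee_fin sqr_ge0.
    - by apply/measurable_EFinP; apply: measurable_funX; exact: measurable_funB.
  apply: le_trans (leeD (k1P n) (k2P n)) _.
  by rewrite -EFinD lee_fin -eE; have := sqr_ge0 (e n); lra.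
have fB2 n : L2fun mu (fun x => f x - rep (u n) x).
  have mfB : cmeasurable (fun x => f x - rep (u n) x).
    apply: cmeasurableD => //; apply: L2fun_meas; apply: L2funN; exact: L2fun_rep.
  split => //; apply/integrableP; split.
    by apply/measurable_EFinP; exact: measurable_sqn.
  under eq_integral do rewrite gee0_abs ?lee_fin ?sqn_ge0//.
  by apply: le_lt_trans (fle n) _; exact: ltry.
have f2 : L2fun mu f.
  rewrite [f](_ : _ = fun x => (f x - rep (u 0%N) x) + rep (u 0%N) x).
    by apply: L2funD => //; exact: L2fun_rep.
  by apply/funext => x; rewrite subrK.
pose v := cls mu f.
have vu n : `|v - u n| <= (2 * e n)%:C.
  apply: L2norm_le; first by rewrite mulr_ge0// ltW.
  rewrite -lee_fin -integral_sqn_repB; apply: le_trans (fle n).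
  rewrite le_eqVlt; apply/orP; left; apply/eqP; apply: ge0_ae_eq_integral => //.
  - apply/measurable_EFinP/measurable_sqn/L2fun_meas/L2funD; first exact: L2fun_rep.
    by apply: L2funN; exact: L2fun_rep.
  - by apply/measurable_EFinP/measurable_sqn/L2fun_meas.
  - by move=> x _; rewrite lee_fin sqn_ge0.
  - by move=> x _; rewrite lee_fin sqn_ge0.
  - by apply: filterS (rep_cls f2) => x /= ->.
apply/cvg_ex; exists v; apply/cvg_ballP => eps eps0.
have [r r0 ->] : exists2 r : R, 0 < r & eps = r%:C.
  by case: eps eps0 => r i; rewrite ltcE/= => /andP[/eqP -> r0]; exists r.
have [n nr] : exists n, 4 * e n < r.
  have [n /andP[_ hn]] : exists n : nat, true && (4 / r < n%:R).
    by have /andP[_ h] := truncn_itv (divr_ge0 (ler0n _ 4) (ltW r0)); exists (truncn (4 / r)).+1.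
  exists n; rewrite eE mul1r ltr_pdivrMr ?ltr0n ?expn_gt0// mulrC -ltr_pdivrMr//.
  by apply: lt_trans hn _; rewrite ltr_nat ltnW// ltn_expl.
apply: filterS (Fxs n) => y; have := Au n n (leqnn n); rewrite -!ball_normE /= => h1 h2.
have -> : v - y = (v - u n) - (xs n - u n) + (xs n - y) by rewrite opprB -addrA !subrKA.
apply: le_lt_trans (ler_normD _ _) _.
apply: (@le_lt_trans _ _ ((2 * e n)%:C + (e n / 2)%:C + (e n / 2)%:C)).
  apply: lerD (ltW h2); apply: le_trans (ler_normB _ _) _.
  by apply: lerD (vu n) (ltW h1).
rewrite -!rmorphD /= ltcR; apply: le_lt_trans nr.
by move: (e n) (e0 n) => a a0; clear -a0; lra.
Qed.

HB.instance Definition _ := Uniform_isComplete.Build (L2 mu) L2_complete.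

Definition L2hilbert : hilbertSpace R :=
  @HilbertSpace R (L2 mu) (@L2dot _ _ _ mu) (@L2norm_sqr _ _ _ mu).
End L2complete.

(** In the partial order of [R[i]] comparable numbers share their imaginary part, so closedness of
    the order needs both coordinates: Im w equals Im c and tends to Im z. *)
Lemma lec_approx (R : realType) (z c : R[i]) :
  (forall e : R, 0 < e -> exists2 w, w <= c & `|w - z| < e%:C) -> z <= c.
Proof.
move=> H; rewrite lecE.
have {}H e : 0 < e -> exists w, [/\ complex.Im c = complex.Im w, complex.Re w <= complex.Re c,
    `|complex.Re w - complex.Re z| < e & `|complex.Im w - complex.Im z| < e].
  move=> /H[w]; rewrite lecE => /andP[/eqP im re] wz; exists w; split => //.
    by rewrite -ltcR; apply: le_lt_trans wz; rewrite -ReN -ReD; exact: normc_ge_Re.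
  rewrite -ltcR; apply: le_lt_trans wz; rewrite -ImN -ImD.
  by rewrite normcE2 lecR -sqrtr_sqr ler_wsqrtr// /sqn lerDr sqr_ge0.
apply/andP; split.
  apply: contrapT => /negP imcz.
  have [|w [-> _ _]] := H `|complex.Im c - complex.Im z|.
    by rewrite normr_gt0 subr_eq0.
  by rewrite ltxx.
apply/ler_addgt0Pr => e /H[w [_ h1 h2 _]].
rewrite -lerBlDr; apply: le_trans h1; rewrite lerBlDr -lerBlDl.
by apply: le_trans (ltW h2); rewrite distrC ler_norm.
Qed.

(** * Bounded operators on a Hilbert space *)

Section Hilbert.
Context {R : realType} {H : hilbertSpace R}.
Implicit Types (x y z : H) (S T U : H -> H).

Local Notation "''[' x , y ]" := (@hdot R H x y) : ring_scope.

Lemma hdotC x y : '[y, x] = conjC '[x, y].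
Proof. by rewrite (hermC (hdot H)) expr0 mul1r. Qed.

Lemma hdotPl a x y z : '[a *: x + y, z] = a * '[x, z] + '[y, z].
Proof. by rewrite linearPl. Qed.

Lemma hdotPr a x y z : '[z, a *: x + y] = conjC a * '[z, x] + '[z, y].
Proof. by rewrite linearPr. Qed.

Lemma hdotDl x y z : '[x + y, z] = '[x, z] + '[y, z].
Proof. by rewrite linearDl. Qed.
Lemma hdotDr x y z : '[z, x + y] = '[z, x] + '[z, y].
Proof. by rewrite linearDr. Qed.
Lemma hdotBl x y z : '[x - y, z] = '[x, z] - '[y, z].
Proof. by rewrite linearBl. Qed.
Lemma hdotBr x y z : '[z, x - y] = '[z, x] - '[z, y].
Proof. by rewrite linearBr. Qed.
Lemma hdotZl a x z : '[a *: x, z] = a * '[x, z].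
Proof. by rewrite linearZl_LR. Qed.
Lemma hdotZr a x z : '[z, a *: x] = conjC a * '[z, x].
Proof. by rewrite linearZr_LR. Qed.
Lemma hdot0l x : '[0, x] = 0.
Proof. by rewrite linear0l. Qed.
Lemma hdot0r x : '[x, 0] = 0.
Proof. by rewrite linear0r. Qed.

Lemma hdot_ge0 x : 0 <= '[x, x].
Proof. by rewrite -hdotE exprn_ge0. Qed.

Lemma hdot_eq0 x : '[x, x] = 0 -> x = 0.
Proof. by rewrite -hdotE => /eqP; rewrite sqrf_eq0 normr_eq0 => /eqP. Qed.

Lemma hdot_inj x y : (forall z, '[z, x] = '[z, y]) -> x = y.
Proof.
move=> h; apply/eqP; rewrite -subr_eq0; apply/eqP/hdot_eq0.
by rewrite hdotBr h subrr.
Qed.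

Lemma hdot_le x y : `|'[x, y]| <= `|x| * `|y|.
Proof.
rewrite -ler_sqr ?nnegrE ?mulr_ge0// exprMn !hdotE.
by apply: cauchy_schwarz_form => [a u v w|u v|u]; [exact: hdotPl|exact: hdotC|exact: hdot_ge0].
Qed.

Definition linear_op T := forall (a : R[i]) x y, T (a *: x + y) = a *: T x + T y.

Lemma linear_op0 T : linear_op T -> T 0 = 0.
Proof.
move=> /(_ 1 0 0); rewrite !scale1r addr0 => /eqP.
by rewrite eq_sym -subr_eq0 addrK => /eqP.
Qed.

Lemma linear_opD T x y : linear_op T -> T (x + y) = T x + T y.
Proof. by move=> /(_ 1 x y); rewrite !scale1r. Qed.

Lemma linear_opZ T a x : linear_op T -> T (a *: x) = a *: T x.
Proof. by move=> l; have := l a x 0; rewrite (linear_op0 l) !addr0. Qed.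

Lemma linear_opB T x y : linear_op T -> T (x - y) = T x - T y.
Proof. by move=> l; rewrite linear_opD// -scaleN1r linear_opZ// scaleN1r. Qed.

Lemma bounded_opP T : bounded_op T <->
  linear_op T /\ exists2 K : R, 0 <= K & forall x, `|T x| <= K%:C * `|x|.
Proof.
split=> [[lT cT]|[lT [K K0 TK]]].
  split => //.
  pose L := HB.pack_for {linear H -> H} T (GRing.isLinear.Build _ _ _ _ T lT).
  have : bounded_near L (nbhs (0 : H)) by apply: continuous_linear_bounded; exact: cT.
  move=> /linear_boundedP [[y1 y2] [yr /(_ ((`|y1| + 1)%:C))]] /= h.
  exists (`|y1| + 1); first by rewrite addr_ge0.
  move: yr; rewrite complex_real => /eqP y20.
  by apply: h; rewrite y20 ltcR ltr_pwDr// ler_norm.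
split => // x; have K1 : 0 < (K + 1)%:C by rewrite ltcR ltr_pwDr.
apply/cvgrPdist_lt => e e0; near=> y; rewrite -linear_opB//.
apply: le_lt_trans (TK _) _.
apply: (@le_lt_trans _ _ ((K + 1)%:C * `|x - y|)).
  by rewrite ler_wpM2r// lecR lerDl.
rewrite -ltr_pdivlMl//; near: y; apply: cvgr_dist_lt => //.
by rewrite mulr_gt0// invr_gt0.
Unshelve. all: by end_near. Qed.

Lemma bounded_op_id : bounded_op (id : H -> H).
Proof. by split=> // x; exact: cvg_id. Qed.

Lemma bounded_op_lin a S T : bounded_op S -> bounded_op T ->
  bounded_op (fun x => a *: S x + T x).
Proof.
move=> [lS cS] [lT cT]; split=> [b x y /=|x].
  rewrite lT lS !scalerDr !scalerA [a * b]mulrC -!addrA; congr (_ + _).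
  by rewrite addrCA.
by apply: cvgD; [apply: cvgZr; exact: cS|exact: cT].
Qed.

(** A sesquilinear form that is real on the diagonal is Hermitian; the vectors x + y and i x + y
    yield the imaginary and the real part of the off-diagonal difference. *)
Lemma positive_op_herm T : linear_op T -> positive_op T ->
  forall x y, '[T y, x] = conjC '[T x, y].
Proof.
move=> lT pT x y.
have im z : complex.Im '[T z, z] = 0 by exact: ger0_Im (pT z).
have h1 := im (x + y); have h2 := im ('i *: x + y).
have := im x; have := im y.
move: h1 h2; rewrite (linear_opD _ _ lT) lT !hdotPl !hdotPr !hdotDl !hdotDr.
move: '[T x, x] '[T x, y] '[T y, x] '[T y, y] => [a1 a2] [b1 b2] [c1 c2] [e1 e2].
rewrite /= => h1 h2 e20 a20; apply: complex_ext => /=; rewrite ?ReImE /=; lra.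
Qed.

Lemma le_op_dot S T x : le_op S T -> '[S x, x] <= '[T x, x].
Proof. by move=> /(_ x); rewrite hdotBl subr_ge0. Qed.

(* Cauchy-Schwarz for the form <B x, y> at (x, B x). *)
Lemma positive_op_sqr (B : H -> H) (K : R) x : linear_op B -> positive_op B ->
  0 <= K -> (forall y, '[B y, y] <= K%:C * `|y| ^+ 2) ->
  `|B x| ^+ 2 <= K%:C * '[B x, x].
Proof.
move=> lB pB K0 BK.
have h : `| '[B x, B x] | ^+ 2 <= '[B x, x] * '[B (B x), B x].
  apply: (@cauchy_schwarz_form R H (fun x y => '[B x, y])) => //.
  - by move=> a u v w; rewrite lB hdotPl.
  - by move=> u v; exact: positive_op_herm.
have {}h := le_trans h (ler_wpM2l (pB x) (BK (B x))).
have [->|Bx0] := eqVneq (B x) 0.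
  by rewrite normr0 expr0n/= hdot0l mulr0.
have n0 : 0 < `|B x| ^+ 2 by rewrite exprn_gt0// normr_gt0.
rewrite -(ler_pM2r n0); move: h; rewrite -hdotE (ger0_norm (ltW n0)) => h.
by rewrite -expr2 -mulrA mulrCA.
Qed.

End Hilbert.

(** * Commutants and normality of vector states *)

Section HilbertAlgebras.
Context {R : realType} {H : hilbertSpace R}.
Implicit Types (x y z : H) (S T U p : H -> H) (M N D : set (H -> H)).

Local Notation "''[' x , y ]" := (@hdot R H x y) : ring_scope.

Lemma commutantS M N : M `<=` N -> commutant N `<=` commutant M.
Proof. by move=> MN S [bS cS]; split => // T /MN; exact: cS. Qed.

Lemma commutant2 M : (forall T, M T -> bounded_op T) ->
  M `<=` commutant (commutant M).
Proof. by move=> bM T MT; split; [exact: bM|move=> S [_ cS]; rewrite cS]. Qed.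

Lemma commutant3 M : (forall T, M T -> bounded_op T) ->
  commutant (commutant (commutant M)) = commutant M.
Proof.
move=> bM; apply/seteqP; split; first exact/commutantS/commutant2.
by apply: commutant2 => T [].
Qed.

Lemma adjoint_sym S T : adjoint_of S T -> adjoint_of T S.
Proof. by move=> h x y; rewrite hdotC -h -hdotC. Qed.

(** Equal ranges give q p = p and p q = q; self-adjointness of both then identifies them. *)
Lemma projection_uniq p q : projection p -> projection q ->
  range p = range q -> p = q.
Proof.
move=> [_ pp ap] [_ qq aq] pq.
have pK x : range p x -> p x = x by move=> [y _ <-]; rewrite -[RHS](congr1 (@^~ y) pp).
have qK x : range q x -> q x = x by move=> [y _ <-]; rewrite -[RHS](congr1 (@^~ y) qq).
apply/funext => x; apply: hdot_inj => z.
have e1 : q (p x) = p x by rewrite qK// -pq; exists x.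
have e2 : p (q z) = q z by rewrite pK// pq; exists z.
by rewrite -e1 -aq -ap e2 aq.
Qed.

(** [op_lub] is a purely order-theoretic supremum, so it must be related to the vectors. By Vigier's
    argument a bounded increasing net of positive operators converges strongly to some U. A
    commutant is strongly closed, so U is an upper bound inside it, whence T <= U, and the bound c
    passes to U by continuity. Two vectors appear because the trace below is a sum of two vector
    states. *)
Lemma normal_vector_states (S0 : set (H -> H)) D T x y (c : R[i]) :
  (forall A, S0 A -> bounded_op A) ->
  (forall S, D S -> commutant S0 S /\ positive_op S) -> directed D ->
  op_lub (commutant S0) D T ->
  (forall S, D S -> '[S x, x] + '[S y, y] <= c) -> '[T x, x] + '[T y, y] <= c.
Proof.
move=> bS0 DM [[S1 DS1] dirD] [[bT _] Tub Tlub] Dc.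
have [lT [K K0 TK]] := (bounded_opP T).1 bT.
have dotT z : '[T z, z] <= K%:C * `|z| ^+ 2.
  have pT : 0 <= '[T z, z].
    by apply: le_trans (le_op_dot z (Tub _ DS1)); exact: (DM _ DS1).2.
  rewrite -(ger0_norm pT); apply: le_trans (hdot_le _ _) _.
  by rewrite expr2 mulrA ler_wpM2r.
(* The filter of tails of the directed set replaces convergence of nets. *)
pose F := filter_from D (fun S => [set S' | D S' /\ le_op S S']).
have le_refl S : le_op S S by move=> z; rewrite subrr hdot0l.
have le_tr S S' S'' : le_op S S' -> le_op S' S'' -> le_op S S''.
  by move=> h h' z; rewrite -(subrKA (S' z)) hdotDl addr_ge0.
have FF : ProperFilter F.
  apply: filter_from_proper.
    apply: filter_from_filter; first by exists S1.
    move=> A B DA DB; have [C [DC AC BC]] := dirD _ _ DA DB.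
    exists C => // C' [DC' CC']; split; split => //; exact: le_tr CC'.
  by move=> S DS; exists S; split.
have lD S : D S -> linear_op S by move=> /DM[[[]]].
(* Strong increments are controlled by increments of the quadratic form, as S' - S is positive and
   bounded by T. Monotone convergence of the real numbers [q S] then makes the vectors S z
   Cauchy. *)
have diff S S' z : D S -> D S' -> le_op S S' ->
    `|S' z - S z| ^+ 2 <= K%:C * '[S' z - S z, z].
  move=> DS DS' SS'; apply: (positive_op_sqr (B := fun z => S' z - S z)) => //.
    by move=> a u v; rewrite (lD _ DS) (lD _ DS') scalerBr opprD addrACA.
  move=> u; apply: le_trans (dotT u); rewrite hdotBl.
  apply: le_trans (le_op_dot u (Tub _ DS')).
  by rewrite gerBl; exact: (DM _ DS).2.
have Fc z : cvg ((fun S => S z) @ F).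
  apply: cauchy_cvg; apply: cauchy_exP => e e0.
  have [r r0 er] : exists2 r : R, 0 < r & e = r%:C.
    by case: e e0 => r i; rewrite ltcE/= => /andP[/eqP -> r0]; exists r.
  pose q S := complex.Re '[S z, z].
  have qS S : D S -> '[S z, z] = (q S)%:C.
    by move=> DS; rewrite /q RRe_real// ger0_real//; exact: (DM _ DS).2.
  have qub : has_sup [set q S | S in D].
    split; first by exists (q S1), S1.
    exists (complex.Re '[T z, z]) => _ [S DS <-].
    by have := le_op_dot z (Tub _ DS); rewrite lecE => /andP[].
  (* This is the gap to the supremum below which increments have norm less than r; K + 1 avoids a
     division by zero. *)
  have dpos : 0 < r ^+ 2 / (K + 1) by rewrite divr_gt0 ?exprn_gt0// ltr_pwDr.
  have [_ [S DS <-] Sq] := sup_adherent dpos qub.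
  exists (S z); exists S => // S' [DS' SS'] /=.
  rewrite -ball_normE /= distrC er.
  rewrite -(@ltr_pXn2r _ 2)// ?nnegrE ?ltcR ?lecR ?(ltW r0)//.
  apply: le_lt_trans (diff _ _ z DS DS' SS') _.
  rewrite hdotBl !qS// -rmorphB /= -rmorphM /= -rmorphXn /= ltcR.
  have h1 : q S' <= sup [set q S | S in D].
    by apply: ub_le_sup; [exact: qub.2|exists S'].
  have h2 : q S <= q S'.
    by rewrite -lecR -!qS//; exact: le_op_dot.
  apply: (@le_lt_trans _ _ ((K + 1) * (q S' - q S))).
    by rewrite ler_wpM2r ?subr_ge0// lerDl.
  rewrite mulrC -ltr_pdivlMr ?ltr_pwDr//; lra.
pose U z : H := lim ((fun S => S z) @ F).
have FU z : (fun S => S z) @ F --> U z by exact: Fc.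
have near S z w e : D S -> 0 < e -> exists S', [/\ D S', le_op S S',
    `|U z - S' z| < e & `|U w - S' w| < e].
  move=> DS e0.
  have /cvgrPdist_lt/(_ _ e0) h1 := FU z.
  have /cvgrPdist_lt/(_ _ e0) h2 := FU w.
  have h3 : F [set S' | D S' /\ le_op S S'] by exists S.
  have [S' [[? ?] [[? ?]]]] := filter_ex (filterI (filterI h1 h2) (filterI h3 h3)).
  by exists S'.
have lU : linear_op U.
  move=> a u v.
  have h : (fun S => a *: S u + S v) @ F --> a *: U u + U v.
    by apply: cvgD; [apply: cvgZr|]; exact: FU.
  have h' : (fun S => S (a *: u + v)) @ F --> a *: U u + U v.
    apply: (cvg_trans _ h); apply: near_eq_cvg.
    by exists S1 => // S [DS _] /=; rewrite (lD _ DS).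
  apply: cvg_unique (FU _) h'; exact: norm_hausdorff.
have SK S z : D S -> `|S z| <= K%:C * `|z|.
  move=> DS; have pS := (DM _ DS).2.
  have h : `|S z| ^+ 2 <= K%:C * '[S z, z].
    apply: positive_op_sqr => //; first exact: lD.
    by move=> u; apply: le_trans (dotT u); exact: le_op_dot (Tub _ DS).
  have [->|Sz0] := eqVneq (S z) 0; first by rewrite normr0 mulr_ge0// lecR.
  have n0 : 0 < `|S z| by rewrite normr_gt0.
  rewrite -(ler_pM2r n0) -expr2; apply: le_trans h _.
  rewrite -mulrA ler_wpM2l ?lecR// mulrC -(ger0_norm (pS z)); exact: hdot_le.
have bU : bounded_op U.
  apply/bounded_opP; split => //; exists K => // z.
  have normE (w : H) : (complex.Re `|w|)%:C = `|w| by rewrite RRe_real// ger0_real.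
  rewrite -(normE z) -(normE (U z)) -rmorphM lecR; apply/ler_addgt0Pr => e e0.
  have eC : 0 < e%:C by rewrite ltcR.
  have [S' [DS' _ h _]] := near S1 z z _ DS1 eC.
  rewrite -lecR rmorphD rmorphM /= !normE.
  rewrite -(subrK (S' z) (U z)) addrC; apply: le_trans (ler_normD _ _) _.
  by apply: lerD; [exact: SK|exact: ltW].
have dotU z w e : 0 < e -> exists2 d : R, 0 < d & forall S,
    `|U z - S z| < d%:C -> `|U w - S w| < d%:C ->
    `|('[S z, z] + '[S w, w]) - ('[U z, z] + '[U w, w])| < e%:C :> R[i].
  move=> e0; pose nz := complex.Re `|z|; pose nw := complex.Re `|w|.
  have normE (v : H) : (complex.Re `|v|)%:C = `|v| by rewrite RRe_real// ger0_real.
  have nz0 : 0 <= nz by rewrite -lecR (normE z); exact: normr_ge0.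
  have nw0 : 0 <= nw by rewrite -lecR (normE w); exact: normr_ge0.
  have n1 : 0 < nz + nw + 1 by lra.
  exists (e / (nz + nw + 1)); first by rewrite divr_gt0.
  set d := e / _ => S h1 h2.
  rewrite opprD addrACA -!hdotBl; apply: le_lt_trans (ler_normD _ _) _.
  apply: (@le_lt_trans _ _ (d%:C * `|z| + d%:C * `|w|)).
    apply: lerD; apply: le_trans (hdot_le _ _) _; apply: ler_wpM2r => //.
      by rewrite distrC ltW.
    by rewrite distrC ltW.
  rewrite -mulrDr -(normE z) -(normE w) -rmorphD -rmorphM ltcR -/nz -/nw /d.
  rewrite mulrAC ltr_pdivrMr// ltr_pM2l// ltrDl//.
have UM : commutant S0 U.
  split => // A SA; have [lA cA] := bS0 _ SA.
  apply/funext => z /=.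
  have h : (fun S => S (A z)) @ F --> A (U z).
    have h : (fun S => A (S z)) @ F --> A (U z).
      exact: (continuous_cvg _ (cA _) (FU z)).
    apply: (cvg_trans _ h); apply: near_eq_cvg.
    by exists S1 => // S [DS _] /=; rewrite -[LHS](congr1 (@^~ z) ((DM _ DS).1.2 A SA)).
  apply: cvg_unique (FU _) h; exact: norm_hausdorff.
have Uub S : D S -> le_op S U.
  move=> DS z; rewrite hdotBl subr_ge0 -lerN2; apply: lec_approx => e e0.
  have e20 : 0 < e * 2 by rewrite mulr_gt0.
  have [d d0 hd] := dotU z z _ e20.
  have dC : 0 < d%:C by rewrite ltcR.
  have [S' [DS' SS' h _]] := near S z z _ DS dC.
  exists (- '[S' z, z]); first by rewrite lerN2; exact: le_op_dot.
  rewrite -opprB opprK normrN; have := hd S' h h.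
  rewrite (_ : _ - _ = 2 * ('[S' z, z] - '[U z, z])); last by ring.
  rewrite normrM (ger0_norm (ler0n _ 2)) [e * 2]mulrC rmorphM /= rmorph_nat.
  by rewrite ltr_pM2l ?ltr0n// [- _ + _]addrC.
have TU := Tlub _ UM Uub.
apply: le_trans (lerD (le_op_dot x TU) (le_op_dot y TU)) _.
apply: lec_approx => e e0; have [d d0 hd] := dotU x y _ e0.
have dC : 0 < d%:C by rewrite ltcR.
have [S' [DS' _ h1 h2]] := near S1 x y _ DS1 dC.
by exists ('[S' x, x] + '[S' y, y]); [exact: Dc|exact: hd].
Qed.

End HilbertAlgebras.

(** * Bounded operators as closed graphs, and the algebra generated by a projection *)

Section BoundedGraphs.
Context {R : realType} {H : hilbertSpace R}.
Implicit Types (x y z u v : H) (S T p : H -> H) (M N : set (H -> H)).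

Local Notation "''[' x , y ]" := (@hdot R H x y) : ring_scope.

Definition two_point_op p (a b : R[i]) : H -> H :=
  fun x => a *: p x + b *: (x - p x).

Lemma two_point_linear p a b : bounded_op p -> bounded_op (two_point_op p a b).
Proof.
move=> bp.
have b1 : bounded_op (fun x => x - p x).
  have := bounded_op_lin (-1) bp bounded_op_id.
  by congr bounded_op; apply/funext => x; rewrite scaleN1r addrC.
have b0 : bounded_op (fun x : H => 0 : H).
  split=> [c x y|x]; first by rewrite scaler0 addr0.
  exact: cvg_cst.
have := bounded_op_lin a bp (bounded_op_lin b b1 b0).
by congr bounded_op; apply/funext => x; rewrite addr0.
Qed.

Lemma rank_one_bounded u v : bounded_op (fun x => '[x, v] *: u).
Proof.
apply/bounded_opP; split.
  by move=> a x y; rewrite hdotPl scalerDl scalerA.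
have nE (w : H) : (complex.Re `|w|)%:C = `|w| by rewrite RRe_real// ger0_real.
exists (complex.Re `|v| * complex.Re `|u|).
  by rewrite -lecR rmorphM /= !nE mulr_ge0.
move=> x; rewrite normrZ rmorphM /= !nE mulrC [`|v| * _]mulrC -mulrA.
apply: ler_wpM2l => //; rewrite mulrC; exact: hdot_le.
Qed.

(** The hypothesis says that T commutes with the rank-one operators x |-> <x, v> u for u, v in V.
    Evaluating it at x = v = u0 gives the scalar; when V contains no nonzero vector any scalar
    does. *)
Lemma scalar_on (V : set H) T : linear_op T ->
  (forall u v x, V u -> V v -> '[x, v] *: T u = '[T x, v] *: u) ->
  exists a : R[i], forall u, V u -> T u = a *: u.
Proof.
move=> lT h; have [[u0 [Vu0 u00]]|no] := pselect (exists u, V u /\ u != 0).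
  exists ('[T u0, u0] / '[u0, u0]) => u Vu.
  have d0 : '[u0, u0] != 0 by apply: contra u00 => /eqP/hdot_eq0 ->.
  have := h u u0 u0 Vu Vu0 => /(congr1 (fun w => '[u0, u0]^-1 *: w)).
  by rewrite !scalerA mulVf// scale1r [_^-1 * _]mulrC.
exists 1 => u Vu; have -> : u = 0.
  by apply: contrapT => /eqP u0; apply: no; exists u.
by rewrite (linear_op0 lT) scaler0.
Qed.

(** The rank-one operators built from two vectors of the range of p, or from two vectors of its
    kernel, commute with p. An element of the double commutant commutes with them, hence is scalar
    on the range and on the kernel. *)
Lemma von_neumann_two_point p : projection p ->
  von_neumann_algebra [set T | exists a b, T = two_point_op p a b].
Proof.
move=> [bp pp ap]; set N := (X in von_neumann_algebra X).
have bN T : N T -> bounded_op T by move=> [a [b ->]]; exact: two_point_linear.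
have pK x : p (p x) = p x by exact: (congr1 (@^~ x) pp).
have lp : linear_op p := bp.1.
have qp x : p (x - p x) = 0 by rewrite (linear_opB _ _ lp) pK subrr.
split => //.
  move=> T [a [b ->]]; exists (two_point_op p (conjC a) (conjC b)).
    by exists (conjC a), (conjC b).
  move=> x y; rewrite /two_point_op hdotPl hdotPr hdotZl hdotZr !conjCK.
  by rewrite hdotBl hdotBr ap.
apply/seteqP; split; last exact: commutant2.
move=> T [bT cT]; have lT : linear_op T := bT.1.
have rank1 (V : set H) : (forall u, V u -> p u = u) \/ (forall u, V u -> p u = 0) ->
    forall u v x, V u -> V v -> '[x, v] *: T u = '[T x, v] *: u.
  move=> hV u v x Vu Vv.
  have cR : commutant N (fun x => '[x, v] *: u).
    split=> [|_ [a [b ->]]]; first exact: rank_one_bounded.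
    apply/funext => y; rewrite /= /two_point_op hdotPl hdotZl hdotBl ap.
    rewrite (linear_opZ _ _ lp) -!scalerBr !scalerA.
    by case: hV => h; rewrite !h// ?subrr ?subr0 ?scaler0 ?addr0 ?hdot0r ?subr0
      ?mulr0 ?addr0 ?add0r 1?mulrC.
  have := congr1 (@^~ x) (cT _ cR) => /=.
  by rewrite (linear_opZ _ _ lT).
have [a ha] := scalar_on lT (rank1 [set u | p u = u] (or_introl (fun _ h => h))).
have [b hb] := scalar_on lT (rank1 [set u | p u = 0] (or_intror (fun _ h => h))).
exists a, b; apply/funext => x; rewrite /two_point_op.
rewrite -ha//= -hb//= -(linear_opD _ _ lT).
by rewrite addrC subrK.
Qed.

Definition gr T : set (H * H) := [set z | z.2 = T z.1].

Lemma closed_gr T : bounded_op T -> closed (gr T).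
Proof.
move=> [_ cT].
have -> : gr T = (fun z : H * H => z.2 - T z.1) @^-1` [set 0].
  by apply/seteqP; split=> z /= /eqP; rewrite -subr_eq0 ?subr0 => /eqP; rewrite ?subr0//;
    move=> h; apply/eqP; rewrite -subr_eq0 h.
apply: closed_comp.
  move=> z _; apply: cvgB; first exact: cvg_snd.
  by apply: continuous_comp; [exact: cvg_fst|exact: cT].
by apply: accessible_closed_set1; apply: hausdorff_accessible; exact: norm_hausdorff.
Qed.

Lemma dom_gr T : dom (gr T) = setT.
Proof. by apply/seteqP; split => // x _; exists (T x). Qed.

Lemma ran_gr T : ran (gr T) = range T.
Proof.
by apply/seteqP; split=> [y [x h]|y [x _ <-]]; exists x.
Qed.

Lemma dense_setT : dense [set: H].
Proof. by move=> A [x Ax] _; exists x. Qed.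

Lemma closed_operator_gr T : bounded_op T -> closed_operator (gr T).
Proof.
move=> bT; have lT := bT.1; split.
- by rewrite /gr /= (linear_op0 lT).
- by move=> c x y x' y'; rewrite /gr /= => -> ->; rewrite lT.
- by move=> x y y'; rewrite /gr /= => -> ->.
- by rewrite dom_gr; exact: dense_setT.
- exact: closed_gr.
Qed.

Lemma op_adj_gr S T : adjoint_of S T -> op_adj (gr S) = gr T.
Proof.
move=> h; apply/seteqP; split=> [[y z] /= zP|[y z]]; rewrite /gr /=.
- by apply: hdot_inj => x; rewrite -h (zP x (S x)).
- by move=> -> x w /= ->; rewrite h.
Qed.

Lemma self_adjoint_gr T : adjoint_of T T -> self_adjoint (gr T).
Proof.
by move=> h; split; [rewrite dom_gr; exact: dense_setT|exact: op_adj_gr].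
Qed.

Lemma modulus_of_gr T : adjoint_of T T -> positive_op T -> modulus_of (gr T) (gr T).
Proof.
move=> h pT; split; first exact: self_adjoint_gr.
- by move=> x y; rewrite /gr /= => ->; exact: pT.
- by rewrite (op_adj_gr h).
Qed.

(** The algebraic sum of everywhere defined bounded operators is already closed, so the closure adds
    nothing. *)
Lemma strong_add_gr S T : bounded_op S -> bounded_op T ->
  strong_add (gr S) (gr T) = gr (fun x => S x + T x).
Proof.
move=> bS bT; rewrite /strong_add.
have -> : [set z | exists eta eta', [/\ gr S (z.1, eta), gr T (z.1, eta') &
    z.2 = eta + eta']] = gr (fun x => S x + T x).
  apply/seteqP; split=> [[x y] /= [e [e' []]]|[x y]]; rewrite /gr /=.
    by move=> -> -> ->.
  by move=> ->; exists (S x), (T x).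
apply/esym/closure_id; apply: closed_gr.
have := bounded_op_lin 1 bS bT.
by congr bounded_op; apply/funext => x; rewrite scale1r.
Qed.

Lemma affiliated_gr M T : M T -> affiliated M (gr T).
Proof.
move=> MT u v [_ cu] _ _ _ x y; rewrite /gr /= => ->.
exact: (congr1 (@^~ x) (cu _ MT)).
Qed.

Lemma closure_range_projection p : projection p -> closure (range p) = range p.
Proof.
move=> [[lp cp] pp _]; apply/esym/closure_id.
have -> : range p = (fun x => p x - x) @^-1` [set 0].
  apply/seteqP; split=> [_ [x _ <-]|x /= /eqP].
    by rewrite /= -[p (p x)]/((p \o p) x) pp subrr.
  by rewrite subr_eq0 => /eqP <-; exists x.
apply: closed_comp.
  by move=> z _; apply: cvgB; [exact: cp|exact: cvg_id].
by apply: accessible_closed_set1; apply: hausdorff_accessible; exact: norm_hausdorff.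
Qed.

Lemma proj_onto_range p : projection p -> proj_onto (range p) = p.
Proof.
move=> hp; rewrite /proj_onto; set A := (X in get X).
have [q1 q2] : A (get A) by apply: getPex; exists p.
exact: projection_uniq.
Qed.

End BoundedGraphs.

(** * Crossed product by a measure-preserving involution *)

Section Crossed.
Context {d : measure_display} {T : measurableType d} {R : realType}.
Variable mu : {finite_measure set T -> \bar R}.
Variable sg : {mfun T >-> T}.
Hypothesis sgK : involutive sg.
Hypothesis sg_mu : forall A, measurable A -> mu (sg @^-1` A) = mu A.
Implicit Types (f g a b c e : T -> R[i]) (u v w : L2 mu).

Local Notation H := (L2hilbert mu).
Local Notation "''[' x , y ]" := (@hdot R H x y) : ring_scope.

Lemma ae_invol (P : T -> Prop) : {ae mu, forall x, P x} -> {ae mu, forall x, P (sg x)}.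
Proof.
move=> [A [mA A0 PA]]; exists (sg @^-1` A); split.
- by rewrite -[_ @^-1` _]setTI; exact: measurable_funPT.
- by rewrite sg_mu.
- by move=> x /= h; exact: PA.
Qed.

Lemma ge0_integral_invol (f : T -> \bar R) : measurable_fun setT f ->
  (forall x, 0 <= f x)%E -> (\int[mu]_x f (sg x) = \int[mu]_x f x)%E.
Proof.
move=> mf f0.
have := @ge0_integral_pushforward _ _ _ _ R sg (measurable_funPT sg) mu setT f
  measurableT mf (fun x _ => f0 x).
rewrite preimage_setT => <-.
by apply: eq_measure_integral => A mA _; exact: sg_mu.
Qed.

Lemma measurable_invol d' (U : measurableType d') (f : T -> U) :
  measurable_fun setT f -> measurable_fun setT (fun x => f (sg x)).
Proof. by move=> mf; apply: measurableT_comp mf _; exact: measurable_funPT. Qed.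

Lemma cmeasurable_invol f : cmeasurable f -> cmeasurable (fun x => f (sg x)).
Proof. by move=> [m1 m2]; split; [exact: (measurable_invol m1)|exact: (measurable_invol m2)]. Qed.

Lemma cbounded_invol f : cbounded f -> cbounded (fun x => f (sg x)).
Proof. by move=> [mf [K fK]]; split; [exact: cmeasurable_invol|exists K]. Qed.

Lemma integrable_invol (f : T -> R) : mu.-integrable setT (EFin \o f) ->
  mu.-integrable setT (EFin \o (fun x => f (sg x))).
Proof.
move=> /integrableP[/measurable_EFinP mf fy]; apply/integrableP; split.
  by apply/measurable_EFinP; exact: (measurable_invol mf).
have := @ge0_integral_invol (fun x => `|(f x)%:E|)%E _ (fun x => abse_ge0 _).
move=> /(_ _)/= ->//.
by apply/measurable_EFinP; exact: measurableT_comp.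
Qed.

Lemma L2fun_invol f : L2fun mu f -> L2fun mu (fun x => f (sg x)).
Proof.
move=> [mf f2]; split; first exact: cmeasurable_invol.
exact: integrable_invol f2.
Qed.

Lemma Rintegral_invol (f : T -> R) : mu.-integrable setT (EFin \o f) ->
  \int[mu]_x f (sg x) = \int[mu]_x f x.
Proof.
move=> fi; rewrite /Rintegral; congr fine.
have mf : measurable_fun setT (EFin \o f) by exact: measurable_int fi.
have := @integral_pushforward _ _ _ _ R sg (measurable_funPT sg) mu setT (EFin \o f) mf.
rewrite preimage_setT => /(_ (integrable_invol fi) measurableT) /= <-.
by apply: eq_measure_integral => A mA _; exact: sg_mu.
Qed.

Lemma Cint_invol f : L1fun mu f -> Cint mu (fun x => f (sg x)) = Cint mu f.
Proof. move=> [f1 f2]; apply: complex_ext; first exact: (Rintegral_invol f1).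
exact: (Rintegral_invol f2). Qed.

(* The element [a + b sg] of the crossed product of L^oo(mu) by the action
   [u |-> u \o sg] of Z/2 on L^2(mu). *)
Definition Op a b u : L2 mu := cls mu (fun x => a x * rep u x + b x * rep u (sg x)).

Lemma L2fun_Op a b f : cbounded a -> cbounded b -> L2fun mu f ->
  L2fun mu (fun x => a x * f x + b x * f (sg x)).
Proof.
by move=> ba bb f2; apply: L2funD; apply: L2funMb => //; exact: L2fun_invol.
Qed.

Lemma rep_Op a b u : cbounded a -> cbounded b ->
  aeeq mu (rep (Op a b u)) (fun x => a x * rep u x + b x * rep u (sg x)).
Proof. by move=> ba bb; apply: rep_cls; apply: L2fun_Op => //; exact: L2fun_rep. Qed.

Lemma Op_cls a b f : cbounded a -> cbounded b -> L2fun mu f ->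
  Op a b (cls mu f) = cls mu (fun x => a x * f x + b x * f (sg x)).
Proof.
move=> ba bb f2; apply: cls_eq.
- by apply: L2fun_Op => //; exact: L2fun_rep.
- exact: L2fun_Op.
- apply: filterS2 (rep_cls f2) (ae_invol (rep_cls f2)) => x /= -> ->.
  by [].
Qed.

Lemma cbounded_comp1 a b c e : cbounded a -> cbounded b -> cbounded c -> cbounded e ->
  cbounded (fun x => a x * c x + b x * e (sg x)).
Proof.
by move=> *; apply: cboundedD; apply: cboundedM => //; exact: cbounded_invol.
Qed.

Lemma Op_comp a b c e : cbounded a -> cbounded b -> cbounded c -> cbounded e ->
  Op a b \o Op c e = Op (fun x => a x * c x + b x * e (sg x))
                        (fun x => a x * e x + b x * c (sg x)).
Proof.
move=> ba bb bc be; apply/funext => u /=; apply: L2_ext.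
have h1 := rep_Op (Op c e u) ba bb.
have h2 := rep_Op u bc be.
have h3 := ae_invol h2.
have h4 := rep_Op u (cbounded_comp1 ba bb bc be) (cbounded_comp1 ba bb be bc).
apply: filterS2 (filterI h1 h2) (filterI h3 h4) => x [/= -> ->] [-> ->].
by rewrite sgK; ring.
Qed.

Lemma Op_lin k a b c e u : cbounded a -> cbounded b -> cbounded c -> cbounded e ->
  Op (fun x => k * a x + c x) (fun x => k * b x + e x) u =
  k *: Op a b u + Op c e u.
Proof.
move=> ba bb bc be; apply: L2_ext.
have bk f : cbounded f -> cbounded (fun x => k * f x).
  by move=> ?; apply: cboundedM => //; exact: cbounded_cst.
have h1 := rep_Op u (cboundedD (bk _ ba) bc) (cboundedD (bk _ bb) be).
have h2 := repD (k *: Op a b u) (Op c e u).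
have h3 := repZ k (Op a b u).
have h4 := rep_Op u ba bb; have h5 := rep_Op u bc be.
apply: filterS3 (filterI h1 h2) (filterI h3 h4) h5 => x [/= -> ->] [-> ->] ->.
by ring.
Qed.

Lemma Op_linear a b : cbounded a -> cbounded b -> linear_op (Op a b : H -> H).
Proof.
move=> ba bb k u v; apply: L2_ext.
have h1 := rep_Op (k *: u + v) ba bb.
have h2 := repD (k *: u) v; have h3 := repZ k u.
have h2' := ae_invol h2; have h3' := ae_invol h3.
have h4 := repD (k *: Op a b u) (Op a b v); have h5 := repZ k (Op a b u).
have h6 := rep_Op u ba bb; have h7 := rep_Op v ba bb.
apply: filterS3 (filterI (filterI h1 h2) (filterI h3 h2')) (filterI h3' h4)
  (filterI h5 (filterI h6 h7)) => x [[/= -> ->] [-> ->]] [-> ->] [-> [-> ->]].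
by ring.
Qed.

Lemma L2sqn_cls f : L2fun mu f ->
  (L2sqn (cls mu f))%:E = (\int[mu]_x (sqn (f x))%:E)%E.
Proof.
move=> f2; rewrite EFin_L2sqn; apply: ge0_ae_eq_integral => //.
- exact/measurable_EFinP/measurable_sqn/L2fun_meas/L2fun_rep.
- by apply/measurable_EFinP/measurable_sqn; exact: L2fun_meas f2.
- by move=> x _; rewrite lee_fin sqn_ge0.
- by move=> x _; rewrite lee_fin sqn_ge0.
- by apply: filterS (rep_cls f2) => x /= ->.
Qed.

Lemma Op_bounded a b : cbounded a -> cbounded b -> bounded_op (Op a b : H -> H).
Proof.
move=> ba bb; apply/bounded_opP; split; first exact: Op_linear.
have [ma [K aK]] := ba; have [mb [L bL]] := bb.
(* K and L bound the squared moduli, so the squared norm of the image is at most 4 M |u|^2; M >= 1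
   makes this at most (2 M)^2 |u|^2. *)
pose M := 1 + `|K| + `|L|.
have M1 : 1 <= M by rewrite /M -addrA lerDl addr_ge0.
exists (2 * M); first by rewrite mulr_ge0// (le_trans ler01).
move=> u; rewrite !L2_normE -rmorphM lecR.
rewrite -[2 * M]ger0_norm ?mulr_ge0// ?(le_trans ler01)//.
rewrite -sqrtr_sqr -sqrtrM ?sqr_ge0//; apply: ler_wsqrtr.
rewrite -lee_fin L2sqn_cls; last by apply: L2fun_Op => //; exact: L2fun_rep.
have mu1 : measurable_fun setT (fun x => (sqn (rep u x))%:E).
  exact/measurable_EFinP/measurable_sqn/L2fun_meas/L2fun_rep.
have mu2 : measurable_fun setT (fun x => (sqn (rep u (sg x)))%:E).
  exact: (measurable_invol mu1).
apply: (@le_trans _ _ (\int[mu]_x ((2 * M)%:E *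
    ((sqn (rep u x))%:E + (sqn (rep u (sg x)))%:E)))%E).
  apply: ge0_le_integral => //.
  - by move=> x _; rewrite lee_fin sqn_ge0.
  - apply/measurable_EFinP/measurable_sqn/(@L2fun_meas _ _ _ mu).
    by apply: L2fun_Op => //; exact: L2fun_rep.
  - by apply: emeasurable_funM => //; exact: emeasurable_funD.
  - move=> x _; rewrite -EFinD -EFinM lee_fin; apply: le_trans (sqnD_le _ _) _.
    rewrite !sqnM -[leRHS]mulrA ler_pM2l// [leRHS]mulrDr; apply: lerD; apply: ler_wpM2r; rewrite ?sqn_ge0//.
      apply: le_trans (aK x) _; apply: le_trans (ler_norm _) _.
      by rewrite /M -addrA addrCA lerDl addr_ge0.
    apply: le_trans (bL _) _; apply: le_trans (ler_norm _) _.
    by rewrite /M addrC lerDl addr_ge0.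
rewrite ge0_integralZl_EFin//; first last.
- by rewrite mulr_ge0// (le_trans ler01).
- exact: emeasurable_funD.
- by move=> x _; rewrite -EFinD lee_fin addr_ge0 ?sqn_ge0.
rewrite ge0_integralD//; first last.
- by move=> x _; rewrite lee_fin sqn_ge0.
- by move=> x _; rewrite lee_fin sqn_ge0.
rewrite (ge0_integral_invol mu1)//; last by move=> x; rewrite lee_fin sqn_ge0.
rewrite -EFin_L2sqn -EFinD -EFinM lee_fin expr2 -mulrA ler_pM2l//; last first.
  by rewrite mulr_gt0// (lt_le_trans ltr01).
by move: (M) M1 (L2sqn u) (L2sqn_ge0 u) => m m1 l l0; nra.
Qed.

(** The adjoint of b sg is sg conj(b), and moving sg to the right composes the coefficient with
    sg. *)
Lemma Op_adjoint a b : cbounded a -> cbounded b ->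
  adjoint_of (Op a b : H -> H) (Op (fun x => conjC (a x)) (fun x => conjC (b (sg x)))).
Proof.
move=> ba bb u v.
have bb' := cbounded_conj (cbounded_invol bb).
have u2 := L2fun_rep u; have v2 := L2fun_rep v.
rewrite [LHS](L2dotE (rep_Op u ba bb) (aeeq_refl _ _))//; last exact: L2fun_Op.
rewrite [RHS](L2dotE (aeeq_refl _ _) (rep_Op v (cbounded_conj ba) bb'))//; last first.
  by apply: L2fun_Op => //; exact: cbounded_conj.
have I1 : L1fun mu (fun x => (a x * rep u x) * conjC (rep v x)).
  by apply: L1fun_L2M => //; exact: L2funMb.
have I2 : L1fun mu (fun x => (b (sg x) * rep u x) * conjC (rep v (sg x))).
  by apply: L1fun_L2M; [apply: L2funMb => //; exact: cbounded_invol|exact: L2fun_invol].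
have I3 : L1fun mu (fun x => (b x * rep u (sg x)) * conjC (rep v x)).
  by apply: L1fun_L2M => //; apply: L2funMb => //; exact: L2fun_invol.
transitivity (Cint mu (fun x => (a x * rep u x) * conjC (rep v x)) +
  Cint mu (fun x => (b x * rep u (sg x)) * conjC (rep v x))).
  rewrite -CintD//; congr Cint; apply/funext => x; by ring.
rewrite -(Cint_invol I3).
under [X in _ + Cint _ X]eq_fun do rewrite sgK.
rewrite -CintD//; congr Cint; apply/funext => x.
by rewrite rmorphD !rmorphM /= !conjCK; ring.
Qed.

Lemma Op_ext a b a' b' : cbounded a -> cbounded b -> cbounded a' -> cbounded b' ->
  aeeq mu a a' -> aeeq mu b b' -> Op a b = Op a' b'.
Proof.
move=> ba bb ba' bb' h h'; apply/funext => u; apply: L2_ext.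
apply: filterS2 (filterI (rep_Op u ba bb) (rep_Op u ba' bb')) (filterI h h').
by move=> x [/= -> ->] [-> ->].
Qed.

Lemma Op_id : Op (fun=> 1) (fun=> 0) = id.
Proof.
apply/funext => u; apply: L2_ext.
apply: filterS (rep_Op u (cbounded_cst 1) (cbounded_cst 0)) => x /= ->.
by rewrite mul1r mul0r addr0.
Qed.

Lemma Op_zero : Op (fun=> 0) (fun=> 0) = fun=> 0.
Proof.
apply/funext => u; apply: L2_ext.
apply: filterS2 (rep_Op u (cbounded_cst 0) (cbounded_cst 0)) (rep0 mu) => x /= -> ->.
by rewrite !mul0r addr0.
Qed.

End Crossed.

(** * The commutant of the multiplications by invariant functions *)

Section CrossedAlgebra.
Context {d : measure_display} {T : measurableType d} {R : realType}.
Variable mu : {finite_measure set T -> \bar R}.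
Variable sg : {mfun T >-> T}.
Hypothesis sgK : involutive sg.
Hypothesis sg_mu : forall A, measurable A -> mu (sg @^-1` A) = mu A.
Implicit Types (f g a b c e w : T -> R[i]) (u v : L2 mu).

Local Notation H := (L2hilbert mu).
Local Notation "''[' x , y ]" := (@hdot R H x y) : ring_scope.
Local Notation Op := (@Op _ _ _ mu sg).

Definition invariant_mult : set (H -> H) :=
  [set A | exists w, [/\ cbounded w, forall x, w (sg x) = w x & A = Op w (fun=> 0)]].

Lemma rep_mult w u : cbounded w ->
  aeeq mu (rep (Op w (fun=> 0) u)) (fun x => w x * rep u x).
Proof.
move=> bw; apply: filterS (rep_Op sg_mu u bw (cbounded_cst 0)) => x /= ->.
by rewrite mul0r addr0.
Qed.

Lemma mult_cls w f : cbounded w -> L2fun mu f ->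
  Op w (fun=> 0) (cls mu f) = cls mu (fun x => w x * f x).
Proof.
move=> bw f2; rewrite Op_cls//; last exact: cbounded_cst.
by congr cls; apply/funext => x; rewrite mul0r addr0.
Qed.

Lemma cbounded_indic (B : set T) : measurable B -> cbounded (fun x => (\1_B x : R)%:C).
Proof.
move=> mB; apply: cbounded_real; first exact: measurable_indic.
by exists 1 => x; rewrite indicE; case: (_ \in _); rewrite ?normr1 ?normr0.
Qed.

Lemma sqn_indicM (B : set T) f x : sqn ((\1_B x : R)%:C * f x) = \1_B x * sqn (f x).
Proof. by rewrite sqnM sqn_real indicE; case: (_ \in _); rewrite ?expr1n ?expr0n. Qed.

(** Cutting e by an invariant set B cuts f = A e by B, so the integral of |f|^2 over B is at most M
    mu(B). Only invariant sets are allowed, which is why the level set B = {s > 2 M} is taken for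
    the symmetrised s = |f|^2 + |f o sg|^2. Adding the bounds for f and f o sg, the positive
    function s - 2 M has integral at most 0 on B, so B is null. *)
Lemma commuting_cls_bounded (A : H -> H) e : bounded_op A ->
  (forall w, cbounded w -> (forall x, w (sg x) = w x) ->
    A \o Op w (fun=> 0) = Op w (fun=> 0) \o A) ->
  cbounded e -> exists2 t, cbounded t & A (cls mu e) = cls mu t.
Proof.
move=> /bounded_opP[lA [K K0 AK]] cA be; have [me [E eE]] := be.
pose f := rep (A (cls mu e) : L2 mu).
have f2 : L2fun mu f by exact: L2fun_rep.
have e2 : L2fun mu e by exact: L2fun_bounded.
have E0 : 0 <= `|E| by [].
pose M := K ^+ 2 * `|E|.
have M0 : 0 <= M by rewrite mulr_ge0 ?sqr_ge0.
have msf : measurable_fun setT (fun x => sqn (f x)).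
  by apply: measurable_sqn; exact: L2fun_meas f2.
have msfs : measurable_fun setT (fun x => sqn (f (sg x))).
  exact: (measurable_invol sg msf).
pose s x := sqn (f x) + sqn (f (sg x)).
have ms : measurable_fun setT s by exact: measurable_funD.
pose B := [set x | 2 * M < s x].
have mB : measurable B.
  rewrite -[B]setTI (_ : B = s @^-1` `]2 * M, +oo[).
    by apply: ms => //; exact: measurable_itv.
  by apply/seteqP; split=> x /=; rewrite in_itv/= andbT.
have sB x : \1_B (sg x) = \1_B x :> R.
  rewrite !indicE (_ : (sg x \in B) = (x \in B))//.
  by apply/idP/idP; rewrite !inE /B /s /= ?sgK addrC.
pose w x := (\1_B x : R)%:C.
have bw : cbounded w by exact: cbounded_indic.
have I0 x : 0 <= \1_B x :> R by [].
have m1 : measurable_fun setT (\1_B : T -> R) by exact: measurable_indic.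
have B_int : (\int[mu]_x (\1_B x * sqn (f x))%:E <= M%:E * mu B)%E.
  have := congr1 (fun S => S (cls mu e)) (cA w bw (fun x => congr1 _ (sB x))).
  rewrite /= mult_cls// => hA.
  have hl : (L2sqn (A (cls mu (fun x => w x * e x)) : L2 mu))%:E =
      (\int[mu]_x (\1_B x * sqn (f x))%:E)%E.
    rewrite hA -[A _]repK mult_cls// L2sqn_cls//; last exact: L2funMb.
    by apply: eq_integral => x _; rewrite sqn_indicM.
  rewrite -hl.
  have we2 : L2fun mu (fun x => w x * e x) by exact: L2funMb.
  have h1 : L2sqn (A (cls mu (fun x => w x * e x)) : L2 mu) <=
      K ^+ 2 * L2sqn (cls mu (fun x => w x * e x)).
    have := AK (cls mu (fun x => w x * e x)); rewrite [leLHS]L2_normE [X in _ * X]L2_normE.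
    rewrite -rmorphM lecR -[X in X * _](ger0_norm K0) -sqrtr_sqr -sqrtrM ?sqr_ge0//.
    by rewrite ler_sqrt// mulr_ge0 ?sqr_ge0// L2sqn_ge0.
  apply: (@le_trans _ _ (K ^+ 2 * L2sqn (cls mu (fun x => w x * e x)))%:E).
    by rewrite lee_fin.
  rewrite /M EFinM [X in (X * mu B)%E]EFinM -muleA; apply: lee_wpmul2l.
    by rewrite lee_fin sqr_ge0.
  rewrite L2sqn_cls//; under eq_integral do rewrite sqn_indicM.
  rewrite -[X in (_ <= _ * mu X)%E]setIT -integral_indic// -ge0_integralZl_EFin//; last first.
    by apply/measurable_EFinP.
  apply: ge0_le_integral => //.
  - by move=> x _; rewrite lee_fin mulr_ge0 ?sqn_ge0.
  - by apply/measurable_EFinP; apply: measurable_funM => //; exact: measurable_sqn.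
  - by apply: emeasurable_funM => //; exact/measurable_EFinP.
  - move=> x _; rewrite -EFinM lee_fin mulrC ler_wpM2r//.
    by apply: le_trans (eE x) _; exact: ler_norm.
have muBfin : mu B \is a fin_num by exact: fin_num_measure.
have mg1 : measurable_fun setT (fun x => (\1_B x * sqn (f x))%:E).
  by apply/measurable_EFinP; exact: measurable_funM.
have s_int : (\int[mu]_x (\1_B x * s x)%:E <= (2 * M)%:E * mu B)%E.
  rewrite (_ : (\int[mu]_x _)%E = (\int[mu]_x (\1_B x * sqn (f x))%:E +
     \int[mu]_x (\1_B x * sqn (f x))%:E)%E).
    rewrite mulr_natl mulr2n EFinD ge0_muleDl ?lee_fin//; exact: leeD.
  rewrite -[in X in (_ + X)%E](ge0_integral_invol sg_mu mg1); last first.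
    by move=> x; rewrite lee_fin mulr_ge0 ?sqn_ge0.
  rewrite -ge0_integralD//.
  - by apply: eq_integral => x _; rewrite sB -EFinD -mulrDr.
  - by move=> x _; rewrite lee_fin mulr_ge0 ?sqn_ge0.
  - by move=> x _; rewrite lee_fin mulr_ge0 ?sqn_ge0.
  - exact: (measurable_invol sg mg1).
pose g x := \1_B x * (s x - 2 * M).
have g0 x : 0 <= g x.
  rewrite /g indicE; have [xB|_] := boolP (x \in B); last by rewrite mul0r.
  by rewrite mul1r subr_ge0 ltW//; rewrite inE in xB.
have mg : measurable_fun setT (EFin \o g).
  by apply/measurable_EFinP; apply: measurable_funM => //; exact: measurable_funB.
have g_int : (\int[mu]_x (g x)%:E = 0)%E.
  apply/eqP; rewrite eq_le integral_ge0 ?andbT//; last by move=> x _; rewrite lee_fin.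
  move: s_int.
  rewrite (_ : (\int[mu]_x (\1_B x * s x)%:E)%E =
     (\int[mu]_x (g x)%:E + (2 * M)%:E * mu B)%E).
    by rewrite -leeBrDr ?fin_numM// subee ?fin_numM.
  rewrite -[X in (_ + _ * mu X)%E]setIT -integral_indic// -ge0_integralZl_EFin//; first last.
  - by rewrite mulr_ge0.
  - exact/measurable_EFinP.
  rewrite -ge0_integralD//.
  - by apply: eq_integral => x _; rewrite -EFinM -EFinD /g; congr (_%:E); ring.
  - by move=> x _; rewrite lee_fin.
  - by move=> x _; rewrite mule_ge0// lee_fin mulr_ge0.
  - by apply: emeasurable_funM => //; exact/measurable_EFinP.
have B0 : {ae mu, forall x, x \notin B}.
  have /(ae_eq_integral_abs mu measurableT mg) : (\int[mu]_x `|(g x)%:E| = 0)%E.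
    by under eq_integral do rewrite gee0_abs ?lee_fin//.
  apply: filterS => x /= /(_ I)[]; rewrite /g indicE => gx.
  apply/negP => xB; move: gx; rewrite xB mul1r => /eqP; rewrite subr_eq0.
  by rewrite inE in xB; rewrite gt_eqF.
pose t x := (\1_(~` B) x : R)%:C * f x.
have bt : cbounded t.
  split.
    apply: cmeasurableM; last exact: L2fun_meas f2.
    by have [] := cbounded_indic (measurableC mB).
  exists (2 * M) => x; rewrite /t sqn_indicM indicE.
  have [xB|_] := boolP (x \in ~` B); last by rewrite mul0r mulr_ge0.
  rewrite mul1r; move: xB; rewrite inE /B /s /= => /negP; rewrite -leNgt.
  by apply: le_trans; rewrite lerDl sqn_ge0.
exists t => //; rewrite -[LHS]repK; apply: cls_eq => //; first exact: L2fun_bounded.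
apply: filterS B0 => x xB; rewrite /t indicE.
by rewrite (_ : x \in ~` B) ?mul1r// inE /=; move: xB; rewrite notin_setE.
Qed.

Variable P : set T.
Hypothesis mP : measurable P.
Hypothesis hP : {ae mu, forall x, (x \in P) = ~~ (sg x \in P)}.

Definition half_indicator x : R[i] := (\1_P x : R)%:C.

Lemma cbounded_half : cbounded half_indicator.
Proof. exact: cbounded_indic. Qed.

Lemma half_invol : {ae mu, forall x, half_indicator x + half_indicator (sg x) = 1 /\ half_indicator x * half_indicator (sg x) = 0
  /\ half_indicator x * half_indicator x = half_indicator x /\ half_indicator (sg x) * half_indicator (sg x) = half_indicator (sg x)}.
Proof.
apply: filterS hP => x; rewrite /half_indicator !indicE => ->.
by case: (_ \in _); rewrite /= ?addr0 ?add0r ?mulr0 ?mul0r ?mulr1.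
Qed.

(** L^2 is a module of rank two over the invariant functions, with basis the indicators of P and of
    its image. An operator commuting with these functions is determined by its values t and r on the
    basis, and expanding A g in g and g o sg yields the coefficients a and b. *)
Lemma commutant_invariant_mult (A : H -> H) : commutant invariant_mult A ->
  exists a b, [/\ cbounded a, cbounded b & A = Op a b].
Proof.
move=> [bA cA0]; have lA := bA.1.
have cA w : cbounded w -> (forall x, w (sg x) = w x) ->
    A \o Op w (fun=> 0) = Op w (fun=> 0) \o A.
  by move=> bw sw; apply: cA0; exists w.
have bh := cbounded_half; have bh' := cbounded_invol sg bh.
have [t bt At] := commuting_cls_bounded bA cA bh.
have [r br Ar] := commuting_cls_bounded bA cA bh'.
have b0 : cbounded (fun _ : T => 0 : R[i]) by exact: cbounded_cst.
pose a x := t x * half_indicator x + r x * half_indicator (sg x).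
pose b x := t x * half_indicator (sg x) + r x * half_indicator x.
have ba : cbounded a by apply: cboundedD; exact: cboundedM.
have bb : cbounded b by apply: cboundedD; exact: cboundedM.
exists a, b; split => //.
(* For bounded g the coordinates c and e in this basis are invariant and bounded, so A may be moved
   past them. *)
have Abnd g : cbounded g -> A (cls mu g) = Op a b (cls mu g).
  move=> bg; have bg' := cbounded_invol sg bg.
  pose c x := g x * half_indicator x + g (sg x) * half_indicator (sg x).
  pose e x := g x * half_indicator (sg x) + g (sg x) * half_indicator x.
  have bc : cbounded c by apply: cboundedD; exact: cboundedM.
  have be : cbounded e by apply: cboundedD; exact: cboundedM.
  have L f : cbounded f -> L2fun mu f by exact: L2fun_bounded.
  have gE : cls mu g = (Op c (fun=> 0) (cls mu half_indicator) : H) +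
                       Op e (fun=> 0) (cls mu (fun x => half_indicator (sg x))).
    rewrite !mult_cls//; try exact: L.
    apply: L2_ext.
    have bch : cbounded (fun x => c x * half_indicator x) by exact: cboundedM.
    have beh : cbounded (fun x => e x * half_indicator (sg x)) by exact: cboundedM.
    have h1 := rep_cls (L _ bg); have h2 := rep_cls (L _ bch); have h3 := rep_cls (L _ beh).
    have h4 := repD (cls mu (fun x => c x * half_indicator x)) (cls mu (fun x => e x * half_indicator (sg x))).
    apply: filterS3 (filterI h1 h2) (filterI h3 h4) half_invol => x [/= -> h2x] [h3x ->].
    move=> [s1 [s2 [s3 s4]]]; rewrite h2x h3x /c /e.
    rewrite !mulrDl -!mulrA s3 s4 s2 [half_indicator (sg x) * _]mulrC s2 !mulr0 !addr0.
    by rewrite -mulrDr s1 mulr1.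
  have cs x : c (sg x) = c x by rewrite /c sgK addrC.
  have es x : e (sg x) = e x by rewrite /e sgK addrC.
  rewrite Op_cls//; last exact: L.
  rewrite gE (linear_opD _ _ lA).
  have -> : A (Op c (fun=> 0) (cls mu half_indicator)) = Op c (fun=> 0) (A (cls mu half_indicator)).
    exact: (congr1 (fun S : H -> H => S (cls mu half_indicator)) (cA c bc cs)).
  have -> : A (Op e (fun=> 0) (cls mu (fun x => half_indicator (sg x)))) =
      Op e (fun=> 0) (A (cls mu (fun x => half_indicator (sg x)))).
    exact: (congr1 (fun S : H -> H => S (cls mu (fun x => half_indicator (sg x)))) (cA e be es)).
  rewrite At Ar !mult_cls//; try exact: L.
  apply: L2_ext.
  have bct : cbounded (fun x => c x * t x) by exact: cboundedM.
  have ber : cbounded (fun x => e x * r x) by exact: cboundedM.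
  have bab : cbounded (fun x => a x * g x + b x * g (sg x)).
    by apply: cboundedD; exact: cboundedM.
  have h1 := rep_cls (L _ bct); have h2 := rep_cls (L _ ber); have h3 := rep_cls (L _ bab).
  have h4 := repD (cls mu (fun x => c x * t x)) (cls mu (fun x => e x * r x)).
  apply: filterS2 (filterI h1 h2) (filterI h3 h4) => x [/= h1x h2x] [-> ->].
  by rewrite h1x h2x /a /b /c /e; ring.
apply/funext => u; pose f := rep (u : L2 mu).
have f2 : L2fun mu f by exact: L2fun_rep.
(* A general u is brought back to a bounded function by the invariant weight 1 / m; the weight
   vanishes nowhere, so multiplication by it is injective and can be cancelled at the end. *)
pose m x : R := 1 + sqn (f x) + sqn (f (sg x)).
have m1 x : 1 <= m x by rewrite /m -addrA lerDl addr_ge0// sqn_ge0.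
have m0 x : m x != 0 by rewrite gt_eqF// (lt_le_trans ltr01).
have mm : measurable_fun setT (fun x => (m x)^-1).
  rewrite (_ : (fun x => _) = (@powR R ^~ (-1)) \o m); last first.
    by apply/funext => x; rewrite /= powR_inv1// (le_trans ler01).
  apply: measurableT_comp; first exact: measurable_powR.
  apply: measurable_funD.
    by apply: measurable_funD => //; apply: measurable_sqn; exact: L2fun_meas f2.
  apply: (measurable_invol sg (f := fun x => sqn (f x))).
  by apply: measurable_sqn; exact: L2fun_meas f2.
pose w x : R[i] := ((m x)^-1)%:C.
have w1 x : `|(m x)^-1| <= 1.
  by rewrite normfV invf_le1 ?normr_gt0// ger0_norm// (le_trans ler01).
have bw : cbounded w by apply: cbounded_real => //; exists 1.
have sw x : w (sg x) = w x by rewrite /w /m sgK addrAC.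
have bwf : cbounded (fun x => w x * f x).
  split; first by apply: cmeasurableM; [exact: bw.1|exact: L2fun_meas f2].
  exists 1 => x; rewrite sqnM sqn_real.
  have := m1 x; have : sqn (f x) <= m x by rewrite /m addrAC addrC lerDl addr_ge0// sqn_ge0.
  move=> h1 h2; rewrite exprVn mulrC ler_pdivrMr ?exprn_gt0 ?(lt_le_trans ltr01)//.
  by rewrite mul1r; apply: le_trans h1 _; rewrite expr2 ler_peMr// (le_trans ler01).
have winj v v' : Op w (fun=> 0) v = Op w (fun=> 0) v' -> v = v'.
  move=> vv'; apply: L2_ext.
  apply: filterS2 (rep_mult v bw) (rep_mult v' bw) => x /= h1 h2.
  have w0 : w x != 0 by rewrite eq_complex /= negb_and invr_eq0 m0.
  by apply: (mulfI w0); rewrite -h1 -h2 vv'.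
apply: winj.
have -> : Op w (fun=> 0) (A u) = A (Op w (fun=> 0) u).
  by exact: (esym (congr1 (fun S : H -> H => S u) (cA w bw sw))).
have -> : Op w (fun=> 0) u = cls mu (fun x => w x * f x).
  by rewrite -[in LHS](repK u) mult_cls.
rewrite Abnd// -mult_cls// /f repK.
have := Op_comp sgK sg_mu ba bb bw b0 => /(congr1 (fun S => S u)) /= ->.
have := Op_comp sgK sg_mu bw b0 ba bb => /(congr1 (fun S => S u)) /= ->.
congr (Op _ _ u); apply/funext => x; rewrite ?sw; ring.
Qed.

End CrossedAlgebra.

(** * The crossed product as a noncommutative probability space *)

Section CrossedSpace.
Context {d : measure_display} {T : measurableType d} {R : realType}.
Variable mu : {finite_measure set T -> \bar R}.
Variable sg : {mfun T >-> T}.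
Hypothesis sgK : involutive sg.
Hypothesis sg_mu : forall A, measurable A -> mu (sg @^-1` A) = mu A.
Variable P : set T.
Hypothesis mP : measurable P.
Hypothesis hP : {ae mu, forall x, (x \in P) = ~~ (sg x \in P)}.
Hypothesis mu1 : mu setT = 1%E.
Implicit Types (f g a b c e w : T -> R[i]) (u v : L2 mu).

Local Notation H := (L2hilbert mu).
Local Notation "''[' x , y ]" := (@hdot R H x y) : ring_scope.
Local Notation Op := (@Op _ _ _ mu sg).
Local Notation half_indicator := (@half_indicator _ T R P).

(* This is the algebra of all [Op a b] (see [crossedP]); presented as a commutant,
   it is its own double commutant. *)
Definition crossed_alg : set (H -> H) := commutant (@invariant_mult _ _ _ mu sg).

(* As [P] is a fundamental domain of [sg], the indicators of [P] and of its image
   are vectors whose states add up to [Op a b |-> \int a]. *)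
Definition crossed_tau (A : H -> H) : R[i] :=
  '[A (cls mu half_indicator), cls mu half_indicator] +
  '[A (cls mu (fun x => half_indicator (sg x))), cls mu (fun x => half_indicator (sg x))].

Lemma invariant_mult_bounded A : @invariant_mult _ _ _ mu sg A -> bounded_op A.
Proof. by move=> [w [bw _ ->]]; apply: Op_bounded => //; exact: cbounded_cst. Qed.

Lemma Op_crossed a b : cbounded a -> cbounded b -> crossed_alg (Op a b).
Proof.
move=> ba bb; split; first exact: Op_bounded.
move=> _ [w [bw sw ->]]; have b0 := cbounded_cst (0 : R[i]).
rewrite !Op_comp//; congr Op; apply/funext => x; rewrite ?sw; ring.
Qed.

Lemma crossedP A : crossed_alg A ->
  exists a b, [/\ cbounded a, cbounded b & A = Op a b].
Proof. exact: (commutant_invariant_mult sgK sg_mu mP hP). Qed.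

Lemma cbounded_L2 f : cbounded f -> L2fun mu f.
Proof. exact: L2fun_bounded. Qed.

(** The indicators of P and of its image have almost disjoint supports, which kills the terms in b,
    and they add up to 1 almost everywhere, which restores a. *)
Lemma crossed_tau_Op a b : cbounded a -> cbounded b -> crossed_tau (Op a b) = Cint mu a.
Proof.
move=> ba bb; have bh := cbounded_half (R := R) mP; have bh' := cbounded_invol sg bh.
have L f : cbounded f -> L2fun mu f by exact: cbounded_L2.
rewrite /crossed_tau.
have c1 : cbounded (fun x => a x * half_indicator x + b x * half_indicator (sg x)).
  by apply: cboundedD; exact: cboundedM.
have c2 : cbounded (fun x => a x * half_indicator (sg x) + b x * half_indicator (sg (sg x))).
  by apply: cboundedD; apply: cboundedM => //; exact: (cbounded_invol sg bh').
rewrite !Op_cls//; try exact: L.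
have L1 f g : cbounded f -> cbounded g -> L1fun mu (fun x => f x * conjC (g x)).
  by move=> bf bg; apply: L1fun_cbounded; apply: cboundedM => //; exact: cbounded_conj.
rewrite [X in X + _](L2dotE (rep_cls (L _ c1)) (rep_cls (L _ bh)) (L _ c1) (L _ bh)).
rewrite [X in _ + X](L2dotE (rep_cls (L _ c2)) (rep_cls (L _ bh')) (L _ c2) (L _ bh')).
rewrite -CintD; [|exact: L1|exact: L1].
apply: Cint_ae; [|exact: ba.1|].
  by apply: cmeasurableD; apply: L1fun_meas; exact: L1.
apply: filterS (half_invol (R := R) hP) => x /= [s1 [s2 [s3 s4]]].
have hc y : conjC (half_indicator y) = half_indicator y by rewrite /half_indicator conj_Creal// ger0_real// lecR.
rewrite !hc sgK !mulrDl -!mulrA s3 s4 [half_indicator (sg x) * _]mulrC s2 !mulr0 !addr0.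
by rewrite -mulrDr s1 mulr1.
Qed.

Lemma Cint_cst (z : R[i]) : Cint mu (fun=> z) = z.
Proof.
apply: complex_ext; rewrite /= Rintegral_cst//.
  by rewrite [X in fine X](mu1 : _ = _) mulr1.
by rewrite [X in fine X](mu1 : _ = _) mulr1.
Qed.

Lemma crossed_von_neumann : von_neumann_algebra crossed_alg.
Proof.
split; first by move=> A [].
  move=> A /crossedP[a [b [ba bb ->]]].
  exists (Op (fun x => conjC (a x)) (fun x => conjC (b (sg x)))).
    by apply: Op_crossed; apply: cbounded_conj => //; exact: (cbounded_invol sg).
  exact: Op_adjoint.
by apply: commutant3; exact: invariant_mult_bounded.
Qed.

(** The diagonal coefficients of the two products differ only in the twisted term, where b (e o sg)
    becomes e (b o sg); these have the same integral by invariance of the measure. *)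
Lemma crossed_tau_trace A B : crossed_alg A -> crossed_alg B ->
  crossed_tau (A \o B) = crossed_tau (B \o A).
Proof.
move=> /crossedP[a [b [ba bb ->]]] /crossedP[c [e [bc be ->]]].
have I f g : cbounded f -> cbounded g -> cbounded (fun x => f x * g (sg x)).
  by move=> bf bg; apply: cboundedM => //; exact: (cbounded_invol sg).
rewrite (Op_comp sgK sg_mu ba bb bc be) (Op_comp sgK sg_mu bc be ba bb).
rewrite (crossed_tau_Op (cbounded_comp1 sg ba bb bc be) (cbounded_comp1 sg ba bb be bc)).
rewrite (crossed_tau_Op (cbounded_comp1 sg bc be ba bb) (cbounded_comp1 sg bc be bb ba)).
rewrite !CintD; try by apply: L1fun_cbounded; do ?[exact: cboundedM|exact: I].
congr (_ + _); first by congr Cint; apply/funext => x; rewrite mulrC.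
rewrite -[LHS](Cint_invol sg_mu); last by apply: L1fun_cbounded; exact: I.
by congr Cint; apply/funext => x; rewrite sgK mulrC.
Qed.

(** A positive operator whose form vanishes at a vector kills that vector. Being killed on both
    indicators means that the coefficients vanish on P and on its image, that is, almost
    everywhere. *)
Lemma crossed_tau_faithful A : crossed_alg A -> positive_op A ->
  crossed_tau A = 0 -> A = fun=> 0.
Proof.
move=> MA pA A0; have /bounded_opP[lA [K K0 AK]] := MA.1.
have bh := cbounded_half (R := R) mP; have bh' := cbounded_invol sg bh.
have null u : '[A u, u] = 0 -> A u = 0.
  move=> Auu; have := @positive_op_sqr R H A K u lA pA K0.
  rewrite Auu mulr0 => h; apply/eqP; rewrite -normr_eq0 -sqrf_eq0 eq_le exprn_ge0// andbT.
  apply: h => y; rewrite -[X in X <= _](ger0_norm (pA y)).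
  apply: le_trans (hdot_le _ _) _; rewrite expr2 mulrA; exact: ler_wpM2r.
have /eqP := A0; rewrite /crossed_tau paddr_eq0; [|exact: pA|exact: pA].
move=> /andP[/eqP/null h1 /eqP/null h2].
have [a [b [ba bb AE]]] := crossedP MA.
have b0 := cbounded_cst (0 : R[i]).
rewrite AE -(Op_zero sg_mu); apply: Op_ext => //.
all: move: h1 h2; rewrite AE !Op_cls//; try exact: cbounded_L2.
all: have c1 : cbounded (fun x => a x * half_indicator x + b x * half_indicator (sg x))
  by apply: cboundedD; exact: cboundedM.
all: have c2 : cbounded (fun x => a x * half_indicator (sg x) + b x * half_indicator (sg (sg x)))
  by apply: cboundedD; apply: cboundedM => //; exact: (cbounded_invol sg bh').
all: move=> h1 h2.
all: have r1 := rep_cls (cbounded_L2 c1); have r2 := rep_cls (cbounded_L2 c2).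
all: rewrite h1 in r1; rewrite h2 in r2.
all: apply: filterS3 (filterI r1 r2) (rep0 mu) hP => x [/= e1 e2] e0 xP.
all: move: e1 e2; rewrite e0 sgK /half_indicator !indicE xP.
all: by case: (_ \in _) => /=; rewrite ?mulr0 ?mulr1 ?addr0 ?add0r => e1 e2;
  first [exact: esym e1|exact: esym e2].
Qed.

Lemma crossed_state : faithful_normal_tracial_state crossed_alg crossed_tau.
Proof.
split.
- by move=> k A B _ _; rewrite /crossed_tau !hdotPl addrACA mulrDr.
- by move=> A _ pA; apply: addr_ge0; exact: pA.
- exact: crossed_tau_faithful.
- exact: crossed_tau_trace.
- move=> D A DM dirD lubA; split.
    move=> S DS; have [_ Aub _] := lubA.
    by apply: lerD; apply: le_op_dot; exact: Aub.
  move=> k Dk; apply: (normal_vector_states _ DM dirD lubA Dk).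
  exact: invariant_mult_bounded.
- rewrite -(Op_id sg_mu) crossed_tau_Op; try exact: cbounded_cst.
  exact: Cint_cst.
Qed.

(** For an isometry A with adjoint B, the defect 1 - A B is a projection, and its trace is 1 - tau(B
    A) = 0. Faithfulness makes it zero. *)
Lemma crossed_finite : finite_algebra crossed_alg.
Proof.
move=> A B MA MB AB BA.
have [bA _] := MA; have [bB _] := MB; have lA := bA.1.
pose C : H -> H := fun x => -1 *: (A \o B) x + x.
have MM X Y : crossed_alg X -> crossed_alg Y -> crossed_alg (X \o Y).
  move=> /crossedP[a [b [ba bb ->]]] /crossedP[c [e [bc be ->]]].
  rewrite Op_comp//; apply: Op_crossed; apply: cboundedD;
    apply: cboundedM => //; exact: (cbounded_invol sg).
have MC : crossed_alg C.
  have [a [b [ba bb E]]] := crossedP (MM _ _ MA MB).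
  have b1 k : cbounded (fun _ : T => k : R[i]) by exact: cbounded_cst.
  have -> : C = Op (fun x => -1 * a x + 1) (fun x => -1 * b x + 0).
    by apply/funext => x; rewrite (Op_lin sg_mu) // (Op_id sg_mu) /C E.
  by apply: Op_crossed; apply: cboundedD => //; exact: cboundedM.
have CE x : C x = x - A (B x) by rewrite /C scaleN1r addrC.
have pC : positive_op C.
  have CC x : C (C x) = C x.
    rewrite !CE (linear_opB _ _ bB.1) (linear_opB _ _ lA).
    rewrite -[B (A (B x))]/((B \o A) (B x)) BA subrr subr0 //.
  have adj x y : '[C x, y] = '[x, C y].
    by rewrite !CE hdotBl hdotBr (AB (B x)) (adjoint_sym AB x).
  move=> x; have -> : '[C x, x] = '[C x, C x] by rewrite [RHS]adj CC adj.
  exact: hdot_ge0.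
have t0 : crossed_tau C = 0.
  have := tau_linear crossed_state (-1) (MM _ _ MA MB) (_ : crossed_alg id).
  rewrite crossed_tau_trace// BA (tau1 crossed_state) => ->; first by rewrite mulN1r addNr.
  by rewrite -(Op_id sg_mu); apply: Op_crossed; exact: cbounded_cst.
have C0 := crossed_tau_faithful MC pC t0.
apply/funext => x; have := congr1 (fun S : H -> H => S x) C0.
by rewrite CE => /eqP; rewrite subr_eq0 => /eqP.
Qed.

Definition crossed_space : ncProbSpace R :=
  NCProbSpace crossed_von_neumann crossed_finite crossed_state.

End CrossedSpace.

(** * Spectral calculus in the crossed product *)

Section RawIntegral.
Context {d : measure_display} {T : measurableType d} {R : realType}.

Import HBNNSimple.

(* Here the m_i are arbitrary set functions: only measurable sets matter. *)
Lemma eq_setfun_integral (m1 m2 : set T -> \bar R) (f : T -> \bar R) :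
  (forall A, measurable A -> m1 A = m2 A) ->
  (\int[m1]_x f x = \int[m2]_x f x)%E.
Proof.
move=> m12; rewrite /integral; congr (_ - _)%E; congr ereal_sup;
  by apply/seteqP; split=> _ [h hf <-]; exists h => //; apply: eq_fsbigr => r _;
    rewrite m12//; exact: measurable_sfunP.
Qed.

End RawIntegral.

(** * Images of measures with density *)

Section WeightedPushforward.
Context {d d' : measure_display} {X : measurableType d} {Y : measurableType d'}
  {R : realType}.
Variables (mu : {measure set X -> \bar R}) (phi : {mfun X >-> Y}) (rho : X -> R).
Hypothesis mrho : measurable_fun setT rho.
Hypothesis rho0 : forall x, 0 <= rho x.

(** For rho = |u|^2 this is the spectral measure, at the vector u, of the multiplication by phi. *)
Definition weighted_pushforward (A : set Y) : \bar R :=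
  (\int[mu]_(x in phi @^-1` A) (rho x)%:E)%E.

Let wp0 : weighted_pushforward set0 = 0%E.
Proof. by rewrite /weighted_pushforward preimage_set0 integral_set0. Qed.

Let wp_ge0 A : (0 <= weighted_pushforward A)%E.
Proof. by apply: integral_ge0 => x _; rewrite lee_fin. Qed.

Let wp_sigma_additive : semi_sigma_additive weighted_pushforward.
Proof.
move=> F mF tF mUF; rewrite /weighted_pushforward preimage_bigcup.
apply: (@semi_sigma_additive_nng_induced _ _ _ mu (EFin \o rho) _ _ (fun n => phi @^-1` F n)).
- exact/measurable_EFinP.
- by move=> x; rewrite lee_fin.
- by move=> n; rewrite -[X in measurable X]setTI; exact: measurable_funPT.
- apply/trivIsetP => /= i j _ _ ij; rewrite -preimage_setI.
  by move/trivIsetP : tF => /(_ _ _ _ _ ij) ->//; rewrite preimage_set0.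
- by rewrite -preimage_bigcup -[X in measurable X]setTI; exact: measurable_funPT.
Qed.

HB.instance Definition _ := isMeasure.Build _ _ _ weighted_pushforward
  wp0 wp_ge0 wp_sigma_additive.

Lemma weighted_pushforwardE A : measurable A ->
  weighted_pushforward A = (\int[mu]_x (\1_A (phi x) * rho x)%:E)%E.
Proof.
move=> mA; rewrite /weighted_pushforward integral_mkcond; apply: eq_integral => x _.
rewrite patchE indicE; have -> : (x \in phi @^-1` A) = (phi x \in A).
  by apply/idP/idP; rewrite !inE.
by case: ifPn => _; rewrite ?mul1r ?mul0r.
Qed.

Import HBNNSimple.

Let mphi : measurable_fun setT phi. Proof. exact: measurable_funPT. Qed.

Let integral_wp_nnsfun (h : {nnsfun Y >-> R}) :
  (\int[weighted_pushforward]_y (h y)%:E = \int[mu]_x (h (phi x) * rho x)%:E)%E.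
Proof.
have mI (r : R) : measurable_fun setT (\1_(h @^-1` [set r]) : Y -> R).
  exact: measurable_indic.
under [LHS]eq_integral do rewrite fimfunE -fsumEFin//.
rewrite [LHS]ge0_integral_fsum//; last 2 first.
  - by move=> r; exact/measurable_EFinP/measurableT_comp.
  - by move=> n x _; rewrite EFinM nnfun_muleindic_ge0.
under [RHS]eq_integral.
  move=> x xD; rewrite fimfunE EFinM -fsumEFin// ge0_mule_fsuml; last first.
    by move=> r; rewrite EFinM nnfun_muleindic_ge0.
  over.
rewrite [RHS]ge0_integral_fsum//; last 2 first.
  - move=> r; under eq_fun do rewrite -EFinM; apply/measurable_EFinP.
    apply: measurable_funM => //; apply: measurable_funM => //.
    exact: (measurableT_comp (mI r) mphi).
  - by move=> n x _; apply: mule_ge0; [rewrite EFinM nnfun_muleindic_ge0|rewrite lee_fin].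
apply: eq_fsbigr => r _; rewrite integralZl_indic_nnsfun//= integral_indic// setIT.
have [r0|r0] := ltP r 0.
  rewrite preimage_nnfun0//= measure0 mule0; apply/esym.
  by rewrite integral0_eq// => x _; rewrite indic0 mulr0 mul0e.
rewrite (eq_integral (fun x => r%:E * (\1_(h @^-1` [set r]) (phi x) * rho x)%:E)%E); last first.
  by move=> x _; rewrite -!EFinM mulrA.
rewrite ge0_integralZl//.
- by congr (_ * _)%E; exact: weighted_pushforwardE.
- apply/measurable_EFinP; apply: measurable_funM => //.
  exact: (measurableT_comp (mI r) mphi).
- by move=> x _; rewrite lee_fin mulr_ge0.
Qed.

Lemma integral_weighted_pushforward (h : Y -> \bar R) :
  measurable_fun setT h -> (forall y, 0 <= h y)%E ->
  (\int[weighted_pushforward]_y h y = \int[mu]_x (h (phi x) * (rho x)%:E))%E.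
Proof.
move=> mh h0.
pose h_ := nnsfun_approx measurableT mh.
transitivity (limn (fun n => \int[weighted_pushforward]_y (h_ n y)%:E)%E).
  rewrite -monotone_convergence//=.
  - apply: eq_integral => ? /[!inE] xD; apply/esym/cvg_lim => //=.
    exact: cvg_nnsfun_approx.
  - by move=> n; exact/measurable_EFinP/measurable_funTS.
  - by move=> n ? _; rewrite lee_fin.
  - by move=> ? _ ? ? mn; rewrite lee_fin; exact/lefP/nd_nnsfun_approx.
transitivity (limn (fun n => \int[mu]_x (h_ n (phi x) * rho x)%:E)%E).
  by apply: congr_lim; apply/funext => n /=; exact: integral_wp_nnsfun.
rewrite -monotone_convergence//=.
- apply: eq_integral => x _; apply/cvg_lim => //.
  under eq_fun do rewrite EFinM.
  by apply: cvgeZr => //; exact: cvg_nnsfun_approx.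
- move=> n; apply/measurable_EFinP; apply: measurable_funM => //.
  exact: (measurableT_comp (measurable_funPT (h_ n)) mphi).
- by move=> n ? _; rewrite lee_fin mulr_ge0.
- move=> x _ m n mn; rewrite lee_fin ler_wpM2r//; exact/lefP/nd_nnsfun_approx.
Qed.

Definition weighted_measure : {measure set Y -> \bar R} := weighted_pushforward.

Lemma integral_weighted_measure (h : Y -> \bar R) :
  measurable_fun setT h -> (forall y, 0 <= h y)%E ->
  (\int[weighted_measure]_y h y = \int[mu]_x (h (phi x) * (rho x)%:E))%E.
Proof. exact: integral_weighted_pushforward. Qed.

Lemma weighted_measureE A : measurable A ->
  weighted_measure A = (\int[mu]_x (\1_A (phi x) * rho x)%:E)%E.
Proof. exact: weighted_pushforwardE. Qed.

End WeightedPushforward.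

(** * Functional calculus for a projection commuting with the even functions *)

Section SpecOp.
Context {d : measure_display} {T : measurableType d} {R : realType}.
Variable mu : {finite_measure set T -> \bar R}.
Variable sg : {mfun T >-> T}.
Hypothesis sgK : involutive sg.
Hypothesis sg_mu : forall A, measurable A -> mu (sg @^-1` A) = mu A.
Implicit Types (f g : T -> R) (w : T -> R[i]) (u v : L2 mu).

Local Notation H := (L2hilbert mu).
Local Notation "''[' x , y ]" := (@hdot R H x y) : ring_scope.
Local Notation Op := (@Op _ _ _ mu sg).

Definition inv_fun f := [/\ measurable_fun setT f,
  exists K, forall x, `|f x| <= K & forall x, f (sg x) = f x].

(** The two equations say that w sg is an involution and that it is self-adjoint, so that (1 + w sg)
    / 2 is a projection. *)
Definition twist w := [/\ cbounded w, forall x, w x * w (sg x) = 1 &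
  forall x, conjC (w x) = w (sg x)].

(* [f p + g (1 - p)], where [p = (1 + w sg) / 2] is a projection commuting with
   the even functions [f] and [g]. *)
Definition spec_op f g w : H -> H :=
  Op (fun x => ((f x + g x) / 2)%:C) (fun x => ((f x - g x) / 2)%:C * w x).

Lemma inv_fun_cst k : inv_fun (fun=> k).
Proof. by split=> //; exists `|k|. Qed.

Lemma inv_funM f g : inv_fun f -> inv_fun g -> inv_fun (fun x => f x * g x).
Proof.
move=> [mf [K fK] sf] [mg [L gL] sg']; split.
- exact: measurable_funM.
- by exists (K * L) => x; rewrite normrM ler_pM.
- by move=> x; rewrite sf sg'.
Qed.

Lemma inv_fun_indic f (A : set R) : inv_fun f -> measurable A ->
  inv_fun (fun x => \1_A (f x)).
Proof.
move=> [mf _ sf] mA; split.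
- have mI : measurable_fun setT (\1_A : R -> R) by exact: measurable_indic.
  exact: (measurableT_comp mI mf).
- by exists 1 => x; rewrite indicE; case: (_ \in _); rewrite ?normr1 ?normr0.
- by move=> x; rewrite sf.
Qed.

Section Coefficients.
Variables (f g : T -> R) (w : T -> R[i]).
Hypotheses (hf : inv_fun f) (hg : inv_fun g) (hw : twist w).

Lemma spec_coef1 : cbounded (fun x => ((f x + g x) / 2)%:C).
Proof.
have [mf [K fK] _] := hf; have [mg [L gL] _] := hg.
apply: cbounded_real.
  by apply: measurable_funM => //; exact: measurable_funD.
exists ((K + L) * `|2^-1|) => x; rewrite normrM ler_wpM2r//.
by apply: le_trans (ler_normD _ _) _; exact: lerD.
Qed.

Lemma spec_coef2 : cbounded (fun x => ((f x - g x) / 2)%:C * w x).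
Proof.
have [mf [K fK] _] := hf; have [mg [L gL] _] := hg; have [bw _ _] := hw.
apply: cboundedM => //; apply: cbounded_real.
  by apply: measurable_funM => //; exact: measurable_funB.
exists ((K + L) * `|2^-1|) => x; rewrite normrM ler_wpM2r//.
by apply: le_trans (ler_normB _ _) _; exact: lerD.
Qed.

Lemma spec_op_bounded : bounded_op (spec_op f g w).
Proof. by apply: Op_bounded => //; [exact: spec_coef1|exact: spec_coef2]. Qed.

Lemma spec_op_adj : adjoint_of (spec_op f g w) (spec_op f g w).
Proof.
have h : adjoint_of (spec_op f g w) (Op (fun x => conjC ((f x + g x) / 2)%:C)
    (fun x => conjC (((f (sg x) - g (sg x)) / 2)%:C * w (sg x))) : H -> H).
  exact: (Op_adjoint sgK sg_mu spec_coef1 spec_coef2).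
have cr (r : R) : conjC r%:C = r%:C :> R[i] by rewrite conj_Creal// complex_real.
have [_ _ sf] := hf; have [_ _ sg'] := hg; have [_ _ cw] := hw.
have e1 : (fun x => conjC ((f x + g x) / 2)%:C) = (fun x => ((f x + g x) / 2)%:C).
  by apply/funext => x; rewrite cr.
have e2 : (fun x => conjC (((f (sg x) - g (sg x)) / 2)%:C * w (sg x))) =
    (fun x => ((f x - g x) / 2)%:C * w x).
  by apply/funext => x; rewrite rmorphM /= cw sgK sf sg' cr.
by rewrite e1 e2 in h.
Qed.

End Coefficients.

(** Invariant functions commute with p = (1 + w sg) / 2, so the pairs (f, g) multiply
    coordinatewise. Idempotent pairs thus give projections. *)
Lemma spec_op_comp f g f' g' w : inv_fun f -> inv_fun g -> inv_fun f' -> inv_fun g' ->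
  twist w -> spec_op f g w \o spec_op f' g' w =
  spec_op (fun x => f x * f' x) (fun x => g x * g' x) w.
Proof.
move=> hf hg hf' hg' hw; have [_ ww _] := hw.
have [_ _ sf'] := hf'; have [_ _ sg'] := hg'.
rewrite /spec_op Op_comp//; try exact: spec_coef1; try exact: spec_coef2.
congr Op; apply/funext => x; rewrite ?sf' ?sg'.
  rewrite (_ : _ + _ = (((f x + g x) / 2) * ((f' x + g' x) / 2))%:C +
    (((f x - g x) / 2) * ((f' x - g' x) / 2))%:C * (w x * w (sg x))).
    by rewrite ww mulr1 -rmorphD; congr _%:C; field.
  by rewrite !rmorphM /=; ring.
rewrite (_ : _ + _ = ((((f x + g x) / 2) * ((f' x - g' x) / 2)) +
    (((f x - g x) / 2) * ((f' x + g' x) / 2)))%:C * w x).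
  by congr (_%:C * _); field.
by rewrite !(rmorphM, rmorphD) /=; ring.
Qed.

Lemma spec_op_compE f g f' g' w u : inv_fun f -> inv_fun g -> inv_fun f' -> inv_fun g' ->
  twist w -> spec_op f g w (spec_op f' g' w u) =
  spec_op (fun x => f x * f' x) (fun x => g x * g' x) w u.
Proof.
move=> hf hg hf' hg' hw.
exact: (congr1 (fun S : H -> H => S u) (spec_op_comp hf hg hf' hg' hw)).
Qed.

Lemma spec_op_id w : spec_op (fun=> 1) (fun=> 1) w = id.
Proof.
rewrite -(Op_id sg_mu) /spec_op; congr Op; apply/funext => x.
  by rewrite -[1 + 1]/(2%:R) divff.
by rewrite subrr mul0r mul0r.
Qed.

Lemma spec_op_diag f w : spec_op f f w = Op (fun x => (f x)%:C) (fun=> 0).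
Proof.
rewrite /spec_op; congr Op; apply/funext => x.
  by congr _%:C; field.
by rewrite subrr mul0r mul0r.
Qed.

Lemma spec_opD f g f' g' w u : inv_fun f -> inv_fun g -> inv_fun f' -> inv_fun g' ->
  twist w -> (spec_op (fun x => f x + f' x) (fun x => g x + g' x) w u : H) =
  spec_op f g w u + spec_op f' g' w u.
Proof.
move=> hf hg hf' hg' hw; rewrite -[X in _ = X + _]scale1r -(Op_lin sg_mu);
  try exact: spec_coef1; try exact: spec_coef2.
rewrite /spec_op; congr (Op _ _ u); apply/funext => x.
  by rewrite mul1r -rmorphD; congr _%:C; field.
by rewrite mul1r -mulrDl -rmorphD; congr (_%:C * _); field.
Qed.

Lemma spec_opZ (t : R) f g w u : inv_fun f -> inv_fun g -> twist w ->
  (spec_op (fun x => t * f x) (fun x => t * g x) w u : H) = t%:C *: spec_op f g w u.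
Proof.
move=> hf hg hw.
rewrite -[RHS]addr0 -[X in _ = _ + X]/((fun=> 0 : H) u) -(Op_zero sg_mu) -(Op_lin sg_mu);
  try exact: spec_coef1; try exact: spec_coef2; try exact: cbounded_cst.
rewrite /spec_op; congr (Op _ _ u); apply/funext => x.
  by rewrite addr0 -rmorphM; congr _%:C; field.
by rewrite addr0 mulrA -rmorphM; congr (_%:C * _); field.
Qed.

Lemma spec_op_projection f g w : inv_fun f -> inv_fun g -> twist w ->
  (forall x, f x * f x = f x) -> (forall x, g x * g x = g x) ->
  projection (spec_op f g w).
Proof.
move=> hf hg hw ff gg; split.
- exact: spec_op_bounded.
- by rewrite spec_op_comp//; congr spec_op; apply/funext.
- exact: spec_op_adj.
Qed.

Lemma mult_dot f u : inv_fun f -> '[Op (fun x => (f x)%:C) (fun=> 0) u, u] =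
  (\int[mu]_x (f x * sqn (rep u x)))%:C.
Proof.
move=> [mf [K fK] _].
have bf : cbounded (fun x => (f x)%:C) by apply: cbounded_real => //; exists K.
have u2 := L2fun_rep u.
rewrite [LHS](L2dotE (rep_mult sg_mu u bf) (aeeq_refl _ _))//; last exact: L2funMb.
have E x : (f x)%:C * rep u x * conjC (rep u x) = (f x * sqn (rep u x))%:C.
  by rewrite -mulrA -sqnE -rmorphM.
under eq_fun do rewrite E.
apply: complex_ext => //=.
by rewrite Rintegral_cst// mul0r.
Qed.

Definition spec_part1 w u := spec_op (fun=> 1) (fun=> 0) w u.
Definition spec_part2 w u := spec_op (fun=> 0) (fun=> 1) w u.

(** Since p and 1 - p commute with f and g, the quadratic form splits into the forms of two
    multiplications, at p u and at (1 - p) u. Positivity and the spectral measure both follow from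
    this splitting. *)
Lemma spec_op_dot f g w u : inv_fun f -> inv_fun g -> twist w ->
  '[spec_op f g w u, u] =
    (\int[mu]_x (f x * sqn (rep (spec_part1 w u : L2 mu) x)) +
     \int[mu]_x (g x * sqn (rep (spec_part2 w u : L2 mu) x)))%:C.
Proof.
move=> hf hg hw; have h0 := inv_fun_cst 0; have h1 := inv_fun_cst 1.
have -> : spec_op f g w u = spec_op f (fun=> 0) w u + (spec_op (fun=> 0) g w u : H).
  rewrite -spec_opD//; congr (spec_op _ _ w u); apply/funext => x; by rewrite ?addr0 ?add0r.
have e1 : spec_op f (fun=> 0) w u =
    spec_op (fun=> 1) (fun=> 0) w (spec_op f f w (spec_op (fun=> 1) (fun=> 0) w u)).
  rewrite !spec_op_compE//; try exact: inv_funM.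
  by congr (spec_op _ _ w u); apply/funext => x; rewrite ?mulr1 ?mul1r ?mulr0.
have e2 : spec_op (fun=> 0) g w u =
    spec_op (fun=> 0) (fun=> 1) w (spec_op g g w (spec_op (fun=> 0) (fun=> 1) w u)).
  rewrite !spec_op_compE//; try exact: inv_funM.
  by congr (spec_op _ _ w u); apply/funext => x; rewrite ?mulr1 ?mul1r ?mulr0.
transitivity ('[spec_op f f w (spec_part1 w u), spec_part1 w u] +
  '[spec_op g g w (spec_part2 w u), spec_part2 w u]).
  rewrite hdotDl e1 e2; congr (_ + _).
    exact: (spec_op_adj h1 h0 hw).
  exact: (spec_op_adj h0 h1 hw).
by rewrite !spec_op_diag (mult_dot (spec_part1 w u) hf) (mult_dot (spec_part2 w u) hg) -rmorphD.
Qed.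

Lemma spec_op_positive f g w : inv_fun f -> inv_fun g -> twist w ->
  (forall x, 0 <= f x) -> (forall x, 0 <= g x) -> positive_op (spec_op f g w).
Proof.
move=> hf hg hw f0 g0 u; rewrite spec_op_dot// lecR addr_ge0//;
  by apply: Rintegral_ge0 => x _; rewrite mulr_ge0// sqn_ge0.
Qed.

End SpecOp.

(** * Explicit spectral measures *)

Section SpectralMeasure.
Context {d : measure_display} {T : measurableType d} {R : realType}.
Variable mu : {finite_measure set T -> \bar R}.
Variable sg : {mfun T >-> T}.
Hypothesis sgK : involutive sg.
Hypothesis sg_mu : forall A, measurable A -> mu (sg @^-1` A) = mu A.
Variables (f g : {mfun T >-> R}) (w : T -> R[i]).
Hypotheses (hf : inv_fun sg f) (hg : inv_fun sg g) (hw : twist sg w).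
Hypotheses (f0 : forall x, 0 <= f x) (g0 : forall x, 0 <= g x).

Local Notation H := (L2hilbert mu).
Local Notation "''[' x , y ]" := (@hdot R H x y) : ring_scope.
Local Notation spec_op := (@spec_op _ _ _ mu sg).

Definition spec_proj (A : set R) : H -> H :=
  spec_op (fun x => \1_A (f x)) (fun x => \1_A (g x)) w.

Local Notation rho1 u := (fun x => sqn (rep (spec_part1 sg w u : L2 mu) x)).
Local Notation rho2 u := (fun x => sqn (rep (spec_part2 sg w u : L2 mu) x)).

Lemma EFin_Rintegral_sqn (h : T -> R) (u : L2 mu) : inv_fun sg h -> 
  (\int[mu]_x (h x * sqn (rep u x)))%:E = (\int[mu]_x (h x * sqn (rep u x))%:E)%E.
Proof.
move=> [mh [K hK] _]; rewrite /Rintegral fineK//.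
apply: integrable_fin_num => //.
have I := integrableZl measurableT K (integrable_sqn_rep u).
have ms : measurable_fun setT (fun x => sqn (rep u x)).
  by apply: measurable_sqn; exact: L2fun_meas (L2fun_rep u).
apply: le_integrable I => //.
  by apply/measurable_EFinP; exact: measurable_funM.
move=> x _ /=; rewrite lee_fin !normrM ler_wpM2r//.
by apply: le_trans (hK x) _; exact: ler_norm.
Qed.

Lemma measurable_rho1 u : measurable_fun setT (rho1 u).
Proof. by apply: measurable_sqn; exact: L2fun_meas (L2fun_rep _). Qed.

Lemma measurable_rho2 u : measurable_fun setT (rho2 u).
Proof. by apply: measurable_sqn; exact: L2fun_meas (L2fun_rep _). Qed.

Let rho1_ge0 u x : 0 <= rho1 u x. Proof. exact: sqn_ge0. Qed.
Let rho2_ge0 u x : 0 <= rho2 u x. Proof. exact: sqn_ge0. Qed.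

Definition spec_measure (u : L2 mu) : {measure set R -> \bar R} :=
  measure_add (weighted_measure mu f (measurable_rho1 u) (rho1_ge0 u))
              (weighted_measure mu g (measurable_rho2 u) (rho2_ge0 u)).

Lemma spectral_distrE u A : measurable A ->
  spectral_distr spec_proj u A = spec_measure u A.
Proof.
move=> mA; rewrite /spectral_distr /spec_proj.
have i1 := inv_fun_indic hf mA; have i2 := inv_fun_indic hg mA.
rewrite (spec_op_dot sgK sg_mu u i1 i2 hw) /= EFinD [RHS]measure_addE.
rewrite !weighted_measureE//; congr (_ + _)%E; first exact: (EFin_Rintegral_sqn _ i1).
exact: (EFin_Rintegral_sqn _ i2).
Qed.

Lemma spectral_distr_spec_measure u (h : R -> \bar R) :
  (\int[spectral_distr spec_proj u]_l h l = \int[spec_measure u]_l h l)%E.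
Proof. by apply: eq_setfun_integral => A mA; exact: spectral_distrE. Qed.

Lemma integral_spec_measure u (h : R -> \bar R) : measurable_fun setT h ->
  (forall l, 0 <= h l)%E ->
  (\int[spec_measure u]_l h l =
   \int[mu]_x (h (f x) * (rho1 u x)%:E) + \int[mu]_x (h (g x) * (rho2 u x)%:E))%E.
Proof.
move=> mh h0; rewrite ge0_integral_measure_add//.
congr (_ + _)%E.
  exact: (integral_weighted_measure mu f (measurable_rho1 u) (rho1_ge0 u) mh h0).
exact: (integral_weighted_measure mu g (measurable_rho2 u) (rho2_ge0 u) mh h0).
Qed.

(** The spectral projection of A is obtained by applying the indicator of A to f and g. At a vector
    u its distribution is the sum of the images of |p u|^2 mu under f and of |(1 - p) u|^2 mu under
    g. Boundedness of f and g makes the domain condition hold for every vector. *)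
Lemma spec_spectral_measure : spectral_measure_of (gr (spec_op f g w)) spec_proj.
Proof.
have Mb (h : T -> R) (u : L2 mu) : inv_fun sg h -> (forall x, 0 <= h x) ->
    (\int[mu]_x ((h x)%:E * (sqn (rep u x))%:E))%E = (\int[mu]_x (h x * sqn (rep u x)))%:E.
  by move=> hh h0; rewrite (EFin_Rintegral_sqn u hh); apply: eq_integral => x _; rewrite EFinM.
split.
- move=> A mA; apply: spec_op_projection => //; try exact: inv_fun_indic.
  + by move=> x; rewrite indicE; case: (_ \in _); rewrite ?mulr1 ?mulr0.
  + by move=> x; rewrite indicE; case: (_ \in _); rewrite ?mulr1 ?mulr0.
- rewrite -(spec_op_id sg_mu w) /spec_proj; congr spec_op; apply/funext => x;
    by rewrite indicT.
- move=> u F mF tF mUF; rewrite spectral_distrE//.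
  rewrite (_ : (fun n => _) = (fun n => \sum_(0 <= i < n) spec_measure u (F i))%E).
    exact: measure_semi_sigma_additive.
  by apply/funext => n; apply: eq_bigr => i _; exact: spectral_distrE.
- move=> u; rewrite dom_gr; split => // _.
  rewrite spectral_distr_spec_measure integral_spec_measure//; first last.
  + by move=> l; rewrite lee_fin sqr_ge0.
  + by apply/measurable_EFinP; exact: exprn_measurable.
  have h1 := inv_funM hf hf; have h2 := inv_funM hg hg.
  rewrite (Mb (fun x => f x ^+ 2) (spec_part1 sg w u)) ?(Mb (fun x => g x ^+ 2) (spec_part2 sg w u)).
  + by rewrite -EFinD ltry.
  + exact: h2.
  + by move=> x; rewrite sqr_ge0.
  + exact: h1.
  + by move=> x; rewrite sqr_ge0.
- move=> u v; rewrite /gr /= => ->.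
  rewrite (spec_op_dot sgK sg_mu u hf hg hw); congr _%:C.
  (* The change of variables is for nonnegative integrands; the negative part of the identity
     contributes nothing because f and g are nonnegative. *)
  rewrite spectral_distr_spec_measure integralE.
  have mE : measurable_fun setT (@EFin R) by [].
  have fneg (r : R) : 0 <= r -> (EFin^\- r = 0)%E.
    by move=> r0; rewrite funenegE; apply/max_idPr; rewrite -EFinN lee_fin oppr_le0.
  rewrite [X in (_ - X)%E](_ : _ = 0)%E; last first.
    rewrite integral_spec_measure//; last exact: measurable_funeneg.
    by rewrite !integral0_eq ?adde0// => x _; rewrite fneg ?mul0e.
  rewrite sube0 integral_spec_measure//; last exact: measurable_funepos.
  have fpos (r : R) : 0 <= r -> (EFin^\+ r = r%:E)%E.
    by move=> hx; rewrite funeposE; apply/max_idPl; rewrite lee_fin.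
  under eq_integral do rewrite fpos//.
  under [X in (_ + X)%E]eq_integral do rewrite fpos//.
  by rewrite (Mb f)// (Mb g)// -EFinD.
Qed.

End SpectralMeasure.

Lemma half_combination (R : realType) (V : lmodType R[i]) (a b : R[i]) (u z : V) :
  a *: (2^-1 *: u + 2^-1 *: z) + b *: (u - (2^-1 *: u + 2^-1 *: z)) =
  ((a + b) / 2) *: u + ((a - b) / 2) *: z.
Proof.
have -> : u - (2^-1 *: u + 2^-1 *: z) = 2^-1 *: u - 2^-1 *: z.
  rewrite opprD addrA; congr (_ - _); rewrite -{1}[u]scale1r -scalerBl.
  by congr (_ *: _); field.
rewrite scalerDr scalerBr !scalerA addrACA -scalerDl -scalerBl -mulrDl -mulrBl.
by [].
Qed.

Lemma hdot_comb (R : realType) (H : hilbertSpace R) (k l : R[i]) (x y z : H) :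
  hdot H (k *: x + l *: y) z = k * hdot H x z + l * hdot H y z.
Proof. by rewrite hdotPl hdotZl. Qed.

(** * A free pair of two-valued operators *)

Section FreePair.
Context {d : measure_display} {T : measurableType d} {R : realType}.
Variable mu : {finite_measure set T -> \bar R}.
Variable sg : {mfun T >-> T}.
Hypothesis sgK : involutive sg.
Hypothesis sg_mu : forall A, measurable A -> mu (sg @^-1` A) = mu A.
Variable P : set T.
Hypothesis mP : measurable P.
Hypothesis hP : {ae mu, forall x, (x \in P) = ~~ (sg x \in P)}.
Hypothesis mu1 : mu setT = 1%E.

Local Notation H := (L2hilbert mu).
Local Notation "''[' x , y ]" := (@hdot R H x y) : ring_scope.
Local Notation Op := (@Op _ _ _ mu sg).
Local Notation spec_op := (@spec_op _ _ _ mu sg).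
Local Notation M := (crossed_space sgK sg_mu mP hP mu1).

Local Notation alg := (@crossed_alg _ _ _ mu sg).
Local Notation tau := (@crossed_tau _ _ _ mu sg P).
Implicit Types (f g : T -> R) (w : T -> R[i]).

Lemma tau_comb k l (A B : H -> H) :
  tau (fun u => k *: A u + l *: B u) = k * tau A + l * tau B.
Proof.
rewrite /crossed_tau.
set e1 : H := cls mu (@half_indicator _ T R P).
set e2 : H := cls mu (fun x => @half_indicator _ T R P (sg x)).
transitivity ((k * '[A e1, e1] + l * '[B e1, e1]) + (k * '[A e2, e2] + l * '[B e2, e2])).
  by congr (_ + _); exact: hdot_comb.
by rewrite addrACA -!mulrDr.
Qed.

Lemma spec_op_in f g w : inv_fun sg f -> inv_fun sg g -> twist sg w ->
  alg (spec_op f g w).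
Proof. by move=> hf hg hw; apply: Op_crossed => //; [exact: spec_coef1 hf hg|exact: spec_coef2 hf hg hw]. Qed.

Lemma tau_spec_op f g w : inv_fun sg f -> inv_fun sg g -> twist sg w ->
  tau (spec_op f g w) = (\int[mu]_x ((f x + g x) / 2))%:C.
Proof.
move=> hf hg hw; rewrite (crossed_tau_Op sgK sg_mu mP hP (spec_coef1 hf hg) (spec_coef2 hf hg hw)).
by apply: complex_ext => //=; rewrite Rintegral_cst// mul0r.
Qed.

Section MeasurableOperator.
Variables (f g : {mfun T >-> R}) (w : T -> R[i]).
Hypotheses (hf : inv_fun sg f) (hg : inv_fun sg g) (hw : twist sg w).
Hypotheses (f0 : forall x, 0 <= f x) (g0 : forall x, 0 <= g x).

Lemma spec_measurable : forall e : R, 0 < e -> exists p : nc_space M -> nc_space M,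
    [/\ nc_alg p, projection p, forall xi, dom (gr (spec_op f g w)) (p xi) &
        complex.Re (nc_tau (fun xi => xi - p xi)) <= e].
Proof.
move=> e e0; exists id; split.
- by rewrite -(Op_id sg_mu); apply: Op_crossed => //; exact: cbounded_cst.
- by split => //; exact: bounded_op_id.
- by move=> xi; rewrite dom_gr.
- rewrite (_ : (fun xi => _) = fun=> 0); last by apply/funext => xi; rewrite subrr.
  have -> : nc_tau (n := M) (fun=> 0) = 0.
    by rewrite -[LHS]/(tau (fun=> 0)) /crossed_tau /= !(@hdot0l R H) addr0.
  exact: ltW.
Qed.

Definition spec_mo : measurableOperator M :=
  @MeasurableOperator R M (gr (spec_op f g w))
    (closed_operator_gr (spec_op_bounded sg_mu hf hg hw))
    (affiliated_gr (spec_op_in hf hg hw)) spec_measurable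
    (gr (spec_op f g w))
    (modulus_of_gr (spec_op_adj sgK sg_mu hf hg hw)
      (spec_op_positive sgK sg_mu hf hg hw f0 g0))
    (@spec_proj _ _ _ mu sg f g w)
    (spec_spectral_measure sgK sg_mu hf hg hw f0 g0).

Lemma spec_mo_rv : nc_random_variable spec_mo.
Proof. exact: self_adjoint_gr (spec_op_adj sgK sg_mu hf hg hw). Qed.

(** The diagonal coefficient of the spectral projection is the mean of the indicators of A at f and
    at g, as p and 1 - p each carry half of the trace. *)
Lemma nc_distr_spec_mo A : measurable A ->
  nc_distr spec_mo A = ((2^-1)%:E * (mu (f @^-1` A) + mu (g @^-1` A)))%E.
Proof.
move=> mA; rewrite /nc_distr /trace.
have i1 := inv_fun_indic hf mA; have i2 := inv_fun_indic hg mA.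
rewrite [nc_tau _](tau_spec_op i1 i2 hw) /=.
have E (h : {mfun T >-> R}) x : \1_A (h x) = \1_(h @^-1` A) x :> R.
  by rewrite !indicE; congr (_%:R); congr nat_of_bool; apply/idP/idP; rewrite !inE.
have mh (h : {mfun T >-> R}) : measurable (h @^-1` A).
  by rewrite -[X in measurable X]setTI; exact: measurable_funPT.
have I (h : {mfun T >-> R}) : mu.-integrable setT (EFin \o (fun x => \1_(h @^-1` A) x : R)).
  exact: integrable_indic.
under eq_Rintegral do rewrite mulrC !E.
rewrite RintegralZl//; last first.
  by have := integrableD measurableT (I f) (I g).
rewrite (RintegralD measurableT (I f) (I g)).
rewrite EFinM EFinD /Rintegral !fineK; [|exact: integrable_fin_num (I g)|exact: integrable_fin_num (I f)].
by rewrite !integral_indic// !setIT.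
Qed.

End MeasurableOperator.

Section TwoPoint.
Variable (w : T -> R[i]).
Hypothesis (hw : twist sg w).
Variable (t : R).
Hypothesis (t0 : 0 < t).

Definition tp_mo := spec_mo (f := cst t) (g := cst 0) (inv_fun_cst sg t)
  (inv_fun_cst sg 0) hw (fun _ => ltW t0) (fun _ => lexx 0).

Let p := spec_op (fun=> 1) (fun=> 0) w.

Let hp : projection p.
Proof.
by apply: spec_op_projection => //; try exact: inv_fun_cst; move=> x; rewrite ?mulr1 ?mulr0.
Qed.

Let i1 : inv_fun sg (fun=> 1 : R). Proof. exact: inv_fun_cst. Qed.
Let i0 : inv_fun sg (fun=> 0 : R). Proof. exact: inv_fun_cst. Qed.

Lemma tp_opE : spec_op (cst t) (cst 0) w = (fun u => t%:C *: p u).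
Proof.
apply/funext => u; rewrite /p -(spec_opZ sg_mu t u i1 i0 hw).
by congr (spec_op _ _ w u); apply/funext => x; rewrite ?mulr1 ?mulr0.
Qed.

Lemma tp_supp : nc_supp tp_mo = p.
Proof.
rewrite /nc_supp /= ran_gr.
have -> : range (spec_op (cst t) (cst 0) w) = range p.
  have [[lp _] _ _] := hp.
  have tC : t%:C != 0 :> R[i] by rewrite eq_complex /= negb_and gt_eqF.
  rewrite tp_opE; apply/seteqP; split=> _ [u _ <-].
    by exists (t%:C *: u) => //; rewrite (linear_opZ _ _ lp).
  by exists (t%:C^-1 *: u) => //; rewrite (linear_opZ _ _ lp) scalerA mulfV// scale1r.
exact: (etrans (congr1 (@proj_onto R H) (closure_range_projection hp)) (proj_onto_range hp)).
Qed.

Lemma tp_trace_supp : trace (nc_supp tp_mo) = 2^-1.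
Proof.
rewrite tp_supp /trace [nc_tau _](tau_spec_op i1 i0 hw) /= addr0 mul1r Rintegral_cst//.
by rewrite [X in fine X](mu1 : _ = _) mulr1.
Qed.

Lemma tp_distr A : measurable A ->
  nc_distr tp_mo A = ((2^-1)%:E * (\d_t A + \d_(0%R : R) A))%E.
Proof.
move=> mA; rewrite nc_distr_spec_mo//; congr (_ * (_ + _))%E.
  rewrite preimage_cst diracE; case: ifPn => _; first exact: mu1.
  exact: measure0.
rewrite preimage_cst diracE; case: ifPn => _; first exact: mu1.
exact: measure0.
Qed.

(** The generated algebra is the least one to which the operator is affiliated, so it lies in the
    algebra of all a p + b (1 - p). Trace 0 forces b = - a, and a (2 p - 1) = a w sg. *)
Lemma tp_generated y : generated_algebra (@nc_alg R M) tp_mo y ->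
  tau y = 0 -> exists a : R[i], y = fun u => a *: Op (fun=> 0) w u.
Proof.
move=> Gy ty.
have tpM a b : alg (two_point_op (H := H) p a b).
  have [bp0 _ _] := hp; have bp := two_point_linear a b bp0.
  split => // S cS.
  have [_ cp] : alg p by exact: spec_op_in.
  have [lS _] := invariant_mult_bounded sg_mu cS.
  apply/funext => u /=; rewrite /two_point_op.
  have pS : p (S u) = S (p u) by exact: (congr1 (fun A : H -> H => A u) (cp _ cS)).
  by rewrite pS lS (linear_opZ _ _ lS) (linear_opB _ _ lS).
have [|||a [b yE]] := Gy [set T | exists a b, T = two_point_op (H := H) p a b].
- exact: von_neumann_two_point.
- by move=> _ [a [b ->]]; exact: tpM.
- apply: affiliated_gr; exists t%:C, 0; rewrite tp_opE.
  by apply/funext => u; rewrite /two_point_op scale0r addr0.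
have [bw _ _] := hw; have b0 : cbounded (fun _ : T => 0 : R[i]) by exact: cbounded_cst.
have hpE u : p u = 2^-1 *: u + 2^-1 *: (Op (fun=> 0) w u : H).
  apply: L2_ext.
  have h1 := rep_Op sg_mu u (spec_coef1 i1 i0) (spec_coef2 i1 i0 hw).
  have h2 := repD (2^-1 *: u) (2^-1 *: Op (fun=> 0) w u).
  have h3 := repZ 2^-1 u; have h4 := repZ 2^-1 (Op (fun=> 0) w u).
  have h5 := rep_Op sg_mu u b0 bw.
  apply: filterS3 (filterI h1 h2) (filterI h3 h4) h5 => x [/= -> ->] [-> ->] ->.
  by rewrite addr0 subr0 mul1r fmorphV rmorph_nat; ring.
have E u : y u = (a + b) / 2 *: u + (a - b) / 2 *: (Op (fun=> 0) w u : H).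
  rewrite yE /two_point_op hpE; exact: (@half_combination R H).
have tid : tau id = 1 by exact: (tau1 (nc_trace M)).
have tw : tau (Op (fun=> 0) w) = 0.
  by rewrite (crossed_tau_Op sgK sg_mu mP hP b0 bw) Cint_cst.
have ab : a + b = 0.
  move: ty; rewrite (_ : y = fun u => (a + b) / 2 *: id u + (a - b) / 2 *: (Op (fun=> 0) w u : H)).
    rewrite tau_comb tid tw mulr0 addr0 mulr1.
    by move/eqP; rewrite mulf_eq0 invr_eq0 pnatr_eq0 orbF => /eqP.
  by apply/funext => u; exact: E.
exists a; apply/funext => u; rewrite E ab mul0r scale0r add0r.
have -> : b = - a by apply/eqP; rewrite -addr_eq0 addrC ab.
by congr (_ *: _); field.
Qed.

End TwoPoint.

End FreePair.

(** * Orlicz functions *)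

Section Orlicz.
Context {R : realType}.
Variable Phi : R -> R.
Hypothesis hPhi : orlicz_function Phi.

Lemma orlicz_ge0 t : 0 <= Phi t.
Proof. by case: hPhi. Qed.

Lemma orlicz_contract (c t : R) : 0 <= c <= 1 -> Phi (c * t) <= c * Phi t.
Proof.
move=> /andP[c0 c1]; have [_ _ cv P0] := hPhi.
have cI : Itv.spec (Itv.num_sem (R := R)) (Itv.Real `[0%Z, 1%Z]) c.
  by rewrite /= /Itv.num_sem in_itv /= c0 c1 num_real.
have h : Phi (c * t + (1 - c) * 0) <= c * Phi t + (1 - c) * Phi 0.
  exact: (cv (@Itv.mk _ _ _ c cI) t 0 (mem_set I) (mem_set I)).
by rewrite P0 !mulr0 !addr0 in h.
Qed.

Lemma orlicz_le s t : 0 <= s <= t -> Phi s <= Phi t.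
Proof.
move=> /andP[s0 st]; have [t0|t0] := eqVneq t 0.
  by rewrite (_ : s = t)//; lra.
have tp : 0 < t by rewrite lt_neqAle eq_sym t0 (le_trans s0).
have c01 : 0 <= s / t <= 1 
  by apply/andP; split; [rewrite divr_ge0// ltW|rewrite ler_pdivrMr// mul1r].
have := orlicz_contract t c01; rewrite divfK// => /le_trans; apply.
by case/andP: c01 => _ c1; rewrite ler_piMl ?orlicz_ge0.
Qed.

Lemma orlicz_normr t : Phi `|t| = Phi t.
Proof.
have [_ ev _ _] := hPhi; have [t0|t0] := leP 0 t; first by rewrite ger0_norm.
by rewrite ltr0_norm.
Qed.

Lemma measurable_orlicz : measurable_fun setT Phi.
Proof.
(* Phi is monotone only on the half-line; precomposing with the maximum with 0 gives a function that
   is nondecreasing everywhere. *)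
rewrite (_ : Phi = (fun y => Phi (maxr 0 y)) \o normr); last first.
  by apply/funext => t /=; rewrite max_r// orlicz_normr.
apply: measurableT_comp; last exact: normr_measurable.
apply: nondecreasing_measurable => // a b ab; apply: orlicz_le.
rewrite le_max lexx /= ge_max !le_max lexx /=.
by rewrite ab orbT.
Qed.

Lemma lebesgue_measure_I01 : lebesgue_measure (I01 : set R) = 1%E.
Proof. by rewrite /I01 lebesgue_measure_itv /= lte_fin ltr01 EFinN sube0. Qed.

Lemma bounded_in_LPhi (g : R -> R) K : measurable_fun I01 g ->
  (forall t, I01 t -> `|g t| <= K) -> in_LPhi Phi g.
Proof.
move=> mg gK; split => //; set Q := Phi 1.
have Q0 : 0 <= Q by exact: orlicz_ge0.
have K0 : 0 <= K.
  apply: le_trans (gK 2^-1 _) => //; rewrite /I01 /= in_itv /=; apply/andP; split; lra.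
(* With this l, |g / l| <= 1 / (Q + 1), and convexity bounds Phi there by Q / (Q + 1) <= 1. *)
pose l := (K + 1) * (Q + 1).
have l0 : 0 < l by rewrite mulr_gt0 ?ltr_pwDr.
apply: (@le_lt_trans _ _ l%:E); last exact: ltry.
apply: ereal_inf_lbound; exists l => //; split => //.
rewrite -lebesgue_measure_I01 -[leRHS]mul1e -integral_cst; last exact: measurable_itv.
apply: ge0_le_integral => //; first exact: measurable_itv.
- by move=> x _; rewrite lee_fin orlicz_ge0.
- apply/measurable_EFinP; apply: (measurableT_comp measurable_orlicz).
  exact: measurable_funM.
- move=> x /gK gx; rewrite lee_fin -orlicz_normr.
  have e01 : 0 <= (Q + 1)^-1 <= 1 by rewrite invr_ge0 addr_ge0//= invf_le1 ?ltr_pwDr// lerDr.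
  apply: le_trans (_ : Phi ((Q + 1)^-1 * 1) <= _).
    apply: orlicz_le; rewrite normr_ge0 mulr1 /= normrM normfV (gtr0_norm l0) ler_pdivrMr//.
    by rewrite /l mulrC -mulrA divff ?mulr1 ?gt_eqF ?ltr_pwDr// (le_trans gx)// lerDl.
  apply: le_trans (orlicz_contract _ e01) _.
  by rewrite mulrC ler_pdivrMr ?ltr_pwDr// mul1r lerDl.
Qed.

End Orlicz.

(** * Freeness of the pair of projections *)

Section FreeSum.
Context {d : measure_display} {T : measurableType d} {R : realType}.
Variable mu : {finite_measure set T -> \bar R}.
Variable sg : {mfun T >-> T}.
Hypothesis sgK : involutive sg.
Hypothesis sg_mu : forall A, measurable A -> mu (sg @^-1` A) = mu A.
Variable P : set T.
Hypothesis mP : measurable P.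
Hypothesis hP : {ae mu, forall x, (x \in P) = ~~ (sg x \in P)}.
Hypothesis mu1 : mu setT = 1%E.
Variable v : T -> R[i].
Hypothesis hv : twist sg v.
Hypothesis v_moment : forall n, (0 < n)%N -> Cint mu (fun x => v x ^+ n.*2) = 0.
Variable t : R.
Hypothesis t0 : 0 < t.

Local Notation H := (L2hilbert mu).
Local Notation Op := (@Op _ _ _ mu sg).
Local Notation spec_op := (@spec_op _ _ _ mu sg).
Local Notation M := (crossed_space sgK sg_mu mP hP mu1).
Local Notation alg := (@crossed_alg _ _ _ mu sg).
Local Notation tau := (@crossed_tau _ _ _ mu sg P).

Lemma twist_invol (w : T -> R[i]) : twist sg w -> twist sg (fun x => w (sg x)).
Proof.
move=> [bw ww cw]; split; first exact: cbounded_invol.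
- by move=> x; rewrite sgK mulrC ww.
- by move=> x; rewrite sgK -cw conjCK.
Qed.

Lemma cbounded_exp (w : T -> R[i]) n : cbounded w -> cbounded (fun x => w x ^+ n).
Proof.
move=> bw; elim: n => [|n IH]; first exact: cbounded_cst.
under eq_fun do rewrite exprS; exact: cboundedM.
Qed.

(* The unitaries [v sg] and [conj v sg] are symmetries of trace 0 and the powers of
   their product [v ^ 2] have trace 0 too: this is why they are free. *)
Definition letter (k : 'I_2) : T -> R[i] := if k == ord0 then v else fun x => v (sg x).

Lemma letter_twist k : twist sg (letter k).
Proof. by rewrite /letter; case: ifP => _ //; exact: twist_invol. Qed.

(** The reflection exchanges the two letters, so pushing sg past the next letter of an alternating
    word turns it into the current one. *)
Lemma letter_neq k l : k != l -> forall x, letter l (sg x) = letter k x.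
Proof.
rewrite /letter => kl x; have [k0|k0] := eqVneq k ord0; have [l0|l0] := eqVneq l ord0.
- by rewrite k0 l0 eqxx in kl.
- by rewrite sgK.
- by [].
- case/negP: kl; apply/eqP/val_inj.
  by case: k l k0 l0 => [[|[|//]] ?] [[|[|//]] ?].
Qed.

(** The alternating product of n symmetries starting with w sg: with all sg moved to the right, it
    is w^n sg^n, where sg^n depends only on the parity of n. *)
Definition word (w : T -> R[i]) n : H -> H :=
  if odd n then Op (fun=> 0) (fun x => w x ^+ n) else Op (fun x => w x ^+ n) (fun=> 0).

(** The relation between w and w' is asked for nonempty words only, since w' does not occur in the
    empty one. *)
Lemma word_recl w w' n u : cbounded w -> cbounded w' ->
  ((0 < n)%N -> forall x, w' (sg x) = w x) ->
  Op (fun=> 0) w (word w' n u) = word w n.+1 u.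
Proof.
move=> bw bw' ww'.
have b0 : cbounded (fun _ : T => 0 : R[i]) by exact: cbounded_cst.
have bn : cbounded (fun x => w' x ^+ n) by exact: cbounded_exp.
have E x : w x * w' (sg x) ^+ n = w x ^+ n.+1.
  rewrite exprS; case: n ww' {bn} => [|n] ww'; first by rewrite !expr0.
  by rewrite ww'.
rewrite /word /=; case: (odd n) => /=.
  rewrite -[LHS]/((Op (fun=> 0) w \o Op (fun=> 0) (fun x => w' x ^+ n)) u).
  rewrite (Op_comp sgK sg_mu b0 bw b0 bn); congr (Op _ _ u); apply/funext => x.
    by rewrite mul0r add0r E.
  by rewrite mul0r mulr0 add0r.
rewrite -[LHS]/((Op (fun=> 0) w \o Op (fun x => w' x ^+ n) (fun=> 0)) u).
rewrite (Op_comp sgK sg_mu b0 bw bn b0); congr (Op _ _ u); apply/funext => x.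
  by rewrite mul0r mulr0 add0r.
by rewrite mul0r add0r E.
Qed.

Lemma alternating_word n : forall (i : nat -> 'I_2) (y : nat -> H -> H),
  (forall j, (j.+1 < n)%N -> i j != i j.+1) ->
  (forall j, (j < n)%N -> exists a : R[i], y j = fun u => a *: Op (fun=> 0) (letter (i j)) u) ->
  exists a : R[i], \big[(fun S T => S \o T)/id]_(j < n) y j =
    fun u => a *: word (letter (i 0%N)) n u.
Proof.
elim: n => [|n IH] i y hi hy.
  exists 1; rewrite big_ord0; apply/funext => u; rewrite scale1r /word /=.
  rewrite -[LHS]/(id u) -(Op_id (sg := sg) sg_mu); congr (Op _ _ u).
have [j jn|j jn|b E] := IH (fun j => i j.+1) (fun j => y j.+1).
- by apply: hi.
- by apply: hy.
have [//|a ya] := hy 0%N; exists (a * b); rewrite big_ord_recl E ya.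
have [bw _ _] := letter_twist (i 0%N); have [bw' _ _] := letter_twist (i 1%N).
have b0 : cbounded (fun _ : T => 0 : R[i]) by exact: cbounded_cst.
apply/funext => u /=; rewrite -(word_recl u bw bw'); last first.
  by move=> n0; apply: letter_neq; apply: hi.
by rewrite (linear_opZ _ _ (Op_linear sg_mu b0 bw)) scalerA.
Qed.

(** An odd word has diagonal coefficient 0. An even word is a power of v^2, or of its composition
    with sg, and these have integral 0 by [v_moment]. *)
Lemma tau_word k n : (0 < n)%N -> tau (word (letter k) n) = 0.
Proof.
move=> n0; have [bw _ _] := letter_twist k.
have b0 : cbounded (fun _ : T => 0 : R[i]) by exact: cbounded_cst.
have bn : cbounded (fun x => letter k x ^+ n) by exact: cbounded_exp.
rewrite /word; case: ifP => on.
  by rewrite (crossed_tau_Op sgK sg_mu mP hP b0 bn) Cint_cst.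
rewrite (crossed_tau_Op sgK sg_mu mP hP bn b0).
have nE : n = n./2.*2 by rewrite -[LHS]odd_double_half on.
have h0 : (0 < n./2)%N by rewrite -double_gt0 -nE.
have V := v_moment h0; rewrite -nE in V.
rewrite /letter; case: ifP => _ //; rewrite -{}V.
have [bv _ _] := hv.
by rewrite (Cint_invol sg_mu (L1fun_cbounded mu (cbounded_exp n bv))).
Qed.

Definition free_pair (k : 'I_2) : measurableOperator M :=
  tp_mo sgK sg_mu mP hP mu1 (letter_twist k) t0.

Lemma free_pair_free : freely_independent free_pair.
Proof.
move=> m i y hi hy.
have [|j /hy [Gy ty]|a E] := @alternating_word m.+1 i y.
- by move=> j; apply: hi.
- exact: (tp_generated Gy ty).
rewrite -[LHS]/(tau (\big[(fun S T => S \o T)/id]_(j < m.+1) y j)) E.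
rewrite (_ : (fun u => _) = (fun u => a *: word (letter (i 0%N)) m.+1 u +
    (0 : R[i]) *: word (letter (i 0%N)) m.+1 u)); last first.
  by apply/funext => u; rewrite scale0r addr0.
by rewrite tau_comb tau_word// mulr0 mul0r addr0.
Qed.

Lemma mfun_Re : measurable_fun setT (fun x => complex.Re (v x)).
Proof. by have [[[]]] := hv. Qed.

Definition sum_coef (e : R) (x : T) := t * (1 + e * complex.Re (v x)).

Lemma measurable_sum_coef e : measurable_fun setT (sum_coef e).
Proof.
apply: measurable_funM => //; apply: measurable_funD => //.
by apply: measurable_funM => //; exact: mfun_Re.
Qed.

Definition sum_mfun e : {mfun T >-> R} :=
  HB.pack (sum_coef e) (isMeasurableFun.Build _ _ _ _ _ (measurable_sum_coef e)).

End FreeSum.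

(** * The free sum and its distribution *)

Section FreeEstimate.
Context {d : measure_display} {T : measurableType d} {R : realType}.
Variable mu : {finite_measure set T -> \bar R}.
Variable sg : {mfun T >-> T}.
Hypothesis sgK : involutive sg.
Hypothesis sg_mu : forall A, measurable A -> mu (sg @^-1` A) = mu A.
Variable P : set T.
Hypothesis mP : measurable P.
Hypothesis hP : {ae mu, forall x, (x \in P) = ~~ (sg x \in P)}.
Hypothesis mu1 : mu setT = 1%E.
Variable v : T -> R[i].
Hypothesis hv : twist sg v.
Hypothesis v_moment : forall n, (0 < n)%N -> Cint mu (fun x => v x ^+ n.*2) = 0.
Variable t : R.
Hypothesis t0 : 0 < t.

Local Notation H := (L2hilbert mu).
Local Notation Op := (@Op _ _ _ mu sg).
Local Notation spec_op := (@spec_op _ _ _ mu sg).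
Local Notation M := (crossed_space sgK sg_mu mP hP mu1).
Local Notation tp := (free_pair sgK sg_mu mP hP mu1 hv t0).

Lemma Re_twist_le1 x : `|complex.Re (v x)| <= 1.
Proof.
have [_ ww cw] := hv.
have E : sqn (v x) = 1.
  apply: (@complexI R); rewrite sqnE cw ww//.
rewrite -(@ler_pXn2r _ 2) ?nnegrE// expr1n real_normK ?num_real// -E /sqn.
by rewrite lerDl sqr_ge0.
Qed.

Lemma Re_twist_invol x : complex.Re (v (sg x)) = complex.Re (v x).
Proof. by have [_ _ cw] := hv; rewrite -cw; case: (v x). Qed.

Lemma sum_coef_bounds e x : `|e| <= 1 -> 0 <= sum_coef v t e x <= t * 2.
Proof.
move=> e1; have h : `|e * complex.Re (v x)| <= 1.
  by rewrite normrM mulr_ile1// Re_twist_le1.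
move: h; rewrite ler_norml => /andP[h1 h2].
rewrite /sum_coef; apply/andP; split.
  by apply: mulr_ge0; [exact: ltW|lra].
by rewrite ler_pM2l//; lra.
Qed.

Lemma inv_fun_sum e : `|e| <= 1 -> inv_fun sg (sum_mfun hv t e).
Proof.
move=> e1; split; first exact: measurable_sum_coef hv t e.
- exists (t * 2) => x; have /andP[a b] := sum_coef_bounds x e1.
  by rewrite ger0_norm.
- by move=> x; rewrite /sum_mfun /= /sum_coef Re_twist_invol.
Qed.

(** The constant twist belongs to the projection (1 + sg) / 2, which diagonalises the sum: v sg + (v
    o sg) sg = 2 Re(v) sg, with Re(v) even. *)
Lemma twist1 : twist sg (fun=> 1 : R[i]).
Proof.
split; first exact: cbounded_cst.
- by move=> x; rewrite mulr1.
- by move=> x; rewrite conjC1.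
Qed.

Let n1 : `|1 : R| <= 1. Proof. by rewrite normr1. Qed.
Let nN1 : `|-1 : R| <= 1. Proof. by rewrite normrN1. Qed.
Let ge0 e (e1 : `|e| <= 1) x : 0 <= sum_mfun hv t e x.
Proof. by have /andP[] := sum_coef_bounds x e1. Qed.

Definition free_sum : measurableOperator M :=
  spec_mo sgK sg_mu mP hP mu1 (inv_fun_sum n1) (inv_fun_sum nN1) twist1 (ge0 n1) (ge0 nN1).

Lemma free_sum_graph :
  mo_graph free_sum = strong_sum (fun k => mo_graph (tp k)).
Proof.
have c0 := inv_fun_cst sg (0 : R); have ct := inv_fun_cst sg t.
have hv' := twist_invol sgK hv.
have b1 := spec_op_bounded sg_mu ct c0 hv.
have b2 := spec_op_bounded sg_mu ct c0 hv'.
rewrite /strong_sum !big_ord_recl big_ord0 /=.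
(* The empty sum [op_zero] is the graph of the zero map by conversion, so every closure taken is
   that of a bounded graph. *)
transitivity (strong_add (gr (spec_op (cst t) (cst 0) v : H -> H))
   (strong_add (gr (spec_op (cst t) (cst 0) (fun x => v (sg x)) : H -> H)) (gr (fun=> 0 : H)))); last by [].
rewrite strong_add_gr//; last first.
  by rewrite -(Op_zero (sg := sg) sg_mu); apply: Op_bounded => //; exact: cbounded_cst.
rewrite strong_add_gr//; last first.
  by rewrite (_ : (fun _ => _) = spec_op (cst t) (cst 0) (fun x => v (sg x)))//;
    apply/funext => u; rewrite addr0.
have E : spec_op (sum_mfun hv t 1) (sum_mfun hv t (-1)) (fun=> 1) = (fun u =>
    spec_op (cst t) (cst 0) v u + (spec_op (cst t) (cst 0) (fun x => v (sg x)) u + 0)) :> (H -> H).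
  apply/funext => u; rewrite addr0.
  rewrite -[X in _ = X + _]scale1r -(Op_lin sg_mu);
    try exact: (spec_coef1 ct c0); try exact: (spec_coef2 ct c0).
  rewrite /spec_op; congr (Op _ _ u); apply/funext => x.
    by rewrite mul1r -rmorphD; congr _%:C; rewrite /sum_mfun /= /sum_coef /cst; field.
  have [_ _ cw] := hv; rewrite mul1r -mulrDr -cw /sum_mfun /= /sum_coef /cst mulr1.
  by case: (v x) => a b; apply: complex_ext; rewrite /=; field.
exact: (congr1 (@gr R H) E).
Qed.

Lemma free_pair_singular k u : I01 u ->
  singular_value (tp k) u = if u < 2^-1 then t else 0.
Proof.
rewrite /I01 /= in_itv /= => /andP[u0 u1].
have E (s : R) : 0 < s -> trace (mo_spec (tp k) `]s, +oo[) = if s < t then 2^-1 else 0.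
  move=> s0; apply/EFin_inj.
  have := tp_distr sgK sg_mu mP hP mu1 (letter_twist sgK hv k) t0 (A := `]s, +oo[) (measurable_itv _).
  rewrite /nc_distr => ->; rewrite !diracE !mem_setE !in_itv /= !andbT.
  rewrite (ltNge s 0) (ltW s0) /= adde0.
  by case: ltP => _; rewrite ?mule1 ?mule0.
rewrite /singular_value; case: ltP => hu.
  rewrite (_ : [set s | _] = `[t, +oo[%classic) ?inf_itv// -?set_itvE //.
  apply/seteqP; split=> s /=; rewrite in_itv /= andbT.
    by move=> [s0]; rewrite E//; case: ltP => // _; lra.
  by move=> ts; have s0 := lt_le_trans t0 ts; split => //; rewrite E// ltNge ts /= ltW.
rewrite (_ : [set s | _] = `]0, +oo[%classic) ?inf_itv//.
apply/seteqP; split=> s /=; rewrite in_itv /= andbT; first by case.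
by move=> s0; split => //; rewrite E//; case: ifP => // _; exact: ltW.
Qed.

Lemma free_pair_LPhi Phi k : orlicz_function Phi -> in_nc_LPhi Phi (tp k).
Proof.
move=> hPhi; rewrite /in_nc_LPhi; apply: (bounded_in_LPhi hPhi (K := t)); last first.
  move=> u hu; rewrite free_pair_singular//; case: ifP => _; first by rewrite gtr0_norm.
  by rewrite normr0 ltW.
have h : measurable_fun I01 (fun u : R => if u < 2^-1 then t else 0 : R).
  apply: measurable_funTS; apply: measurable_fun_ifT => //.
  by apply: measurable_fun_ltr.
apply: eq_measurable_fun h => u; rewrite inE => hu.
by rewrite free_pair_singular.
Qed.

(** Each of the two distributions is half of the sum of the Dirac masses at t and 0, and Phi
    vanishes at 0. *)
Lemma free_pair_oplus Phi : orlicz_function Phi ->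
  tau_Phi_oplus Phi tp = (Phi t)%:E.
Proof.
move=> hPhi; have [P0 _ _ Phi0] := hPhi.
have mPhi : measurable_fun setT (EFin \o Phi).
  by apply/measurable_EFinP; exact: measurable_orlicz hPhi.
rewrite /tau_Phi_oplus.
rewrite (@eq_setfun_integral _ _ _ _ (measure_add \d_t \d_(0%R : R)) (EFin \o Phi)).
  rewrite ge0_integral_measure_add//.
    rewrite !integral_dirac// !diracT !mul1e /= Phi0.
    by rewrite adde0.
  by move=> x _; rewrite lee_fin.
have E (a b : R) : ((2^-1)%:E * (a%:E + b%:E) + (2^-1)%:E * (a%:E + b%:E) = a%:E + b%:E)%E.
  by rewrite -!EFinD; congr _%:E; lra.
have sum2 (F : 'I_2 -> \bar R) a : (forall k, F k = a) -> (\sum_(k < 2) F k = a + a)%E.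
  by move=> Fa; rewrite !big_ord_recl big_ord0 adde0 !Fa.
move=> A mA; rewrite [RHS](measure_addE _ _ A).
apply: etrans (sum2 _ _ (fun k => tp_distr sgK sg_mu mP hP mu1 (letter_twist sgK hv k) t0 mA)) _.
by rewrite !diracE; exact: E.
Qed.

(** Markov's inequality for the branch t (1 + Re v), which carries half of the trace; the other
    branch is bounded below by 0. *)
Lemma le_tau_Phi_free_sum Phi c : orlicz_function Phi -> 0 <= c ->
  ((Phi c)%:E * ((2^-1)%:E * mu [set x | (c <= sum_coef v t 1 x)%R]) <=
   tau_Phi Phi free_sum)%E.
Proof.
move=> hPhi c0; have [P0 _ _ _] := hPhi.
have mPhi : measurable_fun setT (EFin \o Phi).
  by apply/measurable_EFinP; exact: measurable_orlicz hPhi.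
have mh : measurable_fun setT (fun _ : T => 2^-1 : R) by [].
have h0 : T -> 0 <= 2^-1 :> R by move=> _; rewrite invr_ge0.
(* [tau_Phi] integrates against a bare set function; this genuine measure agrees with it on Borel
   sets. *)
pose nu : {measure set R -> \bar R} := measure_add
  (weighted_measure mu (sum_mfun hv t 1) mh h0) (weighted_measure mu (sum_mfun hv t (-1)) mh h0).
have nuE A : measurable A -> nu A = ((2^-1)%:E *
    (mu (sum_mfun hv t 1 @^-1` A) + mu (sum_mfun hv t (-1) @^-1` A)))%E.
  move=> mA; have ms e : measurable (sum_mfun hv t e @^-1` A).
    by rewrite -[X in measurable X]setTI; exact: measurable_funPT.
  rewrite [LHS]measure_addE ge0_muleDr//.
  by congr (_ + _)%E; rewrite [LHS]integral_cst//; exact: ms.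
rewrite /tau_Phi (@eq_setfun_integral _ _ _ _ nu (EFin \o Phi)); last first.
  move=> A mA; rewrite nuE//; exact: nc_distr_spec_mo mA.
apply: (@le_trans _ _ (\int[nu]_(l in `[c, +oo[) (Phi c)%:E)%E).
  rewrite integral_cst//; apply: lee_pmul => //.
  - by rewrite lee_fin.
  - by rewrite mule_ge0// lee_fin.
  - rewrite nuE//; apply: lee_pmul => //; do ?by rewrite lee_fin invr_ge0.
    rewrite (_ : _ @^-1` _ = [set x | (c <= sum_coef v t 1 x)%R]).
      by rewrite leeDl.
    by apply/seteqP; split=> x /=; rewrite in_itv /= andbT.
apply: (@le_trans _ _ (\int[nu]_(l in `[c, +oo[) (EFin \o Phi) l)%E).
  apply: ge0_le_integral => //.
  - by move=> x _; rewrite lee_fin.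
  - exact: measurable_funTS.
  - move=> x /=; rewrite in_itv /= andbT => cx.
    by rewrite lee_fin orlicz_le// c0.
by apply: ge0_subset_integral => // x _; rewrite lee_fin.
Qed.

Lemma free_estimate_pair Phi C c : orlicz_function Phi -> free_estimate Phi C -> 0 <= c ->
  ((Phi c)%:E * ((2^-1)%:E * mu [set x | (c <= sum_coef v t 1 x)%R]) <=
   C%:E * (Phi t)%:E)%E.
Proof.
move=> hPhi hC c0; apply: le_trans (le_tau_Phi_free_sum hPhi c0) _.
rewrite -(free_pair_oplus hPhi); apply: hC => //.
- by move=> k; exact: spec_mo_rv.
- by move=> k; exact: free_pair_LPhi.
- exact: free_pair_free.
- rewrite !big_ord_recl big_ord0 !tp_trace_supp; lra.
- exact: free_sum_graph.
Qed.

End FreeEstimate.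

(** * The circle *)

Section Uniform.
Context {R : realType}.

Lemma Npi_lt_pi : - pi < pi :> R.
Proof. by have := @pi_gt0 R; lra. Qed.

Let X := measurableTypeR R.

Definition circle_measure : {finite_measure set X -> \bar R} := uniform_prob Npi_lt_pi.

Local Notation mu := circle_measure.

Lemma circle_measure1 : mu setT = 1%E.
Proof. exact: (@probability_setT _ _ _ (uniform_prob Npi_lt_pi)). Qed.

Definition flip : {mfun X >-> X} :=
  HB.pack (-%R : X -> X) (isMeasurableFun.Build _ _ X X _ (@oppr_measurable R setT)).

Lemma flipK : involutive flip.
Proof. exact: opprK. Qed.

Lemma flip_measure A : measurable A -> mu (flip @^-1` A) = mu A.
Proof.
move=> mA.
have mpdf : measurable_fun setT (EFin \o uniform_pdf (- pi) (pi : R)).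
  by apply/measurable_EFinP; exact: measurable_uniform_pdf.
have pdf0 x : (0 <= (EFin \o uniform_pdf (- pi) (pi : R)) x)%E.
  by rewrite lee_fin uniform_pdf_ge0 ?Npi_lt_pi.
rewrite -[LHS]/(\int[lebesgue_measure]_(x in -%R @^-1` A) (uniform_pdf (- pi) pi x)%:E)%E.
rewrite -[RHS]/(\int[lebesgue_measure]_(x in A) (uniform_pdf (- pi) pi x)%:E)%E.
transitivity (\int[lebesgue_measure]_(x in (-%R : R -> X) @^-1` A)
    ((EFin \o uniform_pdf (- pi) pi) \o -%R) x)%E.
  apply: eq_integral => x _ /=; rewrite /uniform_pdf.
  by congr (if _ then _ else _)%:E; rewrite lerN2 [X in _ = _ && X]lerNl andbC.
have mN : measurable_fun setT (-%R : X -> X) by exact: oppr_measurable.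
apply: etrans (esym (ge0_integral_pushforward mN lebesgue_measure mA (measurable_funTS mpdf)
  (fun x _ => pdf0 x))) _.
by apply: eq_measure_integral => B mB _; exact: lebesgue_measureN.
Qed.

(** The fundamental domain is a half-line because the underlying space is all of R; the only
    exception is the fixed point 0. *)
Lemma flip_half : {ae mu, forall x, (x \in (`]0%R, +oo[%classic : set X)) =
  ~~ (flip x \in (`]0%R, +oo[%classic : set X))}.
Proof.
exists [set (0%R : R)]; split; first exact: measurable_set1.
  rewrite -[LHS]/(\int[lebesgue_measure]_(x in [set (0%R : R)]) (uniform_pdf (- pi) pi x)%:E)%E.
  by rewrite integral_set1.
move=> x /= h; apply: contrapT => /eqP x0; apply: h.
rewrite !mem_setE !in_itv /= !andbT oppr_gt0 -leNgt le_eqVlt.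
by rewrite eq_sym (negbTE x0).
Qed.

Definition half_angle (x : X) : R[i] := (cos (x / 2) +i* sin (x / 2))%C.

Lemma half_angleX n x : half_angle x ^+ n = (cos (n%:R * x / 2) +i* sin (n%:R * x / 2))%C.
Proof.
elim: n => [|n IH]; first by rewrite expr0 !mul0r cos0 sin0.
have E : n.+1%:R * x / 2 = x / 2 + n%:R * x / 2 :> R by rewrite -natr1; field.
by rewrite exprS IH E cosD sinD; apply: complex_ext => /=; ring.
Qed.

Lemma half_angle_twist : twist flip half_angle.
Proof.
have mc (f : R -> R) : continuous f -> measurable_fun setT (fun x : X => f (x / 2)).
  move=> /continuous_measurable_fun mf; apply: (measurableT_comp mf).
  exact: measurable_funM.
split.
- split; first by split; apply: mc; [exact: continuous_cos|exact: continuous_sin].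
  by exists 1 => x; rewrite /sqn /= cos2Dsin2.
- move=> x; rewrite /half_angle /= mulNr cosN sinN; apply: complex_ext => /=.
    by rewrite mulrN opprK -!expr2 cos2Dsin2.
  by ring.
- by move=> x; rewrite /half_angle /= mulNr cosN sinN.
Qed.

(** The mean of a derivative over the circle vanishes when the primitive F takes equal values at
    both ends. *)
Lemma circle_mean0 (h F : R -> R) : (forall x, -1 <= h x <= 1) -> continuous h ->
  (forall x, is_derive x (1 : R) F (h x)) -> F (- pi) = F pi ->
  \int[mu]_x h x = 0.
Proof.
move=> hb ch dF FE.
have mh : measurable_fun setT h by exact: continuous_measurable_fun.
have ih : mu.-integrable setT (EFin \o h).
  apply: (@le_integrable _ _ _ mu _ _ _ (EFin \o cst 1)) => //.
  - by apply/measurable_EFinP.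
  - by move=> x _ /=; rewrite lee_fin normr1 ler_norml hb.
  - exact: finite_measure_integrable_cst.
have i1 : mu.-integrable setT (EFin \o cst (1 : R)).
  exact: finite_measure_integrable_cst.
have dG x : is_derive x (1 : R) (fun x : R => x + F x) (1 + h x).
  by apply: is_deriveD.
have cG : continuous (fun x : R => x + F x).
  by move=> x; apply/differentiable_continuous/derivable1_diffP; have [] := dG x.
(* Adding 1 makes the integrand nonnegative, as [integral_uniform] demands; the primitive becomes x
   + F x. *)
have E : (\int[mu]_x (1 + h x)%:E = 1)%E.
  rewrite integral_uniform//.
  - rewrite (@continuous_FTC2 _ _ (fun x => x + F x)) ?Npi_lt_pi//.
    + rewrite FE -EFinB -EFinM; congr _%:E; have := @pi_gt0 R => p0.
      by field; lra.
    + by apply: continuous_subspaceT => x; apply: cvgD; [exact: cvg_cst|exact: ch].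
    + split; first by move=> x _; have [] := dG x.
      * by apply: cvg_at_right_filter; exact: cG.
      * by apply: cvg_at_left_filter; exact: cG.
    + by move=> x _; rewrite derive1E; exact: derive_val.
  - by apply/measurable_EFinP; exact: measurable_funD.
  - by move=> x; rewrite lee_fin; have /andP[] := hb x; lra.
have /(congr1 fine) := E.
rewrite -/(Rintegral mu setT (fun x => 1 + h x)).
rewrite (RintegralD measurableT i1 ih) Rintegral_cst//.
rewrite [X in fine X]circle_measure1 /=; lra.
Qed.

Lemma is_derive_comp_scale (k : R) (G g : R -> R) : k != 0 ->
  (forall x, is_derive x (1 : R) G (g x)) ->
  forall x, is_derive x (1 : R) (fun y => k^-1 * G (k * y)) (g (k * x)).
Proof.
move=> k0 dG x.
have dk : is_derive x (1 : R) (fun y : R => k * y) k.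
  apply: (is_derive_eq (is_deriveM (is_derive_cst k x 1) (is_derive_id x 1))).
  by rewrite scaler0 addr0 /GRing.scale /= mulr1.
have dc : is_derive x (1 : R) (G \o (fun y : R => k * y)) (g (k * x) * k).
  exact: (@is_derive1_comp _ G (fun y : R => k * y) x _ _ (dG (k * x)) dk).
apply: (is_derive_eq (is_deriveZ k^-1 dc)).
by rewrite /GRing.scale /= mulrCA mulVf// mulr1.
Qed.

Lemma half_angle_moment n : (0 < n)%N -> Cint mu (fun x => half_angle x ^+ n.*2) = 0.
Proof.
move=> n0; have nR : n%:R != 0 :> R by rewrite pnatr_eq0 -lt0n.
have E x : half_angle x ^+ n.*2 = (cos (n%:R * x) +i* sin (n%:R * x))%C.
  by rewrite half_angleX -muln2 natrM; congr (cos _ +i* sin _)%C; field.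
have cM : continuous (fun x : R => n%:R * x) by exact: mulrl_continuous.
under eq_fun do rewrite E.
apply: complex_ext => /=.
  apply: (@circle_mean0 _ (fun x => n%:R^-1 * sin (n%:R * x))).
  - by move=> x; rewrite cos_geN1 cos_le1.
  - by move=> x; apply: continuous_comp; [exact: cM|exact: continuous_cos].
  - exact: is_derive_comp_scale nR (@is_derive_sin R).
  - have sn m : sin (m%:R * pi) = 0 :> R.
      elim: m => [|m IH]; first by rewrite mul0r sin0.
      by rewrite -natr1 mulrDl mul1r sinDpi IH oppr0.
    by rewrite mulrN sinN sn oppr0.
apply: (@circle_mean0 _ (fun x => n%:R^-1 * - cos (n%:R * x))).
- by move=> x; rewrite sin_geN1 sin_le1.
- by move=> x; apply: continuous_comp; [exact: cM|exact: continuous_sin].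
- apply: (is_derive_comp_scale (G := - cos) nR) => x.
  by apply: (is_derive_eq (is_deriveN (is_derive_cos x))); rewrite opprK.
- by rewrite [n%:R * - pi]mulrN cosN.
Qed.

Lemma circle_measure_cos_ge : ((4^-1)%:E <= mu [set x | (2^-1 <= cos (x / 2))%R])%E.
Proof.
have p0 := @pi_gt0 R.
(* The double angle formula at pi / 4 gives 2 c^2 = 1 with c >= 0. *)
have c4 : (2^-1 : R) <= cos (pi / 4).
  have c0 : 0 <= cos (pi / 4 : R) by apply: cos_ge0_pihalf; apply/andP; split; lra.
  have := cos_mulr2n (pi / 4 : R).
  rewrite (_ : pi / 4 *+ 2 = pi / 2); last by rewrite -mulr_natr; field.
  rewrite cos_pihalf; move: c0; set c := cos _; nra.
(* This interval is a quarter of (-pi, pi) and x / 2 stays below pi / 4 on it; a crude lower bound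
   is enough. *)
have sub : `[0, pi / 2] `<=` [set x : X | (2^-1 <= cos (x / 2))%R].
  move=> x /=; rewrite in_itv /= => /andP[x0 xp]; apply: le_trans c4 _.
  have [<-|ne] := eqVneq (x / 2) (pi / 4); first by [].
  apply/ltW; rewrite ltr_cos ?in_itv /=.
  - by rewrite lt_neqAle ne /=; lra.
  - by apply/andP; split; lra.
  - by apply/andP; split; lra.
have le4 : ((4^-1)%:E <= mu (`[0%R, (pi / 2)%R]%classic : set X))%E.
  rewrite -[X in (_ <= X)%E]/(\int[lebesgue_measure]_(x in `[0%R, (pi / 2)%R]) (uniform_pdf (- pi) pi x)%:E)%E.
  rewrite (eq_integral (fun=> ((pi - - pi)^-1)%:E)); last first.
    move=> x; rewrite inE /= in_itv /= => /andP[x0 xp]; rewrite /uniform_pdf.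
    by rewrite ifT//; apply/andP; split; lra.
  rewrite integral_cst//= lebesgue_measure_itv /= lte_fin divr_gt0// -EFinB -EFinM lee_fin.
  by rewrite le_eqVlt; apply/orP; left; apply/eqP; field; lra.
apply: (le_trans le4); apply: le_measure => //; rewrite ?inE//.
rewrite (_ : [set x | _] = (fun x : X => cos (x / 2)) @^-1` `[2^-1, +oo[).
  rewrite -[X in measurable X]setTI.
  have [[[mc _] _] _ _] := half_angle_twist; exact: mc.
by apply/seteqP; split=> x /=; rewrite in_itv /= andbT.
Qed.

Lemma free_estimate_step (Phi : R -> R) C t : orlicz_function Phi -> free_estimate Phi C ->
  0 < t -> Phi (3 / 2 * t) <= 8 * C * Phi t.
Proof.
move=> hPhi hC t0.
have c0 : 0 <= 3 / 2 * t by lra.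
have h := free_estimate_pair flipK flip_measure (measurable_itv _) flip_half circle_measure1
  half_angle_twist half_angle_moment t0 hPhi hC c0.
have [P0 _ _ _] := hPhi.
have : ((Phi (3 / 2 * t) * (2^-1 * 4^-1))%:E <= (C * Phi t)%:E)%E.
  rewrite [leRHS]EFinM; apply: le_trans h; rewrite EFinM EFinM.
  apply: lee_pmul => //; rewrite ?lee_fin//.
  apply: lee_pmul => //; rewrite ?lee_fin//.
  rewrite (_ : [set x | _] = [set x : X | (2^-1 <= cos (x / 2))%R]).
    exact: circle_measure_cos_ge.
  have E y : (3 / 2 * t <= t * (1 + 1 * y)) = (2^-1 <= y).
    by rewrite mul1r [3 / 2 * t]mulrC ler_pM2l//; apply/idP/idP; lra.
  by apply/seteqP; split=> x /=; rewrite /sum_coef /= E.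
rewrite lee_fin; lra.
Qed.

End Uniform.

(** * The classical case *)

Section ClassicalPair.
Context {R : realType}.
Implicit Types (S B : set R) (t x : R).

Let nb (b : bool) : R := b%:R.

(** All events of the classical example are constant on each quarter of (0, 1), so independence
    becomes a finite check on four booleans. *)
Lemma Pr_quarters S (b0 b1 b2 b3 : bool) :
  (forall x, 0 < x < 1 / 4 -> S x <-> b0) -> (forall x, 1 / 4 <= x < 1 / 2 -> S x <-> b1) ->
  (forall x, 1 / 2 <= x < 3 / 4 -> S x <-> b2) -> (forall x, 3 / 4 <= x < 1 -> S x <-> b3) ->
  Pr S = (4^-1 * (nb b0 + nb b1 + nb b2 + nb b3))%:E.
Proof.
move=> h0 h1 h2 h3.
pose Q (b : bool) (i : interval R) : set R := if b then [set` i] else set0.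
have mQ b i : measurable (Q b i) by rewrite /Q; case: b.
have QE b l a c : a < c -> c - a = 4^-1 ->
    lebesgue_measure (Q b (Interval (BSide l a) (BLeft c))) = (4^-1 * nb b)%:E.
  move=> ac cE; rewrite /Q /nb; case: b; last by rewrite measure0 mulr0.
  by rewrite lebesgue_measure_itv /= lte_fin ac -EFinB cE mulr1.
have -> : Pr S = lebesgue_measure (Q b0 `]0, (1 / 4)[ `|` (Q b1 `[1 / 4, 1 / 2[ `|`
    (Q b2 `[1 / 2, 3 / 4[ `|` Q b3 `[3 / 4, 1[))).
  congr lebesgue_measure; apply/seteqP; split => x.
    rewrite /I01 /= in_itv /= => -[Sx /andP[x0 x1]].
    have [l1|g1] := ltP x (1 / 4).
      by left; have := (h0 x); rewrite x0 l1 /Q => /(_ isT)[/(_ Sx) -> _] /=; rewrite in_itv /= x0.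
    right; have [l2|g2] := ltP x (1 / 2).
      by left; have := (h1 x); rewrite g1 l2 /Q => /(_ isT)[/(_ Sx) -> _] /=; rewrite in_itv /= g1.
    right; have [l3|g3] := ltP x (3 / 4).
      by left; have := (h2 x); rewrite g2 l3 /Q => /(_ isT)[/(_ Sx) -> _] /=; rewrite in_itv /= g2.
    by right; have := (h3 x); rewrite g3 x1 /Q => /(_ isT)[/(_ Sx) -> _] /=; rewrite in_itv /= g3.
  have I c d : 0 <= c -> d <= 1 -> c < x < d -> I01 x.
    by rewrite /I01 /= in_itv /= => ? ? /andP[? ?]; apply/andP; split; lra.
  have J c d : 0 < c -> d <= 1 -> c <= x < d -> I01 x.
    by rewrite /I01 /= in_itv /= => ? ? /andP[? ?]; apply/andP; split; lra.
  rewrite /Q => -[|[|[|]]].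
  - case: b0 h0 => // h0; rewrite /= in_itv /= => hx; split; first exact/(h0 _ hx).
    by apply: I hx; lra.
  - case: b1 h1 => // h1; rewrite /= in_itv /= => hx; split; first exact/(h1 _ hx).
    by apply: J hx; lra.
  - case: b2 h2 => // h2; rewrite /= in_itv /= => hx; split; first exact/(h2 _ hx).
    by apply: J hx; lra.
  - case: b3 h3 => // h3; rewrite /= in_itv /= => hx; split; first exact/(h3 _ hx).
    by apply: J hx; lra.
have D b c l k (a1 a2 a3 a4 : R) : a2 <= a3 ->
    Q b (Interval (BSide l a1) (BLeft a2)) `&` Q c (Interval (BSide k a3) (BLeft a4)) = set0.
  move=> a23; rewrite /Q; case: b; case: c; rewrite ?setI0 ?set0I//.
  apply/seteqP; split=> // x []; rewrite /= !in_itv /= => /andP[_ xa2] /andP[].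
  by case: k => /= xa3 _; lra.
have q12 : 1 / 4 <= 1 / 2 :> R by lra.
have q13 : 1 / 4 <= 3 / 4 :> R by lra.
have q23 : 1 / 2 <= 3 / 4 :> R by lra.
have mU b c i j : measurable (Q b i `|` Q c j) by exact: measurableU.
have mU3 : measurable (Q b1 `[1 / 4, 1 / 2[ `|` (Q b2 `[1 / 2, 3 / 4[ `|` Q b3 `[3 / 4, 1[)).
  by apply: measurableU.
have U A B : measurable A -> measurable B -> A `&` B = set0 ->
  lebesgue_measure (A `|` B) = (lebesgue_measure A + lebesgue_measure B)%E.
  move=> mA mB AB; exact: (@measureU _ _ _ lebesgue_measure A B mA mB AB).
have e0 : lebesgue_measure (Q b0 `]0, (1 / 4)[) = (4^-1 * nb b0)%:E by apply: QE; lra.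
have e1 : lebesgue_measure (Q b1 `[1 / 4, 1 / 2[) = (4^-1 * nb b1)%:E by apply: QE; lra.
have e2 : lebesgue_measure (Q b2 `[1 / 2, 3 / 4[) = (4^-1 * nb b2)%:E by apply: QE; lra.
have e3 : lebesgue_measure (Q b3 `[3 / 4, 1[) = (4^-1 * nb b3)%:E by apply: QE; lra.
rewrite U ?setIUr ?D ?setU0// U ?setIUr ?D ?setU0// U ?D// e0 e1 e2 e3.
by rewrite -!EFinD; congr _%:E; ring.
Qed.

(* The values on the four quarters of (0, 1) are [t * a0], ..., [t * a3]. *)
Definition quarter_fun (t : R) (a0 a1 a2 a3 : bool) (x : R) : R :=
  if x < 1 / 4 then t * nb a0 else if x < 1 / 2 then t * nb a1 else
  if x < 3 / 4 then t * nb a2 else t * nb a3.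

Lemma measurable_quarter_fun t a0 a1 a2 a3 D :
  measurable_fun D (quarter_fun t a0 a1 a2 a3).
Proof.
apply: measurable_funTS.
by do 3 (apply: measurable_fun_ifT => //; do ?by apply: measurable_fun_ltr).
Qed.

Lemma quarter_fun_le t a0 a1 a2 a3 x : 0 <= t -> `|quarter_fun t a0 a1 a2 a3 x| <= t.
Proof.
move=> t0; have h b : `|t * nb b| <= t.
  by rewrite normrM (ger0_norm t0) /nb; case: b; rewrite ?normr1 ?mulr1// normr0 mulr0.
by rewrite /quarter_fun; do ![case: ifP => _ //].
Qed.

Lemma Pr_quarter_fun t a0 a1 a2 a3 B : Pr (quarter_fun t a0 a1 a2 a3 @^-1` B) =
  (4^-1 * (nb ((t * nb a0) \in B) + nb ((t * nb a1) \in B) +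
           nb ((t * nb a2) \in B) + nb ((t * nb a3) \in B)))%:E.
Proof.
apply: Pr_quarters => x /andP[x0 x1]; rewrite /= /quarter_fun inE.
- by rewrite x1.
- by rewrite ltNge x0 /= x1.
- have n1 : (x < 1 / 4) = false by apply: le_gtF; lra.
  by rewrite n1 (le_gtF x0) x1.
- have n1 : (x < 1 / 4) = false by apply: le_gtF; lra.
  have n2 : (x < 1 / 2) = false by apply: le_gtF; lra.
  by rewrite n1 n2 (le_gtF x0).
Qed.

(** t times the indicators that the first, respectively the second, binary digit of x is 0: the
    usual model of two independent fair coins. *)
Definition halves (t : R) (k : 'I_2) : R -> R :=
  if k == ord0 then quarter_fun t true true false false
  else quarter_fun t true false true false.

(** The second variable is moved to the complement of the support of the first, which keeps its
    distribution and makes the sum constant. *)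
Definition disjoint_halves (t : R) (k : 'I_2) : R -> R :=
  if k == ord0 then quarter_fun t true true false false
  else quarter_fun t false false true true.

Lemma ord2P (k : 'I_2) : k = ord0 \/ k = lift ord0 ord0.
Proof. by case: k => [[|[|//]] i]; [left|right]; exact: val_inj. Qed.

Lemma halves_equimeasurable t k : equimeasurable (disjoint_halves t k) (halves t k).
Proof.
move=> B _; rewrite /disjoint_halves /halves; case: ifP => // _.
by rewrite !Pr_quarter_fun; congr (_ * _)%:E; ring.
Qed.

Lemma halves_independent t : independent (halves t).
Proof.
move=> B _; rewrite !big_ord_recl big_ord0 mule1.
rewrite [X in (X * _)%E]Pr_quarter_fun [X in (_ * X)%E]Pr_quarter_fun -EFinM.
set B0 := B ord0; set B1 := B (lift ord0 ord0).
have -> : \bigcap_k (halves t k @^-1` B k) =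
    quarter_fun t true true false false @^-1` B0 `&` quarter_fun t true false true false @^-1` B1.
  apply/seteqP; split=> x; first by move=> h; split; [exact: (h ord0 I)|exact: (h (lift ord0 ord0) I)].
  by move=> [h0 h1] k _; have [->|->] := ord2P k.
rewrite (@Pr_quarters _ ((t * nb true \in B0) && (t * nb true \in B1))
  ((t * nb true \in B0) && (t * nb false \in B1))
  ((t * nb false \in B0) && (t * nb true \in B1))
  ((t * nb false \in B0) && (t * nb false \in B1))); last 4 first.
- move=> x /andP[x0 x1]; rewrite /setI /= /quarter_fun x1 -(rwP andP).
  by rewrite !inE.
- move=> x /andP[x0 x1]; rewrite /setI /= /quarter_fun ltNge x0 x1 /= -(rwP andP).
  by rewrite !inE.
- move=> x /andP[x0 x1]; have n1 : (x < 1 / 4) = false by apply: le_gtF; lra.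
  by rewrite /setI /= /quarter_fun n1 (le_gtF x0) x1 -(rwP andP) !inE.
- move=> x /andP[x0 x1]; have n1 : (x < 1 / 4) = false by apply: le_gtF; lra.
  have n2 : (x < 1 / 2) = false by apply: le_gtF; lra.
  by rewrite /setI /= /quarter_fun n1 n2 (le_gtF x0) -(rwP andP) !inE.
congr _%:E.
(* Both sides depend only on whether t and 0 belong to B0 and to B1. The identity holds for all
   sixteen combinations, so t = 0 needs no separate treatment. *)
by case: (t * nb true \in B0); case: (t * nb false \in B0);
  case: (t * nb true \in B1); case: (t * nb false \in B1); rewrite /nb /=; field.
Qed.

Lemma halves_disjoint_sum t : disjoint_sum (halves t) (fun=> t).
Proof.
exists (disjoint_halves t); split.
- by move=> k; rewrite /disjoint_halves; case: ifP => _; exact: measurable_quarter_fun.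
- exact: halves_equimeasurable.
- have D : fsupp (quarter_fun t true true false false) `&`
      fsupp (quarter_fun t false false true true) = set0.
    apply/seteqP; split=> // x []; rewrite /fsupp /= /quarter_fun /nb /=.
    by do ![case: ifP => _]; rewrite ?mulr0 ?eqxx.
  move=> j k; rewrite /disjoint_halves; have [->|->] := ord2P j; have [->|->] := ord2P k => //= _.
    by rewrite D set0I.
  by rewrite [X in X `&` _]setIC D set0I.
- move=> x _; rewrite !big_ord_recl big_ord0 addr0 /disjoint_halves /= /quarter_fun /nb /=.
  by do ![case: ifP => _]; rewrite ?mulr0 ?mulr1 ?addr0 ?add0r.
Qed.

Lemma Pr_halves_supp t : 0 < t -> (\sum_(k < 2) Pr (fsupp (halves t k)) <= 1)%E.
Proof.
move=> t0.
have E k : Pr (fsupp (halves t k)) = (2^-1)%:E.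
  rewrite -[fsupp _]/(halves t k @^-1` [set y | y != 0]) /halves.
  have p1 : (t * nb true \in [set y | y != 0]) = true by apply/idP; rewrite inE /= mulr1 gt_eqF.
  have p0 : (t * nb false \in [set y | y != 0]) = false.
    by apply/negbTE/negP; rewrite inE /= mulr0 eqxx.
  by case: ifP => _; rewrite Pr_quarter_fun p0 p1 /nb /=; congr _%:E; field.
by rewrite !big_ord_recl big_ord0 !E -!EFinD lee_fin; lra.
Qed.

Lemma classical_estimate_double (Phi : R -> R) C t : orlicz_function Phi ->
  classical_estimate Phi C -> 0 < t -> Phi (2 * t) <= 4 * C * Phi t.
Proof.
move=> hPhi hC t0; have [P0 _ _ _] := hPhi.
have mI : measurable (I01 : set R) by exact: measurable_itv.
have EI : EPhi Phi (fun=> t) = (Phi t)%:E.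
  rewrite /EPhi (integral_cst lebesgue_measure mI (Phi t)%:E).
  by rewrite [X in (_ * X)%E](lebesgue_measure_I01 : _ = _) mule1.
have := hC 2%N (halves t) isT _ (halves_independent t) (Pr_halves_supp t0) _ (halves_disjoint_sum t).
have mh k D : measurable_fun D (halves t k).
  by rewrite /halves; case: ifP => _; exact: measurable_quarter_fun.
move=> /(_ _)/wrap[k|].
  apply: (bounded_in_LPhi hPhi (K := t)) => // x _.
  by rewrite /halves; case: ifP => _; apply: quarter_fun_le; exact: ltW.
rewrite EI => h.
suff : (((4^-1) * Phi (2 * t))%:E <= (C * Phi t)%:E)%E by rewrite lee_fin; lra.
rewrite [leRHS]EFinM; apply: le_trans h.
(* On the first quarter both variables equal t; the integral over the rest is bounded below by 0. *)
have sub : `]0, (1 / 4)[%classic `<=` (I01 : set R).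
  by move=> x; rewrite /I01 /= !in_itv /= => /andP[? ?]; apply/andP; split; lra.
apply: (@le_trans _ _ (\int[lebesgue_measure]_(x in `]0%R, (1 / 4)%R[) (Phi (2 * t))%:E)%E).
  rewrite integral_cst//= lebesgue_measure_itv /= lte_fin divr_gt0// -EFinB -EFinM lee_fin.
  by rewrite mulrC subr0 div1r.
have -> : (\int[lebesgue_measure]_(x in `]0%R, (1 / 4)%R[) (Phi (2 * t))%:E =
    \int[lebesgue_measure]_(x in `]0%R, (1 / 4)%R[) (Phi (\sum_(k < 2) halves t k x))%:E)%E.
  apply: eq_integral => x; rewrite inE /= in_itv /= => /andP[x0 x1].
  rewrite !big_ord_recl big_ord0 addr0 /halves /= /quarter_fun x1 /nb /= mulr1.
  by congr (Phi _)%:E; ring.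
apply: ge0_subset_integral => //.
- apply/measurable_EFinP; apply: (measurableT_comp (measurable_orlicz hPhi)).
  by apply: measurable_sum => k; exact: mh.
- by move=> x _; rewrite lee_fin.
Qed.

End ClassicalPair.

Theorem theorem1p7 (R : realType) (Phi : R -> R) (hPhi : orlicz_function Phi)
  (hC : exists2 C : R, 0 < C & classical_estimate Phi C \/ free_estimate Phi C) :
  Delta2 Phi.
Proof.
have [C C0 [hc|hf]] := hC.
  by exists (4 * C) => t t0; exact: classical_estimate_double.
exists ((8 * C) * (8 * C)) => t t0.
have C8 : 0 <= 8 * C by rewrite mulr_ge0// ltW.
have h1 := free_estimate_step hPhi hf t0.
have s0 : 0 < 3 / 2 * t by lra.
have h2 := free_estimate_step hPhi hf s0.
rewrite -mulrA; apply: le_trans (ler_wpM2l C8 h1); apply: le_trans h2.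
by apply: orlicz_le hPhi _ _ _; apply/andP; split; lra.
Qed.
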